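(* Let $W$ be a $(0,1)$-valued random variable, let $K_n^*(t)$, $t\in[0,1]$, be the number of boxes containing at least one and at most $n^t$ balls in the Bernoulli sieve driven by $W$ after $n$ balls have been placed, and let $K_n^*=K_n^*(1)$ (definitions in the context). Suppose that $\mathbb{P}\{|\log W|>x\}\sim x^{-\alpha}\ell(x)$ as $x\to\infty$ for some $\alpha\in(0,1)$ and some $\ell$ slowly varying at infinity. Then, as $n\to\infty$, $$\left(\frac{\ell(\log n)K_n^*(t)}{(\log n)^\alpha}\right)_{t\in[0,1]}\Longrightarrow\big(W_\alpha^{\leftarrow}(1)-W_\alpha^{\leftarrow}((1-t)-)\big)_{t\in[0,1]}$$ and $$\left(\frac{K_n^*(t)}{K_n^*}\right)_{t\in[0,1]}\Longrightarrow\left(1-\frac{W_\alpha^{\leftarrow}((1-t)-)}{W_\alpha^{\leftarrow}(1)}\right)_{t\in[0,1]}$$ weakly in $D[0,1]$ endowed with the $J_1$-topology, where $W_\alpha^{\leftarrow}(t):=\inf\{s\ge0:W_\alpha(s)>t\}$ for $t\ge0$ and $(W_\alpha(s))_{s\ge0}$ is an $\alpha$-stable subordinator (nondecreasing Lévy process) with Laplace exponent $-\log\mathbb{E}\exp(-zW_\alpha(1))=\Gamma(1-\alpha)z^\alpha$, $z\ge0$.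
   Context: Bernoulli sieve: let $W_1,W_2,\ldots$ be independent copies of a $(0,1)$-valued random variable $W$; put $V_0:=1$ and $V_n:=\prod_{i=1}^n W_i$ for $n\in\mathbb{N}=\{1,2,\ldots\}$. Box $i\in\mathbb{N}$ is the interval $(V_i,V_{i-1}]$. Let $(U_j)_{j\in\mathbb{N}}$ be independent uniform $(0,1)$ random variables, independent of $(W_k)_{k\in\mathbb{N}}$; ball $j$ goes into box $i$ iff $V_i<U_j\le V_{i-1}$. The number of balls in box $i$ after $n$ balls have been placed is $Z_{n,i}^*:=\#\{1\le j\le n:U_j\in(V_i,V_{i-1}]\}$. For $t\in[0,1]$, $K_n^*(t):=\sum_{i\ge1}\mathbf{1}_{\{1\le Z_{n,i}^*\le n^t\}}$, and $K_n^*:=K_n^*(1)$ is the number of nonempty boxes. $D[0,1]$ is the Skorohod space of real-valued functions on $[0,1]$ that are right-continuous with left-hand limits, with Skorohod's usual $J_1$-topology. $f(s-)$ denotes the left limit of $f$ at $s$, with $W_\alpha^{\leftarrow}(0-):=0$. $\Gamma$ is the gamma function; $f(x)\sim g(x)$ means $f(x)/g(x)\to1$. *)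

(* Defs.v *)
From HB Require Import structures.
From mathcomp Require Import all_boot all_order all_algebra.
From mathcomp Require Import all_classical all_reals all_analysis.
Import Order.TTheory GRing.Theory Num.Theory numFieldNormedType.Exports.

Set Implicit Arguments.
Unset Strict Implicit.
Unset Printing Implicit Defensive.

Local Open Scope classical_set_scope.
Local Open Scope ring_scope.

Section skorohod_space.
Variable R : realType.
Implicit Types (f g h l m : R -> R) (t x y e : R).

Definition cadlag01 f : Prop :=
  (forall t, 0 <= t < 1 -> f x @[x --> t^'+] --> f t) /\
  (forall t, 0 < t <= 1 -> cvg (f x @[x --> t^'-])).

(* Only the values on [0,1] matter: two elements that agree on [0,1] are at
   Skorohod distance 0, so they are not separated by the topology below and
   every continuous functional takes the same value at both. *)
Record skorohod : Type := Skorohod {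
  sko_fun :> R -> R ;
  sko_cadlag : cadlag01 sko_fun }.

HB.instance Definition _ := gen_eqMixin skorohod.
HB.instance Definition _ := gen_choiceMixin skorohod.

Lemma cadlag01_cst (c : R) : cadlag01 (fun=> c).
Proof.
split=> t _; first exact: cvg_cst.
exact: is_cvg_cst.
Qed.

(* Sends a path outside D[0,1] to the zero path; in [weak_cvg_D] below this
   only happens on a null event. *)
Definition to_D f : skorohod :=
  if pselect (cadlag01 f) is left fD then Skorohod fD
  else Skorohod (cadlag01_cst 0).

(* Increasing bijections of [0,1]; continuity and l 0 = 0, l 1 = 1 follow. *)
Definition time_change l : Prop :=
  [/\ forall t, 0 <= t <= 1 -> 0 <= l t <= 1,
      forall s t, 0 <= s -> s < t -> t <= 1 -> l s < l t &
      forall y, 0 <= y <= 1 -> exists2 t, 0 <= t <= 1 & l t = y].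

(* Open ball of the metric
   d(f,g) = inf_l max (sup_t |l t - t|, sup_t |f (l t) - g t|),
   which induces the J1 topology. *)
Definition j1_ball (f : skorohod) e (g : skorohod) : Prop :=
  exists l, exists2 r, r < e & time_change l /\
    forall t, 0 <= t <= 1 -> `|l t - t| <= r /\ `|f (l t) - g t| <= r.

Lemma j1_ball_center (f : skorohod) e : 0 < e -> j1_ball f e f.
Proof.
move=> e0; exists id, 0 => //; split; last by move=> t _; rewrite !subrr normr0.
by split=> // y y01; exists y.
Qed.

Lemma j1_ball_sym (f g : skorohod) e : j1_ball f e g -> j1_ball g e f.
Proof.
move=> [l [r re [[l01 lmono lsurj] lr]]].
have [m mP] : exists m : R -> R,
    forall y, 0 <= y <= 1 -> 0 <= m y <= 1 /\ l (m y) = y.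
  have /choice[m mP] : forall y, exists t,
      0 <= y <= 1 -> 0 <= t <= 1 /\ l t = y.
    move=> y; have [y01|ny01] := pselect (is_true (0 <= y <= 1)).
      by have [t t01 lt] := lsurj y y01; exists t.
    by exists 0 => /ny01.
  by exists m.
exists m, r => //; split; last first.
  move=> t t01; have [mt01 lmt] := mP t t01.
  have [] := lr (m t) mt01; rewrite lmt => h1 h2.
  by rewrite distrC h1 distrC h2.
split.
- by move=> t t01; have [] := mP t t01.
- move=> s t s0 st t1.
  have [/andP[ms0 ms1] lms] := mP s (introT andP (conj s0 (ltW (lt_le_trans st t1)))).
  have [/andP[mt0 mt1] lmt] := mP t (introT andP (conj (ltW (le_lt_trans s0 st)) t1)).
  rewrite ltNge; apply/negP; rewrite le_eqVlt => /orP[/eqP mm|mm].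
    by move: st; rewrite -lms -lmt mm ltxx.
  by have := lmono _ _ mt0 mm ms1; rewrite lms lmt ltNge (ltW st).
- move=> y y01; exists (l y); first exact: l01.
  have [/andP[h0 h1] h] := mP _ (l01 _ y01).
  move: y01 => /andP[y0 y1].
  have [hlt|hgt|//] := ltgtP (m (l y)) y.
    by have := lmono _ _ h0 hlt y1; rewrite h ltxx.
  by have := lmono _ _ y0 hgt h1; rewrite h ltxx.
Qed.

Lemma j1_ball_triangle (f g h : skorohod) e1 e2 :
  j1_ball f e1 g -> j1_ball g e2 h -> j1_ball f (e1 + e2) h.
Proof.
move=> [l [r re [[l01 lmono lsurj] lr]]] [m [s se [[m01 mmono msurj] ms]]].
exists (l \o m), (r + s); first exact: ltrD.
split; last first.
  move=> t t01; have [a1 a2] := lr (m t) (m01 t t01).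
  have [b1 b2] := ms t t01.
  split.
    by rewrite (le_trans (ler_distD (m t) _ _))// lerD.
  by rewrite (le_trans (ler_distD (g (m t)) _ _))// lerD.
split.
- by move=> t t01; apply/l01/m01.
- move=> x y x0 xy y1 /=.
  have /andP[mx0 _] := m01 x (introT andP (conj x0 (ltW (lt_le_trans xy y1)))).
  have /andP[_ my1] := m01 y (introT andP (conj (ltW (le_lt_trans x0 xy)) y1)).
  by apply: lmono => //; exact: mmono.
- move=> y /lsurj[u /msurj[v v01 <-] <-].
  by exists v.
Qed.

HB.instance Definition _ :=
  hasNbhs.Build skorohod (nbhs_ (entourage_ j1_ball)).
HB.instance Definition _ := @Nbhs_isPseudoMetric.Build R skorohod
  (entourage_ j1_ball) erefl j1_ball
  j1_ball_center j1_ball_sym j1_ball_triangle erefl.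

End skorohod_space.

Definition weak_cvg_D (R : realType) d (T : measurableType d)
    (P : probability T R) d' (T' : measurableType d') (Q : probability T' R)
    (X : nat -> T -> R -> R) (Y : T' -> R -> R) : Prop :=
  [/\ forall n, {ae P, forall w, cadlag01 (X n w)},
      {ae Q, forall w, cadlag01 (Y w)} &
      forall F : skorohod R -> R, continuous F ->
        (exists M : R, forall f, `|F f| <= M) ->
        'E_P[fun w => F (to_D (X n w))]%E @[n --> \oo] -->
        'E_Q[fun w => F (to_D (Y w))]%E].

Definition same_law (R : realType) d (T : measurableType d)
    (P : probability T R) d' (T' : measurableType d') (Q : probability T' R)
    (X : T -> R) (Y : T' -> R) : Prop :=
  forall B : set R, measurable B -> pushforward P X B = pushforward Q Y B.

Definition mutually_independent (R : realType) d (T : measurableType d)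
    (P : probability T R) (I : eqType) (X : I -> T -> R) : Prop :=
  forall (s : seq I) (B : I -> set R), uniq s ->
    (forall i, measurable (B i)) ->
    P [set w | forall i, i \in s -> B i (X i w)] =
    (\prod_(i <- s) P (X i @^-1` B i))%E.

Section bernoulli_sieve.
Context (R : realType) d (T : measurableType d) (P : probability T R).
Variables (W U : nat -> {RV P >-> R}).

(* Sequences are indexed from 0: [W k], [U k] stand for the variables of index
   k + 1, and [sieve_box i] is the box of index i + 1. Independence of the
   family indexed by nat + nat says that the W k are independent, the U j are
   independent, and the two sequences are independent of each other. *)
Definition bernoulli_sieve d0 (T0 : measurableType d0) (P0 : probability T0 R)
    (W0 : {RV P0 >-> R}) : Prop :=
  [/\ forall k w, 0 < W k w < 1,
      forall k, same_law P P0 (W k) W0,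
      forall j (B : set R), measurable B ->
        distribution P (U j) B = uniform_prob (@ltr01 R) B &
      mutually_independent P (fun i : nat + nat =>
        match i with inl k => W k : T -> R | inr j => U j end)].

Definition sieve_V (n : nat) (w : T) : R := \prod_(i < n) W i w.

Definition sieve_box (i : nat) (w : T) : set R :=
  `]sieve_V i.+1 w, sieve_V i w]%classic.

Definition sieve_Z (n i : nat) (w : T) : nat :=
  #|[set j : 'I_n | U j w \in sieve_box i w]%SET|.

Definition sieve_K (n : nat) (t : R) (w : T) : R :=
  fine (\sum_(0 <= i <oo)
    ((1 <= sieve_Z n i w)%N && ((sieve_Z n i w)%:R <= n%:R `^ t))%:R%:E)%E.

End bernoulli_sieve.

Definition slowly_varying (R : realType) (l : R -> R) : Prop :=
  [/\ exists a : R, measurable_fun `[a, +oo[ l,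
      \forall x \near +oo, 0 < l x &
      forall c : R, 0 < c -> l (c * x) / l x @[x --> +oo] --> (1 : R)].

Definition Gamma (R : realType) (x : R) : R :=
  \int[lebesgue_measure]_(t in `]0, +oo[) (t `^ (x - 1) * expR (- t)).

Section subordinator.
Context (R : realType) d (T : measurableType d) (P : probability T R).
Variable S : R -> {RV P >-> R}.

(* [S s] is meaningful for s >= 0 only. *)
Definition subordinator : Prop :=
  [/\ {ae P, forall w, S 0 w = 0},
      forall t : nat -> R, 0 <= t 0 ->
        {homo t : m n / (m <= n)%N >-> m <= n} ->
        mutually_independent P (fun k => S (t k.+1) \- S (t k)),
      forall s h : R, 0 <= s -> 0 <= h ->
        same_law P P (S (s + h) \- S s) (S h \- S 0),
      {ae P, forall w, forall s : R, 0 <= s ->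
        S x w @[x --> s^'+] --> S s w /\
        (0 < s -> cvg (S x w @[x --> s^'-]))} &
      {ae P, forall w, forall s t : R, 0 <= s -> s <= t -> S s w <= S t w}].

Definition laplace_exponent (z : R) : R :=
  - ln (fine 'E_P[fun w => expR (- z * S 1 w)]%E).

Definition first_passage (t : R) (w : T) : R :=
  inf [set s | 0 <= s /\ t < S s w].

Definition first_passage_left (t : R) (w : T) : R :=
  if t <= 0 then 0 else lim (first_passage x w @[x --> t^'-]).

End subordinator.

(* Main.v *)
From HB Require Import structures.
Require Import Defs.
From mathcomp Require Import all_boot all_order all_algebra.
From mathcomp Require Import all_classical all_reals all_analysis.
From mathcomp Require Import measurable_realfun ring lra.
Import Order.TTheory GRing.Theory Num.Theory numFieldNormedType.Exports.
Local Open Scope classical_set_scope.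
Local Open Scope ring_scope.

Set Implicit Arguments.
Unset Strict Implicit.
Unset Printing Implicit Defensive.

(** Put [x := ln n] and [b := x `^ alpha / l x], the [scaling] at [x].  Given the
    [W i], box [l] receives about [n * V l * (1 - W l)] balls.  On the logarithmic
    scale the factor [1 - W l] is negligible for all but a few boxes, so box [l] has
    more than [n `^ (1 - u)] balls roughly when [V l > n `^ (- u)], that is, when the
    random walk [- ln (V l)] is below [u * x].  Hence [K n 1 - K n (1 - u)] is close to
    the first passage time of this walk above [u * x].  The steps of the walk have
    the tail of an [alpha]-stable law, the walk run for [b * s] steps and divided by
    [x] converges to the subordinator at time [s], and [b^-1 * (K n 1 - K n (1 - u))]
    converges to the passage time of the subordinator above [u].  The subordinator
    is strictly increasing, so its passage time is continuous in the level; this is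
    why left limits do not matter in the limit, and why it suffices to control
    functionals at limit paths in the uniform distance.

    The convergence of the walk enters through finitely many numbers.  Cut the boxes
    into blocks of about [b / N] boxes and let [r i] be the product of the
    [W l `^ x^-1] over block [i].  These ratios are independent with values in [0, 1],
    and an Abelian theorem for the Laplace transform of [- ln W] ([abelian],
    [cvg_block_laplace]) shows that their joint moments converge to those of the
    exponentials of minus the increments of the subordinator ([Ex_incr_prod]).
    Approximation by Bernstein polynomials extends this to the mean of every
    Lipschitz function of finitely many ratios ([cvg_Ex_ratio]).

    A path [y] is [consistent] with given ratios, up to a tolerance [dl], when
    [y 1 - y (1 - u)] obeys the bounds on the passage time that can be read off from
    these ratios.  Two facts relate this notion to the theorem: off an event of small
    probability the rescaled sieve is consistent with its own ratios
    ([sieve_consistent_whp], which rests on a bound for the variance of the number of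
    balls in a box), and a path consistent with a fine discretisation of a strictly
    increasing path is uniformly close to the limit announced in the theorem
    ([consistent_close]).

    For a bounded functional [Phi], the infimum of [Phi y + k * dl] over all paths [y]
    and tolerances [dl] consistent with [r] is a Lipschitz function of [r]
    ([lip_pen_inf]).  It is almost a lower bound of [Phi] at the rescaled sieve, and
    it tends to [Phi] at the limit path when the mesh tends to 0 and [k] to infinity.
    Therefore the lower limit of the means of [Phi] at the sieve is at least the mean
    of [Phi] at the limit ([lower_bound]); with [- Phi] in place of [Phi] one gets
    convergence ([cvg_Ex_path]).  All the comparisons are between expectations of
    bounded functions ordered almost surely ([expectation_le_ae]), so they apply to
    functionals of paths as they stand.

    The first claim is this convergence for continuous functionals on the Skorohod
    space.  The second one applies it after the map [y |-> y / y 1], which is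
    continuous at the limit path because the passage time above 1 is positive. *)

(** * Expectations of arbitrary bounded functions *)

Lemma measurable_natr_bool d (T : measurableType d) (R : realType) (p : T -> bool) :
  measurable_fun setT p -> measurable_fun setT (fun w => (p w)%:R : R).
Proof. exact: (@measurableT_comp _ _ _ _ _ _ (fun c : bool => c%:R : R)). Qed.

Section expectation_any.
Context d (T : measurableType d) (R : realType) (P : probability T R).
Implicit Types f g : T -> R.
Import HBNNSimple.

(** The integral of a nonnegative function is the supremum of the integrals of the
    simple functions below it, and a simple function can be cut off on a null set.
    This gives monotonicity for arbitrary functions. *)
Lemma ge0_le_integral_ae (f g : T -> \bar R) :
  (forall w, (0 <= f w)%E) -> (forall w, (0 <= g w)%E) ->
  {ae P, forall w, (f w <= g w)%E} -> (\int[P]_w f w <= \int[P]_w g w)%E.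
Proof.
move=> f0 g0 [N [mN PN fgN]].
rewrite (ge0_integralTE _ f0) (ge0_integralTE _ g0).
apply: ge_ereal_sup => _ [h /= hf <-].
have mNC : measurable (~` N) by exact: measurableC.
apply: le_ereal_sup_tmp.
exists (sintegral P (mul_nnsfun h (indic_nnsfun R mNC))).
  exists (mul_nnsfun h (indic_nnsfun R mNC)) => //= w.
  rewrite [X in _ * X]indicE; have [wN|wN] := boolP (w \in ~` N).
    rewrite mulr1 (le_trans (hf w))//.
    by apply: contrapT => /fgN; rewrite inE in wN.
  by rewrite mulr0.
rewrite -!integralT_nnsfun.
rewrite [leLHS](@ge0_negligible_integral _ _ _ P setT N)//=; last 2 first.
- exact/measurable_EFinP.
- by move=> w _; rewrite lee_fin.
rewrite integral_mkcond; apply: ge0_le_integral => //=.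
- by move=> w _; rewrite patchE; case: ifP => // _; rewrite lee_fin.
- apply: (measurable_restrictT _ _).1; first exact: measurableD.
  by apply/measurable_EFinP; exact: measurable_funTS.
- pose k : {nnsfun T >-> R} := mul_nnsfun h (indic_nnsfun R mNC).
  by apply/(measurable_EFinP _ k).
- move=> w _; rewrite patchE [X in _ * X]indicE setTD; case: ifP => //= _.
    by rewrite mulr1.
by rewrite mulr0.
Qed.

Lemma expectation_le_ae f g : {ae P, forall w, f w <= g w} ->
  ('E_P[f] <= 'E_P[g])%E.
Proof.
move=> fg; rewrite unlock integralE [leRHS]integralE; apply: leeB.
- apply: ge0_le_integral_ae => //; apply: filterS fg => w fgw.
  by rewrite !funeposE /= -!EFin_max lee_fin ge_max !le_max fgw lexx orbT.
- apply: ge0_le_integral_ae => //; apply: filterS fg => w fgw.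
  rewrite !funenegE /= -!EFin_max lee_fin ge_max !le_max lerN2 fgw.
  by rewrite lexx orbT.
Qed.

(** For a bounded function that is not measurable this is the difference of the
    lower integrals of its positive and negative parts: it is monotone and odd, but
    additive only on measurable functions. *)
Definition Ex f : R := fine ('E_P[f])%E.

Lemma expectation_bounded_fin_num f (M : R) : (forall w, `|f w| <= M) ->
  ('E_P[f])%E \is a fin_num.
Proof.
move=> fM; rewrite fin_numE; apply/andP; split; apply/eqP => Ef.
  have : ((- M)%:E <= 'E_P[f])%E.
    rewrite -(expectation_cst P); apply: expectation_le_ae.
    by apply: aeW => w /=; have := fM w; rewrite ler_norml => /andP[].
  by rewrite Ef.
have : ('E_P[f] <= M%:E)%E.
  rewrite -(expectation_cst P); apply: expectation_le_ae.
  by apply: aeW => w /=; have := fM w; rewrite ler_norml => /andP[].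
by rewrite Ef.
Qed.

Lemma expectation_bounded f (M : R) : (forall w, `|f w| <= M) ->
  ('E_P[f] = (Ex f)%:E)%E.
Proof. by move=> /expectation_bounded_fin_num/fineK. Qed.

Lemma Ex_cst c : Ex (fun=> c) = c.
Proof. by rewrite /Ex expectation_cst. Qed.

Lemma Ex_le_ae f g (M : R) : (forall w, `|f w| <= M) -> (forall w, `|g w| <= M) ->
  {ae P, forall w, f w <= g w} -> Ex f <= Ex g.
Proof.
move=> fM gM /expectation_le_ae.
by rewrite (expectation_bounded fM) (expectation_bounded gM).
Qed.

Lemma Ex_le f g (M : R) : (forall w, `|f w| <= M) -> (forall w, `|g w| <= M) ->
  (forall w, f w <= g w) -> Ex f <= Ex g.
Proof. by move=> fM gM fg; apply: (Ex_le_ae fM gM); exact: aeW. Qed.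

Lemma ExN f (M : R) : (forall w, `|f w| <= M) -> Ex (fun w => - f w) = - Ex f.
Proof.
move=> fM.
have fMN w : `|- f w| <= M by rewrite normrN.
have pos g : (forall w, `|g w| <= M) ->
    (\int[P]_w (EFin \o g)^\+ w)%E \is a fin_num.
  move=> gM; rewrite (_ : (fun w => _) = fun w => (Num.max (g w) 0)%:E); last first.
    by apply/funext => w; rewrite funeposE /= -EFin_max.
  have := @expectation_bounded_fin_num (fun w => Num.max (g w) 0) M.
  rewrite unlock; apply => w; rewrite /Num.max; case: ifP => // _.
  by rewrite normr0; exact: le_trans (gM w).
rewrite /Ex unlock integralE [in RHS]integralE.
have e1 : ((fun w => (- f w)%:E)^\+ = (EFin \o f)^\-)%E.
  by apply/funext => w; rewrite funeposE funenegE.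
have e2 : ((fun w => (- f w)%:E)^\- = (EFin \o f)^\+)%E.
  by apply/funext => w; rewrite funeposE funenegE /= opprK.
have pf := pos _ fM.
have pg : (\int[P]_w (EFin \o f)^\- w)%E \is a fin_num.
  by rewrite -e1; exact: pos.
rewrite e1 e2 fineB// [in RHS]fineB//.
by rewrite opprB.
Qed.

(** An algebra of functions on which [Ex] is linear. *)
Definition bmeas f := measurable_fun setT f /\ exists M : R, forall w, `|f w| <= M.

Lemma bmeas_integrable f : bmeas f -> P.-integrable setT (EFin \o f).
Proof.
move=> [mf [M fM]]; apply: measurable_bounded_integrable => //.
  by rewrite (le_lt_trans (probability_le1 _ _))// ltry.
exists M; split; first exact: num_real.
by move=> x Mx w _ /=; apply: le_trans (fM w) _; exact: ltW.
Qed.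

Lemma bmeas_Lfun f : bmeas f -> f \in Lfun P 1.
Proof. by move=> bf; apply/Lfun1_integrable/bmeas_integrable. Qed.

Lemma bmeas_fin f : bmeas f -> ('E_P[f] = (Ex f)%:E)%E.
Proof. by move=> [_ [M /expectation_bounded]]. Qed.

Lemma bmeas_cst c : bmeas (fun=> c).
Proof. by split=> //; exists `|c|. Qed.

Lemma bmeasD f g : bmeas f -> bmeas g -> bmeas (fun w => f w + g w).
Proof.
move=> [mf [M fM]] [mg [N gN]]; split; first exact: measurable_funD.
by exists (M + N) => w; rewrite (le_trans (ler_normD _ _))// lerD.
Qed.

Lemma bmeasM f g : bmeas f -> bmeas g -> bmeas (fun w => f w * g w).
Proof.
move=> [mf [M fM]] [mg [N gN]]; split; first exact: measurable_funM.
by exists (M * N) => w; rewrite normrM ler_pM.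
Qed.

Lemma bmeas_exp f n : bmeas f -> bmeas (fun w => f w ^+ n).
Proof.
move=> bf; elim: n => [|n IH].
  by rewrite (_ : (fun w => _) = fun=> 1); [exact: bmeas_cst|apply/funext].
rewrite (_ : (fun w => _) = fun w => f w * f w ^+ n); first exact: bmeasM.
by apply/funext => w; rewrite exprS.
Qed.

Lemma bmeas_prod I (s : seq I) (F : I -> T -> R) : (forall i, bmeas (F i)) ->
  bmeas (fun w => \prod_(i <- s) F i w).
Proof.
move=> bF; elim: s => [|i s IH].
  rewrite (_ : (fun w => _) = fun=> 1); first exact: bmeas_cst.
  by apply/funext => w; rewrite big_nil.
rewrite (_ : (fun w => _) = fun w => F i w * \prod_(j <- s) F j w).
  exact: bmeasM.
by apply/funext => w; rewrite big_cons.
Qed.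

Lemma ExD f g : bmeas f -> bmeas g -> Ex (fun w => f w + g w) = Ex f + Ex g.
Proof.
move=> bf bg; apply: EFin_inj; rewrite -bmeas_fin; last exact: bmeasD.
by rewrite EFinD -!bmeas_fin// -expectationD//; exact: bmeas_Lfun.
Qed.

Lemma ExZ c f : bmeas f -> Ex (fun w => c * f w) = c * Ex f.
Proof.
move=> bf; apply: EFin_inj; rewrite -bmeas_fin; last first.
  by apply: bmeasM => //; exact: bmeas_cst.
rewrite EFinM -!bmeas_fin// -expectationZl//; last exact: bmeas_Lfun.
by congr expectation; apply/funext => w /=; rewrite mulrC.
Qed.

(** [f] is compared with the measurable functions [g - e] and [g + e], on which [Ex]
    is additive. *)
Lemma Ex_dist f g (e M N : R) : (forall w, `|f w| <= M) -> (forall w, `|g w| <= N) ->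
  bmeas g -> (forall w, `|f w - g w| <= e) -> `|Ex f - Ex g| <= e.
Proof.
move=> fM gN bg fg; rewrite ler_distl; apply/andP; split.
  have -> : Ex g - e = Ex (fun w => g w + (- e)).
    by rewrite ExD// ?Ex_cst//; exact: bmeas_cst.
  apply: (@Ex_le _ _ (M + (N + `|e|))) => w.
  - rewrite (le_trans (ler_normD _ _))// normrN.
    have := normr_ge0 (f w); have := fM w; have := gN w; lra.
  - have := normr_ge0 e; have := fM w; have := gN w.
    by have := normr_ge0 (g w); lra.
  - by have := fg w; rewrite ler_distl => /andP[] ; lra.
have -> : Ex g + e = Ex (fun w => g w + e).
  by rewrite ExD// ?Ex_cst//; exact: bmeas_cst.
apply: (@Ex_le _ _ (M + (N + `|e|))) => w.
- have := normr_ge0 e; have := fM w; have := gN w.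
  by have := normr_ge0 (g w); lra.
- rewrite (le_trans (ler_normD _ _))//.
  have := normr_ge0 (f w); have := fM w; have := gN w; lra.
- by have := fg w; rewrite ler_distl => /andP[]; lra.
Qed.
End expectation_any.

(** Dominated convergence to an arbitrary function, which off a null set is a limit
    of measurable functions. *)
Lemma cvg_Ex_ae (R : realType) d (T : measurableType d) (P : probability T R)
    (g : nat -> T -> R) (f : T -> R) (M : R) :
  0 <= M -> (forall j, measurable_fun setT (g j)) -> (forall j w, `|g j w| <= M) ->
  (forall w, `|f w| <= M) -> {ae P, forall w, g j w @[j --> \oo] --> f w} ->
  Ex P (g j) @[j --> \oo] --> Ex P f.
Proof.
move=> M0 mg gM fM hcvg; have := hcvg => -[N [mN PN hN]].
pose c w : R := \1_(~` N) w.
have mc : measurable_fun setT c by apply: measurable_indic; exact: measurableC.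
have c01 w : `|c w| <= 1 by rewrite /c indicE; case: (w \in _); rewrite ?normr1 ?normr0.
have mf : measurable_fun setT (fun w => f w * c w).
  apply: (@measurable_fun_cvg _ _ _ _ (fun j w => g j w * c w)) => //.
    by move=> j; exact: measurable_funM.
  move=> w _; rewrite /c indicE; have [wN|wN] := boolP (w \in ~` N).
    apply: cvgMl; apply: contrapT => h.
    by move: wN; rewrite inE; apply; apply: hN.
  by rewrite mulr0; under eq_fun do rewrite mulr0; exact: cvg_cst.
have ff : {ae P, forall w, f w = f w * c w}.
  exists N; split => // w; apply: contra_notP => wN.
  by rewrite /= /c indicE (_ : (w \in ~` N) = true) ?mulr1//; exact/mem_set.
have fcM w : `|f w * c w| <= M.
  by rewrite normrM (le_trans (ler_piMr _ (c01 w))).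
have Ef : Ex P f = Ex P (fun w => f w * c w).
  apply/le_anti/andP; split.
    by apply: (Ex_le_ae fM fcM); apply: filterS ff => w <-.
  by apply: (Ex_le_ae fcM fM); apply: filterS ff => w <-.
rewrite Ef.
have bf : bmeas (fun w => f w * c w) by split=> //; exists M.
have bg j : bmeas (g j) by split=> //; exists M.
have iM : P.-integrable setT (fun=> M%:E).
  by exact: (bmeas_integrable P (bmeas_cst T M)).
have [||||_ _ h] := @dominated_convergence _ T R P setT measurableT
    (fun j w => (g j w)%:E) (fun w => (f w * c w)%:E) (fun=> M%:E) _ _ _ iM.
- by move=> j; exact/measurable_EFinP.
- exact/measurable_EFinP.
- apply: filterS2 hcvg ff => w h1 h2 _; rewrite -h2.
  by apply: cvg_EFin => //; exact: nearW.
- by apply: aeW => w j _; rewrite abse_EFin lee_fin.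
have {}h : (fun j => (Ex P (g j))%:E) @ \oo --> (Ex P (fun w => f w * c w))%:E.
  rewrite -(bmeas_fin P bf) unlock.
  by under eq_fun do rewrite -(bmeas_fin P (bg _)) unlock.
exact: (fine_cvg h).
Qed.

(** * Approximation by polynomials on the cube *)

Section bernstein.
Variable R : realType.
Implicit Types (f g : nat -> R) (x : R).

(** The [N]-th Bernstein operator, as the mean of [f] at the number of successes in
    [N] independent trials of success probability [x]; the recursion conditions on
    the first trial. *)
Fixpoint bern (N : nat) f x : R :=
  if N is N'.+1 then x * bern N' (fun k => f k.+1) x + (1 - x) * bern N' f x
  else f 0%N.

Lemma bern_le N f g x : 0 <= x <= 1 -> (forall k, f k <= g k) ->
  bern N f x <= bern N g x.
Proof.
move=> /andP[x0 x1]; elim: N f g => //= N IH f g fg.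
by apply: lerD; apply: ler_wpM2l => //; rewrite ?subr_ge0// IH.
Qed.

Lemma bern_affine N f a b x : bern N (fun k => a * f k + b) x = a * bern N f x + b.
Proof. by elim: N f => //= N IH f; rewrite !IH; ring. Qed.

Lemma bern_dist N f g c x : 0 <= x <= 1 -> (forall k, `|f k - c| <= g k) ->
  `|bern N f x - c| <= bern N g x.
Proof.
move=> x01 fg; rewrite ler_distl; apply/andP; split.
  rewrite lerBlDr -lerBlDl.
  have -> : c - bern N f x = bern N (fun k => (-1) * f k + c) x.
    by rewrite bern_affine; ring.
  by apply: bern_le => // k; have := fg k; rewrite ler_distl => /andP[]; lra.
have -> : c + bern N g x = bern N (fun k => 1 * g k + c) x.
  by rewrite bern_affine; ring.
by apply: bern_le => // k; have := fg k; rewrite ler_distl => /andP[]; lra.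
Qed.

Lemma bern_variance N a x :
  bern N (fun k => (k%:R - a) ^+ 2) x = (N%:R * x - a) ^+ 2 + N%:R * (x * (1 - x)).
Proof.
elim: N a => [|N IH] a /=; first by rewrite !mul0r addr0.
have -> : (fun k : nat => (k.+1%:R - a) ^+ 2) = fun k => (k%:R - (a - 1)) ^+ 2.
  by apply/funext => k; rewrite -natr1; congr (_ ^+ 2); ring.
by rewrite !IH -natr1; ring.
Qed.

Definition cube (r : nat -> R) := forall i, 0 <= r i <= 1.
Definition upd (r : nat -> R) j c := fun i => if i == j then c else r i.

(* [C] is a class of functions of the first [L] coordinates; functions that are
   close on the cube are not distinguished. *)
Variables (L : nat) (C : ((nat -> R) -> R) -> Prop).
Hypothesis CD : forall h k, C h -> C k -> C (fun r => h r + k r).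
Hypothesis CZ : forall a h, C h -> C (fun r => a * h r).
Hypothesis Clim : forall h, (forall e : R, 0 < e -> exists2 k, C k &
  forall r, cube r -> `|h r - k r| <= e) -> C h.
Let mon (m : nat -> nat) (r : nat -> R) : R := \prod_(i < L) r i ^+ m i.
Hypothesis Cmon : forall m, C (mon m).

Definition lip j (g : (nat -> R) -> R) := exists2 K : R, 0 <= K &
  forall r s, cube r -> cube s -> `|g r - g s| <= K * \sum_(i < j) `|r i - s i|.

Let mon_le1 m r : cube r -> 0 <= mon m r <= 1.
Proof.
move=> cr; apply/andP; split.
  by apply: prodr_ge0 => i _; apply: exprn_ge0; case/andP: (cr i).
apply: prodr_ile1 => i _; have /andP[r0 r1] := cr i.
by rewrite exprn_ge0//= exprn_ile1.
Qed.

Let C_eq h k : C k -> (forall r, cube r -> h r = k r) -> C h.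
Proof.
move=> Ck hk; apply: Clim => e e0; exists k => // r cr.
by rewrite hk// subrr normr0 ltW.
Qed.

(** Each step of the recursion defining [bern] multiplies by [r j] or by [1 - r j],
    which keeps the coefficient [mon m r] within the span of the monomials. *)
Let C_bern j (jL : (j < L)%N) :
  (forall g : (nat -> R) -> R, lip j g -> forall m, C (fun r => g r * mon m r)) ->
  forall N (f : nat -> (nat -> R) -> R), (forall k, lip j (f k)) ->
  forall m, C (fun r => bern N (fun k => f k r) (r j) * mon m r).
Proof.
move=> IHj; elim=> [|N IH] f lf m; first exact: (IHj (f 0%N) (lf 0%N)).
have monS r : r j * mon m r = mon (fun i => if i == j then (m i).+1 else m i) r.
  rewrite /mon (bigD1 (Ordinal jL)) //= [in RHS](bigD1 (Ordinal jL)) //= eqxx.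
  rewrite mulrA -exprS; congr (_ * _); apply: eq_bigr => i ij.
  by case: eqP => // ij'; move: ij; rewrite -val_eqE /= ij' eqxx.
set m' := (fun i => _) in monS.
have h1 := IH (fun k => f k.+1) (fun k => lf k.+1) m'.
have h2 := IH f lf m.
have h3 := CZ (-1) (IH f lf m').
apply: (C_eq (CD h1 (CD h2 h3))) => r _ /=.
by rewrite -!monS; ring.
Qed.

(** Turns the variance of the Bernstein operator into a bound for the mean absolute
    deviation, without square roots. *)
Lemma abs_le_sqr (a e : R) : 0 < e -> `|a| <= e + a ^+ 2 / e.
Proof.
move=> e0; have [ae|ea] := lerP `|a| e.
  by rewrite (le_trans ae)// lerDl divr_ge0// ?sqr_ge0// ltW.
apply: ler_wpDl; first exact: ltW.
by rewrite ler_pdivlMr// -real_normK ?num_real// expr2 ler_wpM2l// ltW.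
Qed.

(** Induction on the number of coordinates. The Bernstein operator in coordinate [j]
    samples the function at fixed values of this coordinate and weights the samples
    by polynomials, so the samples depend on fewer coordinates. The factor [mon m]
    is carried along because these weights multiply the samples. *)
Lemma lip_closure j : (j <= L)%N -> forall g : (nat -> R) -> R, lip j g ->
  forall m, C (fun r => g r * mon m r).
Proof.
elim: j => [_ g [K K0 gK] m|j IH jL g [K K0 gK] m].
  apply: (C_eq (CZ (g (fun=> 0)) (Cmon m))) => r cr.
  congr (_ * _); apply/eqP; rewrite -subr_eq0 -normr_le0.
  rewrite (le_trans (gK _ _ _ _))//; first by move=> i; rewrite lexx ler01.
  by rewrite big_ord0 mulr0.
apply: Clim => e e0.
have K1 : 0 < K + 1 by apply: ltr_wpDl.
(* The mean deviation is at most [eta] plus variance over [eta], and the variance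
   of the frequency is at most [eta ^+ 2]: the error is at most [2 * K * eta]. *)
pose eta := e / (2 * (K + 1)).
have eta0 : 0 < eta by rewrite divr_gt0// mulr_gt0.
pose N := (Num.truncn (eta ^- 2)).+1.
have N0 : 0 < N%:R :> R by rewrite ltr0n.
have NE : N%:R^-1 < eta ^+ 2.
  rewrite -[ltRHS]invrK ltf_pV2 ?posrE ?invr_gt0 ?exprn_gt0//.
  by rewrite truncnS_gt.
(* [bern] evaluates its argument at all naturals, so the sampling points are kept
   within the cube by truncation. *)
pose c k : R := Num.min 1 (k%:R / N%:R).
have c01 k : 0 <= c k <= 1.
  apply/andP; split; first by rewrite /c le_min ler01 divr_ge0.
  by rewrite /c ge_min lexx.
have cu r k : cube r -> cube (upd r j (c k)).
  by move=> cr i; rewrite /upd; case: ifP.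
have lf k : lip j (fun r => g (upd r j (c k))).
  exists K => // r s cr cs; rewrite (le_trans (gK _ _ _ _))//; [exact: cu..|].
  rewrite ler_wpM2l// big_ord_recr /= /upd eqxx subrr normr0 addr0.
  by apply: ler_sum => i _; rewrite ltn_eqF.
exists (fun r => bern N (fun k => g (upd r j (c k))) (r j) * mon m r).
  exact: (C_bern jL (IH (ltnW jL)) N lf m).
move=> r cr; have /andP[m0 m1] := mon_le1 m cr.
rewrite -mulrBl normrM (ger0_norm m0).
rewrite (le_trans (ler_piMr _ m1))//.
have rj := cr j; have /andP[rj0 rj1] := rj.
rewrite distrC.
pose h (k : nat) := K * (eta + (k%:R / N%:R - r j) ^+ 2 / eta).
have gh k : `|g (upd r j (c k)) - g r| <= h k.
  rewrite (le_trans (gK (upd r j (c k)) r (cu r k cr) cr))// ler_wpM2l//.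
  rewrite big_ord_recr big1/=; last first.
    by move=> i _; rewrite /upd ltn_eqF// subrr normr0.
  rewrite add0r /upd eqxx (le_trans _ (abs_le_sqr _ eta0))//.
  rewrite /c minEle; case: ifPn => // h1.
  by rewrite !ger0_norm ?subr_ge0 ?lerB// (le_trans rj1).
rewrite (le_trans (bern_dist N rj gh))//.
have -> : h = fun k : nat => (K / (eta * N%:R ^+ 2)) * (k%:R - N%:R * r j) ^+ 2
   + K * eta.
  by apply/funext => k; rewrite /h; field; rewrite !gt_eqF.
rewrite bern_affine bern_variance subrr expr0n add0r.
have -> : K / (eta * N%:R ^+ 2) * (N%:R * (r j * (1 - r j))) + K * eta =
   K * ((N%:R^-1 / eta) * (r j * (1 - r j)) + eta).
  by field; rewrite !gt_eqF.
have h1 : N%:R^-1 / eta <= eta by rewrite ler_pdivrMr// -expr2 ltW.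
have h2 : 0 <= N%:R^-1 / eta by rewrite divr_ge0// ltW.
have h3 : N%:R^-1 / eta * (r j * (1 - r j)) <= eta.
  rewrite (le_trans _ h1)// ler_piMr//; nra.
have h4 : K * (N%:R^-1 / eta * (r j * (1 - r j)) + eta) <= K * (eta + eta).
  by rewrite ler_wpM2l// lerD2r.
rewrite (le_trans h4)//.
have -> : eta + eta = e / (K + 1) by rewrite /eta; field; rewrite gt_eqF.
by rewrite mulrA ler_pdivrMr// mulrC ler_wpM2l ?ltW//; lra.
Qed.

Lemma lip_in_closure (g : (nat -> R) -> R) : lip L g -> C g.
Proof.
move=> lg; apply: (C_eq (lip_closure (leqnn L) lg (fun=> 0%N))) => r _.
by rewrite /mon big1 ?mulr1.
Qed.

End bernstein.

(** * Independence *)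

Section independence.
Context d (T : measurableType d) (R : realType) (P : probability T R).

(** Both sides are finite measures in [C], so they agree as soon as they agree
    on the rectangles, which are stable under intersection and generate the
    product sigma-algebra. *)
Lemma independent_pair_event d1 d2 (T1 : measurableType d1)
    (T2 : measurableType d2) (X : T -> T1) (Y : T -> T2) (E : set T) :
  measurable_fun setT X -> measurable_fun setT Y -> measurable E ->
  (forall A B, measurable A -> measurable B ->
     P (X @^-1` A `&` (Y @^-1` B `&` E)) = (P (X @^-1` A `&` Y @^-1` B) * P E)%E) ->
  forall C : set (T1 * T2), measurable C ->
    P ((fun w => (X w, Y w)) @^-1` C `&` E) =
    (P ((fun w => (X w, Y w)) @^-1` C) * P E)%E.
Proof.
move=> mX mY mE XYE C mC.
have mXY : measurable_fun setT (fun w => (X w, Y w)).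
  exact: measurable_fun_pair.
have PE0 : 0 <= fine (P E) by exact: fine_ge0.
pose m1 : {measure set (T1 * T2) -> \bar R} := pushforward (mrestr P mE) (fun w => (X w, Y w)).
pose m2 : {measure set (T1 * T2) -> \bar R} :=
  mscale (NngNum PE0) (pushforward P (fun w => (X w, Y w))).
pose G := [set A `*` B | A in (@measurable _ T1) & B in (@measurable _ T2)].
have PEf : (fine (P E))%:E = P E by rewrite fineK// fin_num_measure.
have m1E D : m1 mXY D = P ((fun w => (X w, Y w)) @^-1` D `&` E) by [].
have m2E D : m2 mXY D = ((fine (P E))%:E * P ((fun w => (X w, Y w)) @^-1` D))%E.
  by [].
have : m1 mXY C = m2 mXY C.
  apply: (@measure_unique _ R _ G (fun=> setT) _ _ _ _ (m1 mXY) (m2 mXY)) => //.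
  - exact: measurable_prod_measurableType.
  - move=> _ _ [A1 mA1 [B1 mB1 <-]] [A2 mA2 [B2 mB2 <-]].
    rewrite -setXI; exists (A1 `&` A2); first exact: measurableI.
    by exists (B1 `&` B2) => //; exact: measurableI.
  - by move=> _; exists setT => //; exists setT => //; rewrite setXTT.
  - by rewrite bigcup_const.
  - move=> _ [A mA [B mB <-]].
    rewrite m1E m2E PEf muleC.
    have -> : (fun w => (X w, Y w)) @^-1` (A `*` B) = X @^-1` A `&` Y @^-1` B.
      by apply/seteqP; split.
    by rewrite -XYE// setIA.
  - move=> _; rewrite m1E preimage_setT setTI.
    by rewrite (le_lt_trans (probability_le1 _ _))// ltry.
by rewrite m1E m2E PEf muleC.
Qed.

(** The law of a pair of independent variables is a product measure, so Tonelli
    integrates the two variables one after the other. *)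
Lemma independent_tonelli d1 d2 (T1 : measurableType d1)
    (T2 : measurableType d2) (X : T -> T1) (Y : T -> T2) (f : T1 * T2 -> \bar R) :
  measurable_fun setT X -> measurable_fun setT Y ->
  (forall A B, measurable A -> measurable B ->
     P (X @^-1` A `&` Y @^-1` B) = (P (X @^-1` A) * P (Y @^-1` B))%E) ->
  measurable_fun setT f -> (forall z, (0 <= f z)%E) ->
  (\int[P]_w f (X w, Y w) = \int[P]_w \int[P]_w' f (X w, Y w'))%E.
Proof.
move=> mX mY XY mf f0.
have mXY : measurable_fun setT (fun w => (X w, Y w)).
  exact: measurable_fun_pair.
pose XYm := isMeasurableFun.Build _ _ _ _ _ mXY.
pose XYr : {mfun T >-> (T1 * T2)%type} := HB.pack (fun w => (X w, Y w)) XYm.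
pose Xm := isMeasurableFun.Build _ _ _ _ _ mX.
pose Xr : {mfun T >-> T1} := HB.pack X Xm.
pose Ym := isMeasurableFun.Build _ _ _ _ _ mY.
pose Yr : {mfun T >-> T2} := HB.pack Y Ym.
transitivity (\int[distribution P XYr]_z f z)%E.
  by rewrite ge0_integral_distribution.
transitivity (\int[distribution P Xr \x distribution P Yr]_z f z)%E.
  apply: eq_measure_integral => A mA _; apply/esym.
  apply: (@product_measure_unique _ _ _ _ _ _ _ (distribution P XYr)) => //.
have f0' y : (0 <= fubini_F (distribution P Yr) f y)%E.
  by apply: integral_ge0 => x _; exact: f0.
rewrite fubini_tonelli1//.
rewrite (@ge0_integral_distribution _ _ _ _ _ P Xr
  (fubini_F (distribution P Yr) f))//; last exact: measurable_fun_fubini_tonelli_F.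
apply: eq_integral => w _ /=.
rewrite /fubini_F (@ge0_integral_distribution _ _ _ _ _ P Yr
  (fun y => f (X w, y)))//.
exact: measurableT_comp.
Qed.

Lemma ExM_independent (X Y : T -> R) M :
  measurable_fun setT X -> measurable_fun setT Y ->
  (forall w, 0 <= X w <= M) -> (forall w, 0 <= Y w <= M) ->
  (forall A B, measurable A -> measurable B ->
     P (X @^-1` A `&` Y @^-1` B) = (P (X @^-1` A) * P (Y @^-1` B))%E) ->
  Ex P (fun w => X w * Y w) = Ex P X * Ex P Y.
Proof.
move=> mX mY X01 Y01 XY.
pose f (z : R * R) : \bar R := (`|z.1| * `|z.2|)%:E.
have X0 w : 0 <= X w by case/andP: (X01 w).
have Y0 w : 0 <= Y w by case/andP: (Y01 w).
have bX : bmeas X.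
  by split => //; exists M => w; rewrite ger0_norm//; case/andP: (X01 w).
have bY : bmeas Y.
  by split => //; exists M => w; rewrite ger0_norm//; case/andP: (Y01 w).
have mf : measurable_fun setT f.
  apply/measurable_EFinP; apply: measurable_funM.
    by apply: measurableT_comp => //; exact: measurable_fst.
  by apply: measurableT_comp => //; exact: measurable_snd.
have := independent_tonelli mX mY XY mf; rewrite /f /= => /(_ _) h.
have e1 : ('E_P[fun w => (X w * Y w)%R] = \int[P]_w (`|X w| * `|Y w|)%:E)%E.
  by rewrite unlock; apply: eq_integral => w _; rewrite !ger0_norm.
rewrite /Ex e1 h; last by move=> z; rewrite lee_fin mulr_ge0.
have eY : (\int[P]_w (Y w)%:E = (Ex P Y)%:E)%E by rewrite -bmeas_fin// unlock.
have eX : (\int[P]_w (X w)%:E = (Ex P X)%:E)%E by rewrite -bmeas_fin// unlock.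
have -> : (\int[P]_x \int[P]_w' (`|X x| * `|Y w'|)%:E =
          \int[P]_x ((X x)%:E * (Ex P Y)%:E))%E.
  apply: eq_integral => w _; rewrite -eY -ge0_integralZl//.
  - by apply: eq_integral => w' _; rewrite !ger0_norm// EFinM.
  - exact/measurable_EFinP.
  - by move=> w' _; rewrite lee_fin.
  - by rewrite lee_fin.
rewrite ge0_integralZr//.
- by rewrite eX.
- exact/measurable_EFinP.
- by move=> w' _; rewrite lee_fin.
- by rewrite lee_fin -[leLHS](Ex_cst P); apply: (@Ex_le _ _ _ _ _ _ M) => // w;
    rewrite ?normr0 ?ger0_norm//; case/andP: (Y01 w) => // ? ?; apply: le_trans; eauto.
Qed.

Section family.
Variables (I : eqType) (X : I -> T -> R).
Hypothesis mX : forall i, measurable_fun setT (X i).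
Hypothesis indX : mutually_independent P X.
Variables (iota : nat -> I) (f : nat -> R -> R).
Hypothesis iota_inj : injective iota.
Hypothesis mf : forall m, measurable_fun setT (f m).

Definition joint_event (s : seq I) (B : I -> set R) : set T :=
  [set w | forall i, i \in s -> B i (X i w)].

Lemma measurable_joint_event s B : (forall i, measurable (B i)) ->
  measurable (joint_event s B).
Proof.
move=> mB; elim: s => [|i s IH].
  by rewrite [X in measurable X](_ : _ = setT)//; apply/seteqP; split.
rewrite [X in measurable X](_ : _ = X i @^-1` B i `&` joint_event s B).
  by apply: measurableI => //; rewrite -[X in measurable X]setTI; exact: mX.
apply/seteqP; split=> w /=.
  by move=> h; split=> [|j js]; apply: h; rewrite inE ?eqxx// js orbT.
by move=> [h1 h2] j; rewrite inE => /orP[/eqP->//|]; exact: h2.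
Qed.

Lemma joint_event_cons i s B C : i \notin s ->
  X i @^-1` C `&` joint_event s B =
  joint_event (i :: s) (fun j => if j == i then C else B j).
Proof.
move=> is_; apply/seteqP; split=> w /=.
  move=> [h1 h2] j; rewrite inE; case: eqP => [->//|_ /= js]; exact: h2.
move=> h; split; first by have := h i; rewrite inE eqxx; exact.
move=> j js; have := h j; rewrite inE js orbT; case: eqP => [ji|_]; last exact.
by move: is_; rewrite -ji js.
Qed.

Lemma P_joint_event_cons i s B C : uniq s -> i \notin s -> measurable C ->
  (forall j, measurable (B j)) ->
  P (X i @^-1` C `&` joint_event s B) = (P (X i @^-1` C) * P (joint_event s B))%E.
Proof.
move=> us is_ mC mB; rewrite joint_event_cons// /joint_event (indX us mB).
rewrite (@indX (i :: s) (fun j => if j == i then C else B j)); last 2 first.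
- by rewrite /= is_.
- by move=> j; case: ifP.
rewrite big_cons eqxx; congr (_ * _)%E; rewrite big_seq [RHS]big_seq.
by apply: eq_bigr => j js; case: eqP => // ji; rewrite -ji js in is_.
Qed.

(** The products that occur later range over the indices [iota 0], [iota 1], and so
    on, of a larger family; the remaining indices stay available to express
    independence of the product from other variables. *)
Definition partial_prod l w : R := \prod_(m < l) f m (X (iota m) w).

Lemma measurable_partial_prod l : measurable_fun setT (partial_prod l).
Proof.
by apply: measurable_prod => i _; apply: measurableT_comp.
Qed.

Let step l :
  (forall s B A, uniq s -> (forall m, (m < l)%N -> iota m \notin s) ->
   (forall i, measurable (B i)) -> measurable A ->
   P (partial_prod l @^-1` A `&` joint_event s B) =
   (P (partial_prod l @^-1` A) * P (joint_event s B))%E) ->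
  forall s B (C : set (R * R)), uniq s ->
  (forall m, (m <= l)%N -> iota m \notin s) ->
  (forall i, measurable (B i)) -> measurable C ->
  P ((fun w => (partial_prod l w, X (iota l) w)) @^-1` C `&` joint_event s B) =
  (P ((fun w => (partial_prod l w, X (iota l) w)) @^-1` C) * P (joint_event s B))%E.
Proof.
move=> IH s B C us ls mB mC.
apply: independent_pair_event => //; [exact: measurable_partial_prod| |].
  exact: measurable_joint_event.
move=> A D mA mD.
have lls : iota l \notin s by exact: ls.
have nl m : (m < l)%N -> iota m != iota l.
  by move=> ml; apply/eqP => /iota_inj ml'; move: ml; rewrite ml' ltnn.
rewrite joint_event_cons// IH//; last 3 first.
- by rewrite /= lls.
- by move=> m ml; rewrite inE negb_or nl//= ls// ltnW.
- by move=> i; case: ifP.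
rewrite -joint_event_cons// P_joint_event_cons// muleA; congr (_ * _)%E.
have := IH [::iota l] (fun=> D) A; rewrite (_ : joint_event _ _ = X (iota l) @^-1` D).
  by move=> ->// m ml; rewrite inE nl.
apply/seteqP; split=> w /=; first by apply; rewrite inE.
by move=> h j; rewrite inE => /eqP ->.
Qed.

(** Induction on [l]: the pair formed by the product of the first [l] factors
    and the variable of index [iota l] is independent of the joint event, and
    the next product is a function of this pair. *)
Lemma partial_prod_independent l s B A : uniq s ->
  (forall m, (m < l)%N -> iota m \notin s) ->
  (forall i, measurable (B i)) -> measurable A ->
  P (partial_prod l @^-1` A `&` joint_event s B) =
  (P (partial_prod l @^-1` A) * P (joint_event s B))%E.
Proof.
elim: l s B A => [|l IH] s B A us ls mB mA.
  have [A1|A1] := pselect (A 1).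
    have -> : partial_prod 0 @^-1` A = setT.
      by apply/seteqP; split=> // w _ /=; rewrite /partial_prod big_ord0.
    by rewrite setTI probability_setT mul1e.
  have -> : partial_prod 0 @^-1` A = set0.
    by apply/seteqP; split=> // w /=; rewrite /partial_prod big_ord0.
  by rewrite set0I measure0 mul0e.
pose g (z : R * R) := z.1 * f l z.2.
have mg : measurable_fun setT g.
  apply: measurable_funM; first exact: measurable_fst.
  by apply: measurableT_comp => //; exact: measurable_snd.
have -> : partial_prod l.+1 @^-1` A =
    (fun w => (partial_prod l w, X (iota l) w)) @^-1` (g @^-1` A).
  apply/seteqP; split=> w /=;
    by rewrite /partial_prod big_ord_recr /=.
apply: step => //.
by rewrite -[X in measurable X]setTI; exact: mg.
Qed.

Lemma partial_prod_pair_independent l s B (C : set (R * R)) : uniq s ->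
  (forall m, (m <= l)%N -> iota m \notin s) ->
  (forall i, measurable (B i)) -> measurable C ->
  P ((fun w => (partial_prod l w, X (iota l) w)) @^-1` C `&` joint_event s B) =
  (P ((fun w => (partial_prod l w, X (iota l) w)) @^-1` C) * P (joint_event s B))%E.
Proof. by apply: step => *; exact: partial_prod_independent. Qed.

Lemma joint_event1 i C : joint_event [:: i] (fun=> C) = X i @^-1` C.
Proof.
apply/seteqP; split=> w /=; first by apply; rewrite inE.
by move=> h j; rewrite inE => /eqP ->.
Qed.

Lemma Ex_prod_independent l : (forall m w, 0 <= f m (X (iota m) w) <= 1) ->
  Ex P (partial_prod l) = \prod_(m < l) Ex P (fun w => f m (X (iota m) w)).
Proof.
move=> f01; elim: l => [|l IH].
  rewrite big_ord0 (_ : partial_prod 0 = fun=> 1) ?Ex_cst//.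
  by apply/funext => w; rewrite /partial_prod big_ord0.
rewrite big_ord_recr /= -IH -(@ExM_independent _ _ 1)//; last 4 first.
- exact: measurable_partial_prod.
- exact: measurableT_comp.
- move=> w; apply/andP; split.
    by apply: prodr_ge0 => m _; case/andP: (f01 m w).
  by apply: prodr_ile1 => m _; exact: f01.
- move=> A B mA mB.
  have mfB : measurable (f l @^-1` B).
    by rewrite -[X in measurable X]setTI; exact: mf.
  rewrite (_ : (fun w => f l (X (iota l) w)) @^-1` B = X (iota l) @^-1` (f l @^-1` B))//.
  rewrite -joint_event1 partial_prod_independent// => m ml.
  by rewrite inE; apply/eqP => /iota_inj ml'; move: ml; rewrite ml' ltnn.
by congr (Ex _ _); apply/funext => w; rewrite /partial_prod big_ord_recr.
Qed.

End family.
End independence.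

(** * Balls in the boxes of the sieve *)

Section uniform_variable.
Context d (T : measurableType d) (R : realType) (P : probability T R).

Lemma uniform_prob_itv (a b : R) : 0 <= a -> a <= b -> b <= 1 ->
  uniform_prob (@ltr01 R) `]a, b]%classic = (b - a)%:E.
Proof.
move=> a0 ab b1; rewrite /uniform_prob integral_uniform_pdf setIidl; last first.
  move=> x /=; rewrite !in_itv/= => /andP[ax xb].
  by rewrite (le_trans a0 (ltW ax)) (le_trans xb b1).
rewrite (eq_integral (fun=> 1%E)); last first.
  move=> x; rewrite inE/= in_itv/= => /andP[ax xb].
  by rewrite /uniform_pdf (le_trans a0 (ltW ax)) (le_trans xb b1) subr0 invr1.
rewrite integral_cst//= mul1e lebesgue_measure_itv/= lte_fin.
case: ltP => [_|ba]; first by rewrite EFinB.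
by rewrite (le_anti (introT andP (conj ab ba))) subrr.
Qed.

(** Conditionally on [X], the uniform variable falls between [a X] and [b X]
    with probability [b X - a X]. *)
Lemma integral_between_uniform d1 (T1 : measurableType d1) (X : T -> T1)
    (U : T -> R) (g a b : T1 -> R) :
  measurable_fun setT X -> measurable_fun setT U ->
  (forall A B, measurable A -> measurable B ->
     P (X @^-1` A `&` U @^-1` B) = (P (X @^-1` A) * P (U @^-1` B))%E) ->
  (forall B : set R, measurable B -> P (U @^-1` B) = uniform_prob (@ltr01 R) B) ->
  measurable_fun setT g -> measurable_fun setT a -> measurable_fun setT b ->
  (forall w, 0 <= g (X w)) -> (forall w, 0 <= a (X w) <= b (X w)) ->
  (forall w, b (X w) <= 1) ->
  (\int[P]_w (g (X w) * (a (X w) < U w <= b (X w))%R%:R)%:E =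
   \int[P]_w (g (X w) * (b (X w) - a (X w)))%:E)%E.
Proof.
move=> mX mU XU UU mg ma mb g0 ab b1.
pose f (z : T1 * R) : \bar R := (`|g z.1| * ((a z.1 < z.2) && (z.2 <= b z.1))%:R)%:E.
have m1 : measurable_fun setT (fst : T1 * R -> T1) by exact: measurable_fst.
have m2 : measurable_fun setT (snd : T1 * R -> R) by exact: measurable_snd.
have mf : measurable_fun setT f.
  apply/measurable_EFinP; apply: measurable_funM.
    by apply: measurableT_comp => //; exact: measurableT_comp.
  have mB : measurable_fun setT
      (fun z : T1 * R => (a z.1 < z.2) && (z.2 <= b z.1)).
    apply: measurable_and.
      by apply: measurable_fun_ltr => //; exact: measurableT_comp.
    by apply: measurable_fun_ler => //; exact: measurableT_comp.
  by apply: measurable_natr_bool.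
have := independent_tonelli mX mU XU mf; rewrite /f /= => h.
transitivity (\int[P]_w (`|g (X w)| * ((a (X w) < U w) && (U w <= b (X w)))%:R)%:E)%E.
  by apply: eq_integral => w _; rewrite ger0_norm.
rewrite h; last by move=> z; rewrite lee_fin mulr_ge0.
apply: eq_integral => w _; rewrite ger0_norm//.
have mUi : measurable (U @^-1` `]a (X w), b (X w)]).
  by rewrite -[X in measurable X]setTI; exact: mU.
have -> : (fun w' => (g (X w) * ((a (X w) < U w') && (U w' <= b (X w)))%:R)%:E) =
    (fun w' => (g (X w))%:E * (\1_(U @^-1` `]a (X w), b (X w)]) w')%:E)%E.
  apply/funext => w'; rewrite -EFinM indicE; congr (_ * (nat_of_bool _)%:R)%:E.
  apply/idP/idP; first by move=> h1; rewrite inE /= in_itv.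
  by rewrite inE /= in_itv.
have /andP[a0 ab'] := ab w.
rewrite ge0_integralZl//.
- rewrite integral_indic// setIT EFinM; congr (_ * _)%E.
  by rewrite -uniform_prob_itv//; exact: UU.
- by apply/measurable_EFinP; exact: measurable_indic.
- by rewrite lee_fin.
Qed.
End uniform_variable.

Lemma measurable_inv_pos d (T : measurableType d) (R : realType) (f : T -> R) :
  measurable_fun setT f -> (forall w, 0 <= f w) ->
  measurable_fun setT (fun w => (f w)^-1).
Proof.
move=> mf f0; rewrite (_ : (fun w => _) = (fun x => powR x (-1)) \o f).
  by apply: measurableT_comp => //; exact: measurable_powR.
by apply/funext => w /=; rewrite powR_inv1.
Qed.

Lemma sum_cst_EFin (R : realType) n (c : R) :
  (\sum_(i < n) c%:E = (n%:R * c)%:E)%E.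
Proof.
elim: n => [|n IH]; first by rewrite big_ord0 mul0r.
by rewrite big_ord_recr /= IH -EFinD -natr1; congr (_%:E); ring.
Qed.

Section sieve.
Context (R : realType) d (T : measurableType d) (P : probability T R)
  (W U : nat -> {RV P >-> R})
  d0 (T0 : measurableType d0) (P0 : probability T0 R) (W0 : {RV P0 >-> R}).
Hypothesis hsieve : bernoulli_sieve W U W0.

Let fam (i : nat + nat) : T -> R := match i with inl k => W k | inr j => U j end.
Let mfam i : measurable_fun setT (fam i).
Proof. by case: i => k /=; exact: measurable_funPT. Qed.
Let fam_ind : mutually_independent P fam. Proof. by case: hsieve. Qed.
Let inlI : injective (@inl nat nat). Proof. by move=> x y []. Qed.

Lemma W01 k w : 0 < W k w < 1. Proof. by case: hsieve => + _ _ _; apply. Qed.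

Local Notation V := (sieve_V W).

Lemma sieve_VS l w : V l.+1 w = V l w * W l w.
Proof. by rewrite /sieve_V big_ord_recr. Qed.

Lemma sieve_V01 l w : 0 < V l w <= 1.
Proof.
elim: l => [|l /andP[V0 V1]]; first by rewrite /sieve_V big_ord0 ltr01 lexx.
have /andP[w0 w1] := W01 l w.
by rewrite sieve_VS mulr_gt0//= mulr_ile1// ltW.
Qed.

Lemma sieve_VS_lt l w : V l.+1 w < V l w.
Proof.
have /andP[V0 _] := sieve_V01 l w; have /andP[w0 w1] := W01 l w.
by rewrite sieve_VS gtr_pMr.
Qed.

Lemma sieve_V_le k l w : (k <= l)%N -> V l w <= V k w.
Proof.
move=> /subnK <-; elim: (l - k)%N => // n IH.
by rewrite addSn (le_trans (ltW (sieve_VS_lt _ _))).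
Qed.

Lemma measurable_sieve_V l : measurable_fun setT (V l).
Proof. by rewrite /sieve_V; apply: measurable_prod => i _. Qed.

Let UU j (B : set R) : measurable B -> P (U j @^-1` B) = uniform_prob (@ltr01 R) B.
Proof. by case: hsieve => _ _ + _; apply. Qed.

Let VW l w := (V l w, W l w).
Let mVW l : measurable_fun setT (VW l).
Proof. by apply: measurable_fun_pair => //; exact: measurable_sieve_V. Qed.

Let VW_U l j A B : measurable A -> measurable B ->
  P (VW l @^-1` A `&` U j @^-1` B) = (P (VW l @^-1` A) * P (U j @^-1` B))%E.
Proof.
move=> mA mB; have := @partial_prod_pair_independent _ _ _ P _ fam mfam fam_ind
  inl (fun=> id) inlI (fun=> @measurable_id _ _ setT) l [:: inr j] (fun=> B) A.
by rewrite joint_event1; apply => // m _; rewrite inE.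
Qed.

Let VWU l j w := (VW l w, U j w).
Let mVWU l j : measurable_fun setT (VWU l j).
Proof. exact: measurable_fun_pair. Qed.

Let VWU_U l j j' : j != j' -> forall A B, measurable A -> measurable B ->
  P (VWU l j @^-1` A `&` U j' @^-1` B) = (P (VWU l j @^-1` A) * P (U j' @^-1` B))%E.
Proof.
move=> jj' A B mA mB; apply: independent_pair_event => //.
  by rewrite -[X in measurable X]setTI; exact: measurable_funPT.
move=> C D mC mD.
have inrj : inr j \notin [:: inr j' : nat + nat].
  by rewrite inE; apply: contra jj' => /eqP[->].
have E1 : U j' @^-1` B = joint_event fam [:: inr j'] (fun=> B).
  by rewrite joint_event1.
have E2 : U j @^-1` D `&` U j' @^-1` B =
   joint_event fam [:: inr j; inr j'] (fun i => if i == inr j then D else B).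
  by rewrite E1 -joint_event_cons.
have := @partial_prod_pair_independent _ _ _ P _ fam mfam fam_ind
  inl (fun=> id) inlI (fun=> @measurable_id _ _ setT) l [:: inr j; inr j']
  (fun i => if i == inr j then D else B) C.
rewrite -E2 => -> //; last 2 first.
- by rewrite /= inrj.
- by move=> i; case: ifP.
rewrite VW_U// -muleA; congr (_ * _)%E.
have := @P_joint_event_cons _ _ _ P _ fam fam_ind (inr j) [:: inr j'] (fun=> B) D.
by rewrite joint_event1; apply.
Qed.

Definition ball_in (l j : nat) (w : T) : R := (V l.+1 w < U j w <= V l w)%R%:R.
Definition box_prob l w := V l w - V l.+1 w.

Lemma box_prob_gt0 l w : 0 < box_prob l w.
Proof. by rewrite subr_gt0 sieve_VS_lt. Qed.

Lemma box_prob_le1 l w : box_prob l w <= 1.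
Proof.
have /andP[_ h] := sieve_V01 l w; have /andP[h' _] := sieve_V01 l.+1 w.
by rewrite /box_prob; lra.
Qed.

Lemma measurable_box_prob l : measurable_fun setT (box_prob l).
Proof. by apply: measurable_funB; exact: measurable_sieve_V. Qed.

Lemma measurable_ball_in l j : measurable_fun setT (ball_in l j).
Proof.
have mB : measurable_fun setT (fun w => (V l.+1 w < U j w) && (U j w <= V l w)).
  apply: measurable_and.
    by apply: measurable_fun_ltr => //; exact: measurable_sieve_V.
  by apply: measurable_fun_ler => //; exact: measurable_sieve_V.
by apply: measurable_natr_bool.
Qed.

Lemma sieve_ZE n l w : (sieve_Z W U n l w)%:R = \sum_(j < n) ball_in l j w.
Proof.
rewrite /sieve_Z cardsE -sum1_card natr_sum big_mkcond /=.
apply: eq_bigr => j _; rewrite /ball_in.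
set c := (X in if X then _ else _).
have -> : c = (V l.+1 w < U j w <= V l w).
  rewrite /c unfold_in; apply/asboolP/idP; first by rewrite /sieve_box /= in_itv.
  by move=> h; rewrite /sieve_box /= in_itv.
by case: ifP.
Qed.

Let m1 : measurable_fun setT (fst : R * R -> R). Proof. exact: measurable_fst. Qed.
Let m2 : measurable_fun setT (snd : R * R -> R). Proof. exact: measurable_snd. Qed.
Let lo (z : R * R) := z.1 * z.2.
Let mlo : measurable_fun setT lo. Proof. exact: measurable_funM. Qed.
Let lohi l w : 0 <= lo (VW l w) <= (VW l w).1.
Proof.
rewrite /lo /= -sieve_VS (ltW (sieve_VS_lt _ _)) andbT.
by case/andP: (sieve_V01 l.+1 w) => /ltW.
Qed.

(** Given [V l] and [W l], a ball falls into box [l] with probability [box_prob l];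
    the weight [g] will be the reciprocal of that probability. *)
Lemma integral_ball_in l j (g : R * R -> R) : measurable_fun setT g ->
  (forall w, 0 <= g (V l w, W l w)) ->
  (\int[P]_w (g (V l w, W l w) * ball_in l j w)%:E =
   \int[P]_w (g (V l w, W l w) * box_prob l w)%:E)%E.
Proof.
move=> mg g0; have := @integral_between_uniform _ _ _ P _ _ (VW l) (U j) g lo fst.
rewrite /lo /VW /= => h.
transitivity (\int[P]_w (g (V l w, W l w) * (V l w * W l w < U j w <= V l w)%R%:R)%:E)%E.
  by apply: eq_integral => w _; rewrite /ball_in sieve_VS.
rewrite h//.
- by apply: eq_integral => w _; rewrite /box_prob sieve_VS.
- exact: mVW.
- exact: VW_U.
- exact: UU.
- exact: lohi.
- by move=> w; case/andP: (sieve_V01 l w).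
Qed.

Let ip (z : R * R) := (z.1 - lo z) `^ (-1).
Let measurable_ip : measurable_fun setT ip.
Proof.
apply: (@measurableT_comp _ _ _ _ _ _ (fun x : R => x `^ (-1))).
  exact: measurable_powR.
exact: measurable_funB.
Qed.

Let ipE l w : ip (V l w, W l w) = (box_prob l w)^-1.
Proof.
rewrite /ip /lo /= -sieve_VS -/(box_prob l w) powR_inv1//.
by rewrite ltW// box_prob_gt0.
Qed.

(** Given the boxes, two balls fall into box [l] independently; the first ball is
    treated as part of the conditioning when the second one is integrated out. *)
Lemma integral_two_balls_in l j j' : j != j' ->
  (\int[P]_w ((box_prob l w)^-1 * ball_in l j w * ball_in l j' w)%:E =
   \int[P]_w (box_prob l w)%:E)%E.
Proof.
move=> jj'.
pose g (z : R * R * R) := ip z.1 * ((lo z.1 < z.2) && (z.2 <= z.1.1))%:R.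
have m1' : measurable_fun setT (fst : R * R * R -> R * R) by exact: measurable_fst.
have m2' : measurable_fun setT (snd : R * R * R -> R) by exact: measurable_snd.
have mg : measurable_fun setT g.
  apply: measurable_funM; first exact: measurableT_comp.
  have mB : measurable_fun setT
      (fun z : R * R * R => (lo z.1 < z.2) && (z.2 <= z.1.1)).
    apply: measurable_and.
      by apply: measurable_fun_ltr => //; exact: measurableT_comp.
    by apply: measurable_fun_ler => //; exact: measurableT_comp.
  by apply: measurable_natr_bool.
have gE w : g (VWU l j w) = (box_prob l w)^-1 * ball_in l j w.
  by rewrite /g /ball_in /VWU /VW /= ipE /lo /= -sieve_VS.
have := @integral_between_uniform _ _ _ P _ _ (VWU l j) (U j') g
  (fun z => lo z.1) (fun z => z.1.1) _ _ (VWU_U l jj').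
rewrite /VWU /= => h.
transitivity (\int[P]_w (g (VW l w, U j w) * (lo (VW l w) < U j' w <= V l w)%R%:R)%:E)%E.
  by apply: eq_integral => w _; rewrite gE /ball_in /lo /= -sieve_VS.
rewrite h//; last 6 first.
- exact: mVWU.
- exact: UU.
- exact: measurableT_comp.
- exact: measurableT_comp.
- by move=> w; rewrite gE mulr_ge0// invr_ge0 ltW// box_prob_gt0.
- by move=> w; case/andP: (sieve_V01 l w).
transitivity (\int[P]_w ((fun=> 1) (V l w, W l w) * ball_in l j w)%:E)%E.
  apply: eq_integral => w _; rewrite gE /lo /= -sieve_VS mul1r.
  rewrite mulrAC -/(box_prob l w) mulVf ?mul1r//.
  by rewrite gt_eqF// box_prob_gt0.
have := @integral_ball_in l j (fun=> 1) (measurable_cst _).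
rewrite /= => ->//.
by apply: eq_integral => w _; rewrite mul1r.
Qed.

Lemma integral_one_ball_in l j :
  (\int[P]_w ((box_prob l w)^-1 * ball_in l j w)%:E = 1)%E.
Proof.
transitivity (\int[P]_w (ip (V l w, W l w) * ball_in l j w)%:E)%E.
  by apply: eq_integral => w _; rewrite ipE.
rewrite integral_ball_in//; last first.
  by move=> w; rewrite ipE invr_ge0 ltW// box_prob_gt0.
rewrite (eq_integral (fun=> 1%E)) ?integral_cst//= ?mul1e ?probability_setT//.
by move=> w _; rewrite ipE mulVf// gt_eqF// box_prob_gt0.
Qed.

(** Dividing by the conditional probability makes the mean of this deviation bounded
    by [n] for every box, however small. *)
Definition box_deviation n l w :=
  (box_prob l w)^-1 * ((sieve_Z W U n l w)%:R - n%:R * box_prob l w) ^+ 2.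

Lemma measurable_sieve_Z n l :
  measurable_fun setT (fun w => (sieve_Z W U n l w)%:R : R).
Proof.
rewrite (_ : (fun w => _) = fun w => \sum_(j < n) ball_in l j w).
  by apply: measurable_sum => j; exact: measurable_ball_in.
by apply/funext => w; rewrite sieve_ZE.
Qed.

Lemma measurable_box_deviation n l : measurable_fun setT (box_deviation n l).
Proof.
apply: measurable_funM.
  apply: measurable_inv_pos; first exact: measurable_box_prob.
  by move=> w; rewrite ltW// box_prob_gt0.
apply: measurable_funX; apply: measurable_funB; first exact: measurable_sieve_Z.
by apply: measurable_funM => //; exact: measurable_box_prob.
Qed.

(** Given the boxes, the number of balls in box [l] is binomial with mean [n p],
    [p := box_prob l], hence has variance at most [n p]. The square of the number is
    expanded over pairs of balls. *)
Lemma integral_box_deviation n l :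
  (\int[P]_w (box_deviation n l w)%:E <= n%:R%:E)%E.
Proof.
have mbp := measurable_box_prob l.
have mip : measurable_fun setT (fun w => (box_prob l w)^-1).
  by apply: measurable_inv_pos => // w; rewrite ltW// box_prob_gt0.
have mbi := measurable_ball_in l.
have ip0 w : 0 <= (box_prob l w)^-1 by rewrite invr_ge0 ltW// box_prob_gt0.
have bp0 w : 0 <= box_prob l w by rewrite ltW// box_prob_gt0.
have [p pE p0] : exists2 p, (\int[P]_w (box_prob l w)%:E = p%:E)%E & 0 <= p.
  have bbp : bmeas (box_prob l).
    by split => //; exists 1 => w; rewrite ger0_norm// box_prob_le1.
  exists (Ex P (box_prob l)); first by rewrite -bmeas_fin// unlock.
  by rewrite fine_ge0// expectation_ge0.
have eZ : (\int[P]_w (2 * n%:R * (sieve_Z W U n l w)%:R)%:E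
     = (2 * n%:R * (n%:R * p))%:E)%E.
  rewrite (eq_integral (fun w => \sum_(j < n) (2 * n%:R * ball_in l j w)%:E))%E; last first.
    by move=> w _; rewrite sieve_ZE mulr_sumr sumEFin.
  rewrite ge0_integral_sum//; last 2 first.
  - by move=> j; apply/measurable_EFinP/measurable_funM.
  - by move=> j w _; rewrite lee_fin !mulr_ge0.
  rewrite (eq_bigr (fun=> (2 * n%:R * p)%:E)); last first.
    move=> j _.
    have := @integral_ball_in l j (fun=> 2 * n%:R) (measurable_cst _).
    rewrite /= => ->; last by move=> w; rewrite mulr_ge0.
    under eq_integral do rewrite EFinM.
    rewrite ge0_integralZl//.
    - by rewrite pE.
    - exact/measurable_EFinP.
    - by move=> w _; rewrite lee_fin.
  by rewrite sum_cst_EFin; congr (_%:E); ring.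
have eP : (\int[P]_w (n%:R ^+ 2 * box_prob l w)%:E = (n%:R ^+ 2 * p)%:E)%E.
  under eq_integral do rewrite EFinM.
  rewrite ge0_integralZl//.
  - by rewrite pE.
  - exact/measurable_EFinP.
  - by move=> w _; rewrite lee_fin.
have eZ2 : (\int[P]_w ((box_prob l w)^-1 * (sieve_Z W U n l w)%:R ^+ 2)%:E
     <= (n%:R + n%:R ^+ 2 * p - n%:R * p)%:E)%E.
  rewrite (eq_integral (fun w => \sum_(j < n) \sum_(j' < n)
     ((box_prob l w)^-1 * ball_in l j w * ball_in l j' w)%:E))%E; last first.
    move=> w _; rewrite sieve_ZE expr2 mulrA [X in X * _]mulr_sumr mulr_suml -sumEFin.
    by apply: eq_bigr => j _; rewrite mulr_sumr sumEFin.
  rewrite ge0_integral_sum//; last 2 first.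
  - move=> j; apply: emeasurable_sum => j'.
    by apply/measurable_EFinP/measurable_funM => //; exact: measurable_funM.
  - by move=> j w _; apply: sume_ge0 => j' _; rewrite lee_fin !mulr_ge0.
  rewrite (eq_bigr (fun=> (1 + (n%:R - 1) * p)%:E)); last first.
    move=> j _; rewrite ge0_integral_sum//; last 2 first.
    - move=> j'.
      by apply/measurable_EFinP/measurable_funM => //; exact: measurable_funM.
    - by move=> j' w _; rewrite lee_fin !mulr_ge0.
    rewrite (bigD1 j)//= (eq_integral (fun w => ((box_prob l w)^-1 * ball_in l j w)%:E)); last first.
      by move=> w _; rewrite /ball_in -mulrA; case: (_ && _) => /=; rewrite ?mulr1 ?mulr0.
    rewrite integral_one_ball_in (eq_bigr (fun=> p%:E)); last first.
      by move=> j' jj'; rewrite integral_two_balls_in ?pE// eq_sym.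
    rewrite (sumEFin _ _ (fun=> p)) sumr_const -EFinD; congr (_%:E); congr (_ + _).
    have -> : #|(fun i : 'I_n => i != j)| = n.-1.
      by have := cardC1 j; rewrite card_ord => <-; apply: eq_card.
    case: (n) j => [[]//|m _]; rewrite /= -mulr_natl -natr1; ring.
  rewrite sum_cst_EFin lee_fin; lra.
(* The square is developed with its negative term moved to the left, so that all
   integrands are nonnegative. *)
have : (\int[P]_w ((box_deviation n l w)%:E + (2 * n%:R * (sieve_Z W U n l w)%:R)%:E) =
  \int[P]_w (((box_prob l w)^-1 * (sieve_Z W U n l w)%:R ^+ 2)%:E
     + (n%:R ^+ 2 * box_prob l w)%:E))%E.
  apply: eq_integral => w _; rewrite -!EFinD; congr (_%:E).
  by rewrite /box_deviation; field; rewrite gt_eqF// box_prob_gt0.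
have mZ := measurable_sieve_Z n l.
rewrite ge0_integralD//=; last 3 first.
- by move=> w _; rewrite lee_fin mulr_ge0// sqr_ge0.
- exact/measurable_EFinP/measurable_box_deviation.
- by apply/measurable_EFinP/measurable_funM.
rewrite ge0_integralD//=; last first.
- by apply/measurable_EFinP/measurable_funM.
- by move=> w _; rewrite lee_fin mulr_ge0// exprn_ge0.
- by apply/measurable_EFinP/measurable_funM => //; exact: measurable_funX.
- by move=> w _; rewrite lee_fin mulr_ge0// exprn_ge0.
rewrite eZ eP => h.
have : (\int[P]_w (box_deviation n l w)%:E + (2 * n%:R * (n%:R * p))%:E <=
   (n%:R + n%:R ^+ 2 * p - n%:R * p)%:E + (n%:R ^+ 2 * p)%:E)%E.
  by rewrite h leeD2r.
rewrite -leeBrDr// => /le_trans; apply; rewrite lee_fin.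
have : 0 <= n%:R * p by rewrite mulr_ge0.
lra.
Qed.

(** The balls that miss the first [k] boxes; they bound all later boxes at once. *)
Definition tail_balls n k w : R := \sum_(j < n) (0 < U j w <= V k w)%R%:R.

Lemma measurable_tail_balls n k : measurable_fun setT (tail_balls n k).
Proof.
apply: measurable_sum => j.
have mB : measurable_fun setT (fun w => (0 < U j w) && (U j w <= V k w)).
  apply: measurable_and; first exact: measurable_fun_ltr.
  by apply: measurable_fun_ler => //; exact: measurable_sieve_V.
by apply: measurable_natr_bool.
Qed.

Lemma integral_tail_balls n k :
  (\int[P]_w ((V k w)^-1 * tail_balls n k w)%:E = n%:R%:E)%E.
Proof.
have iV0 w : 0 <= (V k w)^-1.
  by rewrite invr_ge0; case/andP: (sieve_V01 k w) => /ltW.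
have miV : measurable_fun setT (fun w => (V k w)^-1).
  apply: measurable_inv_pos; first exact: measurable_sieve_V.
  by move=> w; case/andP: (sieve_V01 k w) => /ltW.
have mb (j : nat) : measurable_fun setT (fun w => ((0 < U j w) && (U j w <= V k w))%:R : R).
  have mB : measurable_fun setT (fun w => (0 < U j w) && (U j w <= V k w)).
    apply: measurable_and; first exact: measurable_fun_ltr.
    by apply: measurable_fun_ler => //; exact: measurable_sieve_V.
  by apply: measurable_natr_bool.
rewrite (eq_integral (fun w => \sum_(j < n)
   ((V k w)^-1 * (0 < U j w <= V k w)%R%:R)%:E))%E; last first.
  by move=> w _; rewrite mulr_sumr sumEFin.
rewrite ge0_integral_sum//; last 2 first.
- by move=> j; apply/measurable_EFinP/measurable_funM.
- by move=> j w _; rewrite lee_fin !mulr_ge0.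
rewrite (eq_bigr (fun=> 1%E)); first by rewrite sum_cst_EFin mulr1.
move=> j _.
have := @integral_between_uniform _ _ _ P _ _ (VW k) (U j)
  (fun z => z.1 `^ (-1)) (fun=> 0) fst.
rewrite /VW /= => h.
have pV w : V k w `^ (-1) = (V k w)^-1.
  by rewrite powR_inv1//; case/andP: (sieve_V01 k w) => /ltW.
under eq_integral do rewrite -pV.
rewrite h//; last 7 first.
- exact: mVW.
- exact: VW_U.
- exact: UU.
- exact: (@measurableT_comp _ _ _ _ _ _ (fun x : R => x `^ (-1)) _ fst
    (measurable_powR _) m1).
- by move=> w; rewrite pV.
- by move=> w; rewrite lexx /=; case/andP: (sieve_V01 k w) => /ltW.
- by move=> w; case/andP: (sieve_V01 k w).
rewrite (eq_integral (fun=> 1%E)) ?integral_cst//= ?mul1e ?probability_setT//.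
by move=> w _; rewrite pV subr0 mulVf// gt_eqF//; case/andP: (sieve_V01 k w).
Qed.

End sieve.

(** * Regularly varying tails *)

Section regular_variation.
Context (R : realType) (alpha : R) (l f : R -> R).
Hypothesis halpha : 0 < alpha < 1.
Hypothesis hl : slowly_varying l.
Hypothesis f0 : forall x, 0 <= f x <= 1.
Hypothesis fmono : forall x y, x <= y -> f y <= f x.
Hypothesis htail : f x / (x `^ (- alpha) * l x) @[x --> +oo] --> (1 : R).

(** The norming of the number of boxes, asymptotically the reciprocal of the tail. *)
Definition scaling x := x `^ alpha / l x.
Local Notation b := scaling.

Lemma cvg_scale_pinfty (c : R) : 0 < c -> c * x @[x --> +oo] --> +oo.
Proof. by move=> c0; apply: gt0_cvgMry => //; exact: cvg_id. Qed.

Lemma near_l_gt0 : \forall x \near +oo, 0 < l x.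
Proof. by case: hl. Qed.

Lemma scaling_tail : b x * f x @[x --> +oo] --> (1 : R).
Proof.
apply: cvg_trans htail; apply: near_eq_cvg; near=> x.
have x0 : 0 < x by near: x; exact: nbhs_pinfty_gt.
have l0 : 0 < l x by near: x; exact: near_l_gt0.
rewrite /b powRN; field; rewrite !gt_eqF// powR_gt0//.
Unshelve. all: by end_near. Qed.

Lemma scaling_ratio (c : R) : 0 < c ->
  b x / b (c * x) @[x --> +oo] --> c `^ (- alpha).
Proof.
move=> c0; have [_ _ /(_ c c0) hc] := hl.
rewrite -[X in _ --> X]mulr1.
have : c `^ (- alpha) * (l (c * x) / l x) @[x --> +oo] --> c `^ (- alpha) * 1.
  by apply: cvgM => //; exact: cvg_cst.
apply: cvg_trans; apply: near_eq_cvg; near=> x.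
have x0 : 0 < x by near: x; exact: nbhs_pinfty_gt.
have l0 : 0 < l x by near: x; exact: near_l_gt0.
have lc0 : 0 < l (c * x).
  by near: x; exact: (cvg_scale_pinfty c0 near_l_gt0).
rewrite /b powRM ?ltW// powRN; field.
by rewrite !gt_eqF// powR_gt0.
Unshelve. all: by end_near. Qed.

Lemma near_scaling_gt0 : \forall x \near +oo, 0 < b x.
Proof.
near=> x; rewrite divr_gt0//; last by near: x; exact: near_l_gt0.
by rewrite powR_gt0//; near: x; exact: nbhs_pinfty_gt.
Unshelve. all: by end_near. Qed.

(** A tail that vanishes somewhere vanishes from there on, whereas it is asymptotic
    to a positive function. *)
Lemma tail_gt0 x : 0 < f x.
Proof.
have : \forall y \near +oo, 2^-1 < b y * f y.
  by have /cvgr_gt := scaling_tail; apply; lra.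
move=> h; near +oo_R => y.
have xy : x <= y by near: y; apply: nbhs_pinfty_ge; exact: num_real.
have y1 : 2^-1 < b y * f y by near: y.
have b1 : 0 < b y by near: y; exact: near_scaling_gt0.
rewrite (lt_le_trans _ (fmono xy))// -(pmulr_rgt0 _ b1); lra.
Unshelve. all: by end_near. Qed.

Lemma scaling_tail_at (y : R) : 0 < y ->
  b x * f (x * y) @[x --> +oo] --> y `^ (- alpha).
Proof.
move=> y0; rewrite -[X in _ --> X]mulr1.
have h1 : b (y * x) * f (y * x) @[x --> +oo] --> (1 : R).
  exact: (cvg_comp (fun x => y * x) (fun z => b z * f z) (cvg_scale_pinfty y0) scaling_tail).
have h2 : b x / b (y * x) * (b (y * x) * f (y * x)) @[x --> +oo] -->
    y `^ (- alpha) * 1 by apply: cvgM => //; exact: scaling_ratio.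
apply: cvg_trans h2; apply: near_eq_cvg; near=> x.
have b1 : 0 < b (y * x).
  by near: x; exact: (cvg_scale_pinfty y0 near_scaling_gt0).
by rewrite [x * y]mulrC; rewrite /=; field; rewrite gt_eqF.
Unshelve. all: by end_near. Qed.

(* Any exponent strictly between [alpha] and 1 works: larger than [alpha] to absorb
   the slowly varying factor, smaller than 1 for integrability at 0. *)
Let beta := (1 + alpha) / 2.

(** A bound of Potter type. Iterating [f (x / 2) <= 2 `^ beta * f x] down to a fixed
    level bounds [f (x * y) / f x] by a power of [y] that is integrable at 0,
    uniformly in [x]. *)
Lemma scaling_tail_bound : exists2 C : R, 0 <= C & \forall x \near +oo,
  [/\ 0 < b x, forall y : R, 0 < y -> y <= 1 -> b x * f (x * y) <= C * y `^ (- beta) &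
   forall y, 1 <= y -> b x * f (x * y) <= 2].
Proof.
have /andP[a0 a1] := halpha.
pose lam : R := 2 `^ beta.
have lam1 : 1 <= lam.
  rewrite -[leLHS](powRr0 2) /lam ler_powR//; last by rewrite /beta; lra.
  by rewrite ler1n.
have hlt : 2^-1 `^ (- alpha) < lam.
  rewrite powRN -[2^-1]powR_inv1// -powRrM mulN1r powRN invrK.
  rewrite /lam /powR !gt_eqF// ltr_expR ltr_pM2r ?ln_gt0 ?ltr1n// /beta; lra.
have half0 : 0 < 2^-1 :> R by rewrite invr_gt0.
have hh : f (x * 2^-1) / f x @[x --> +oo] --> 2^-1 `^ (- alpha).
  rewrite -[X in _ --> X]divr1.
  have h3 := scaling_tail_at half0.
  have h4 : b x * f (x * 2^-1) * (b x * f x)^-1 @[x --> +oo] -->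
      2^-1 `^ (- alpha) * 1^-1.
    by apply: cvgM => //; apply: cvgV; [exact: oner_neq0|exact: scaling_tail].
  rewrite invr1; rewrite invr1 in h4.
  apply: cvg_trans h4; apply: near_eq_cvg; near=> x => /=.
  have b1 : 0 < b x by near: x; exact: near_scaling_gt0.
  by field; rewrite !gt_eqF// tail_gt0.
have /cvgr_lt/(_ _ hlt) h3 := hh.
have h4 : \forall x \near +oo, b x * f x < 2.
  by have /cvgr_lt := scaling_tail; apply; rewrite ltr1n.
have [M [Mr hM]] : \forall x \near +oo,
    [/\ 0 < x, 0 < b x, b x * f x <= 2 & f (x * 2^-1) <= lam * f x].
  near=> x; split.
  - by near: x; exact: nbhs_pinfty_gt.
  - by near: x; exact: near_scaling_gt0.
  - by rewrite ltW//; near: x.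
  - by rewrite -ler_pdivrMr ?tail_gt0// ltW//; near: x.
pose x0 := Num.max (M + 1) 1.
have x0P x : x0 <= x ->
    [/\ 0 < x, 0 < b x, b x * f x <= 2 & f (x * 2^-1) <= lam * f x].
  by move=> xx; apply: hM; rewrite (lt_le_trans _ xx)// /x0 lt_max ltrDl ltr01.
have x00 : 0 < x0 by rewrite /x0 lt_max ltr01 orbT.
pose C0 := (f (2 * x0))^-1.
have C00 : 0 < C0 by rewrite invr_gt0 tail_gt0.
have C01 : 1 <= C0 by rewrite invr_ge1 ?unitf_gt0 ?tail_gt0//; case/andP: (f0 (2 * x0)).
(* Below the level [2 * x0] the halving stops and the bound [f <= 1] takes over; the
   constant [C0] pays for this. *)
have iter m x : x0 <= x -> f (x * 2^-1 ^+ m) <= C0 * lam ^+ m * f x.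
  elim: m x => [|m IH] x xx.
    by rewrite !expr0 !mulr1 ler_peMl// ltW// tail_gt0.
  have [_ _ _ fx] := x0P x xx.
  have [x2|x2] := leP (2 * x0) x.
    rewrite exprS mulrA (le_trans (IH _ _))//.
      by rewrite ler_pdivlMr// mulrC.
    by rewrite exprSr -!mulrA ler_wpM2l ?(ltW C00)// ler_wpM2l// exprn_ge0// (le_trans ler01).
  rewrite (@le_trans _ _ 1)//; first by case/andP: (f0 (x * 2^-1 ^+ m.+1)).
  have fx2 : f (2 * x0) <= f x by apply: fmono; exact: ltW.
  have h5 : 1 <= C0 * f x.
    by rewrite /C0 mulrC ler_pdivlMr ?tail_gt0// mul1r.
  rewrite mulrAC (le_trans h5)//.
  by rewrite ler_peMr ?(le_trans ler01 h5)// exprn_ege1.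
exists (2 * (C0 * lam)).
  by rewrite !mulr_ge0// ?(ltW C00)// (le_trans ler01).
exists x0; split; first exact: num_real.
move=> x /ltW xx; have [x_0 bx bf fx] := x0P x xx; split => //; last first.
  move=> y y1; rewrite (le_trans _ bf)// ler_wpM2l ?(ltW bx)//.
  by apply: fmono; rewrite ler_peMr// ltW.
move=> y y0 y1.
have ex : exists m, 2^-1 ^+ m.+1 < y.
  have : 2^-1 ^+ n @[n --> \oo] --> (0 : R).
    by apply: cvg_expr; rewrite gtr0_norm ?invr_gt0// invf_lt1// ltr1n.
  move=> /cvgr_lt/(_ _ y0)[N _ hN]; exists N.
  by apply: hN => /=.
have [m hm mmin] := ex_minnP ex.
have ym : y <= 2^-1 ^+ m.
  case: m hm mmin => [|m] hm mmin; first by rewrite expr0.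
  by rewrite leNgt; apply/negP => /mmin; rewrite ltnn.
have h6 : f (x * y) <= C0 * lam ^+ m.+1 * f x.
  rewrite (le_trans _ (iter _ _ xx))//; apply: fmono.
  by rewrite ler_wpM2l// ltW.
have h7 : lam ^+ m <= y `^ (- beta).
  rewrite /lam -powR_mulrn ?powR_ge0// powRAC powR_mulrn// powRN.
  have -> : (y `^ beta)^-1 = y^-1 `^ beta.
    by rewrite -[y^-1]powR_inv1 ?ltW// -powRrM mulN1r powRN.
  rewrite ge0_ler_powR//; first by rewrite /beta; lra.
  - by rewrite nnegrE exprn_ge0.
  - by rewrite nnegrE invr_ge0 ltW.
  by rewrite -[leLHS]invrK lef_pV2 ?posrE ?invr_gt0 ?exprn_gt0// -exprVn.
rewrite (@le_trans _ _ (b x * (C0 * lam ^+ m.+1 * f x)))// ?ler_wpM2l ?(ltW bx)//.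
have -> : b x * (C0 * lam ^+ m.+1 * f x) = (b x * f x) * (C0 * lam) * lam ^+ m.
  by rewrite exprS; ring.
have fp := ltW (tail_gt0 x); have lam0 : 0 <= lam by exact: le_trans lam1.
apply: ler_pM => //.
- by apply: mulr_ge0; apply: mulr_ge0 => //; exact: ltW.
- by rewrite exprn_ge0// (le_trans ler01).
- by rewrite ler_wpM2r// mulr_ge0 ?(ltW C00)// (le_trans ler01).
Unshelve. all: by end_near. Qed.

Hypothesis f_cvg0 : f x @[x --> +oo] --> (0 : R).

Lemma cvg_scaling_pinfty : b x @[x --> +oo] --> +oo.
Proof.
apply/cvgryPge => A; near=> x.
have fx : f x < (2 * (`|A| + 1))^-1.
  near: x; move/cvgr_lt : f_cvg0; apply.
  by rewrite invr_gt0 mulr_gt0// ltr_wpDl.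
have bf : 2^-1 < b x * f x.
  by near: x; have /cvgr_gt := scaling_tail; apply; lra.
have b0 : 0 < b x by near: x; exact: near_scaling_gt0.
have A0 : 0 < `|A| + 1 by rewrite ltr_wpDl.
have : 2^-1 < b x * (2 * (`|A| + 1))^-1.
  by rewrite (lt_le_trans bf)// ler_wpM2l// ltW.
rewrite ltr_pdivlMr ?mulr_gt0// mulrA mulVf// mul1r => h.
by rewrite (le_trans (ler_norm A))// (le_trans _ (ltW h))// lerDl.
Unshelve. all: by end_near. Qed.

End regular_variation.

(** * An Abelian theorem for the Laplace transform *)

Lemma powR01 (R : realType) (w z : R) : 0 < w <= 1 -> 0 <= z -> 0 <= w `^ z <= 1.
Proof.
by move=> w01 z0; rewrite powR_ge0/= -[leRHS](powRr0 w) ger_powR.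
Qed.

Section abelian.
Context (R : realType).
Local Notation mu := (@lebesgue_measure R).

(** The fundamental theorem of calculus bounds the integrals over the intervals from
    [1 / k] to 1. *)
Lemma integrable_powR_near0 (beta : R) : 0 < beta < 1 ->
  mu.-integrable `]0, 1]%classic (EFin \o (fun y => y `^ (- beta))).
Proof.
move=> /andP[be0 be1].
have mpow D : measurable_fun D (EFin \o (fun y : R => y `^ (- beta))).
  by apply/measurable_EFinP; apply: measurable_funTS; exact: measurable_powR.
apply/integrableP; split; first exact: mpow.
under eq_integral do rewrite /= ger0_norm ?powR_ge0//.
pose F (k : nat) : set R := `[k.+2%:R^-1, 1]%classic.
have FU : \bigcup_k F k = `]0, 1]%classic.
  apply/seteqP; split => y /=.
    move=> [k _]; rewrite /F /= !in_itv/= => /andP[ky ->].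
    by rewrite andbT (lt_le_trans _ ky)// invr_gt0.
  rewrite in_itv/= => /andP[y0 y1].
  exists (Num.truncn y^-1) => //; rewrite /F /= in_itv/= y1 andbT.
  rewrite -[leRHS]invrK lef_pV2 ?posrE ?invr_gt0//.
  by rewrite (le_trans (ltW (truncnS_gt _)))// ler_nat.
have be : 1 - beta != 0 by rewrite gt_eqF// subr_gt0.
have FI k : (\int[mu]_(y in F k) (y `^ (- beta))%:E <= ((1 - beta)^-1)%:E)%E.
  have k1 : k.+2%:R^-1 < 1 :> R by rewrite invf_lt1// ltr1n.
  have k0 : 0 < k.+2%:R^-1 :> R by rewrite invr_gt0.
  have in_pos (y : R) : k.+2%:R^-1 <= y -> y \in `]0, +oo[.
    by move=> ky; rewrite in_itv/= andbT (lt_le_trans k0).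
  pose G (y : R) := (1 - beta)^-1 * y `^ (1 - beta).
  have dG (y : R) : k.+2%:R^-1 <= y -> derivable G y 1.
    by move=> ky; apply: derivableM => //; apply: derivable_powR; exact: in_pos.
  have cG (y : R) : k.+2%:R^-1 <= y -> {for y, continuous G}.
    move=> ky; apply: differentiable_continuous; rewrite -derivable1_diffP.
    exact: dG.
  rewrite (@continuous_FTC2 _ (fun y => y `^ (- beta)) G)//.
  - rewrite /G powR1 mulr1 -EFinB lee_fin gerBl mulr_ge0// ?powR_ge0//.
    by rewrite invr_ge0 subr_ge0 ltW.
  - apply: derivable_within_continuous => y; rewrite in_itv/= => /andP[ky _].
    by apply: derivable_powR; exact: in_pos.
  - split.
    + by move=> y; rewrite in_itv/= => /andP[/ltW ky _]; exact: dG.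
    + by apply: cvg_at_right_filter; exact: cG.
    + by apply: cvg_at_left_filter; apply: cG; exact: ltW.
  - move=> y; rewrite in_itv/= => /andP[/ltW ky _].
    rewrite /G derive1Ml; last by apply: derivable_powR; exact: in_pos.
    rewrite powR_derive1 ?in_pos// mulrA mulVf// mul1r.
    by congr (_ `^ _); ring.
have ndF : nondecreasing_seq F.
  move=> m n mn; apply/subsetPset => y; rewrite /F /= !in_itv/= => /andP[my ->].
  rewrite andbT (le_trans _ my)// lef_pV2 ?posrE//.
  by rewrite ler_nat !ltnS.
have h : (\int[mu]_(x in F i) (x `^ (- beta))%:E)%E @[i --> \oo] -->
    (\int[mu]_(x in `]0%R, 1%R]%classic) (x `^ (- beta))%:E)%E.
  rewrite -FU; apply: ge0_nondecreasing_set_cvg_integral => //.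
  - by move=> i; exact: measurable_itv.
  - by move=> i; exact: mpow.
  - by move=> i x _; rewrite lee_fin powR_ge0.
rewrite -(cvg_lim _ h)// (@le_lt_trans _ _ ((1 - beta)^-1)%:E) ?ltry//.
apply: lime_le; last by apply: nearW => k; exact: FI.
by apply/cvg_ex; eexists; exact: h.
Qed.

Context d0 (T0 : measurableType d0) (P0 : probability T0 R) (W0 : {RV P0 >-> R}).
Hypothesis hW0 : forall w, 0 < W0 w < 1.

Definition log_tail (x : R) : R := fine (P0 [set w | `|ln (W0 w)| > x]).

Let X w := `|ln (W0 w)|.
Let mX : measurable_fun setT X.
Proof.
apply: measurableT_comp => //; apply: measurableT_comp => //.
Qed.
Let Xrv : {RV P0 >-> R} := HB.pack X (isMeasurableFun.Build _ _ _ _ _ mX).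

Let tailE x : log_tail x = fine (ccdf Xrv x).
Proof.
rewrite /log_tail /ccdf /distribution /pushforward; congr (fine (P0 _)).
by apply/seteqP; split=> w /=; rewrite in_itv/= andbT.
Qed.

Let tail_fin x : (log_tail x)%:E = ccdf Xrv x.
Proof. by rewrite tailE fineK// fin_num_measure. Qed.

Lemma log_tail01 x : 0 <= log_tail x <= 1.
Proof.
by rewrite tailE fine_ge0//= -lee_fin -tailE tail_fin probability_le1.
Qed.

Lemma log_tail_noninc x y : x <= y -> log_tail y <= log_tail x.
Proof. by move=> xy; rewrite -lee_fin !tail_fin; exact: ccdf_nonincreasing. Qed.

Lemma log_tail_cvg0 : log_tail x @[x --> +oo] --> (0 : R).
Proof.
rewrite (_ : log_tail = fine \o ccdf Xrv); last first.
  by apply/funext => x /=; rewrite tailE.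
by apply: fine_cvg; exact: cvg_ccdfy0.
Qed.

Lemma measurable_log_tail : measurable_fun setT log_tail.
Proof.
apply/measurable_EFinP; rewrite (_ : EFin \o _ = ccdf Xrv).
  exact: ccdf_measurable.
by apply/funext => x /=; rewrite tail_fin.
Qed.

Local Notation pdf1 := (exponential_pdf (1 : R)).

Let XE w : X w = - ln (W0 w).
Proof.
by rewrite /X ler0_norm// ln_le0// ltW//; case/andP: (hW0 w).
Qed.

Let X_gt0 w : 0 < X w.
Proof. by rewrite XE oppr_gt0 ln_lt0//; exact: hW0. Qed.

Let pdf_le (a : R) : 0 < a -> (\int[mu]_y (pdf1 y * (y < a)%R%:R)%:E = (1 - expR (- a))%:E)%E.
Proof.
pose D : set R := `[0, a[%classic.
move=> a0; transitivity (\int[mu]_(y in D) (pdf1 y)%:E)%E.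
  rewrite [RHS]integral_mkcond; apply: eq_integral => y _.
  rewrite patchE; case: ifPn.
    by rewrite inE /D /= in_itv/= => /andP[_ ->]; rewrite mulr1.
  move=> yn; have [y0|y0] := ltP y 0; first by rewrite lt0_exponential_pdf// mul0r.
  case: (ltP y a) => ya; last by rewrite mulr0.
  by exfalso; move/negP: yn; apply; rewrite inE /D /= in_itv/= y0 ya.
rewrite /D integral_itv_bndo_bndc//; last first.
  apply/measurable_EFinP; apply: measurable_funTS.
  exact: measurable_exponential_pdf.
have := @exponential_prob_itv0c R 1 a a0; rewrite /exponential_prob => ->.
by rewrite mulN1r -EFinB.
Qed.

(** [1 - W ^ (1 / x) = 1 - exp (- X / x)] is the probability that a standard
    exponential variable is less than [X / x]. *)
Lemma laplace_log_tail x : 0 < x ->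
  (Ex P0 (fun w => 1 - W0 w `^ x^-1))%:E =
  (\int[mu]_y (pdf1 y * log_tail (x * y))%:E)%E.
Proof.
move=> x0.
have W01 w : 0 <= W0 w `^ x^-1 <= 1.
  have /andP[w0 w1] := hW0 w.
  by apply: powR01; rewrite ?w0 ?invr_ge0 ltW.
have bW : bmeas (fun w => 1 - W0 w `^ x^-1).
  split; last first.
    by exists 1 => w; have := W01 w; rewrite ler_norml => /andP[]; lra.
  apply: measurable_funB => //.
  by apply: (@measurableT_comp _ _ _ _ _ _ (fun z : R => z `^ x^-1)) => //;
    exact: measurable_powR.
rewrite -bmeas_fin// unlock.
pose h (z : T0 * R) : \bar R := (pdf1 z.2 * (z.2 < X z.1 / x)%R%:R)%:E.
have m1 : measurable_fun setT (fst : T0 * R -> T0) by exact: measurable_fst.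
have m2 : measurable_fun setT (snd : T0 * R -> R) by exact: measurable_snd.
have mh : measurable_fun setT h.
  apply/measurable_EFinP; apply: measurable_funM.
    by apply: measurableT_comp => //; exact: measurable_exponential_pdf.
  have mB : measurable_fun setT (fun z : T0 * R => z.2 < X z.1 / x).
    apply: measurable_fun_ltr => //; apply: measurable_funM => //.
    exact: measurableT_comp.
  by apply: measurable_natr_bool.
have h0 z : (0 <= h z)%E.
  by rewrite lee_fin mulr_ge0// exponential_pdf_ge0.
transitivity (\int[P0]_w \int[mu]_y h (w, y))%E.
  apply: eq_integral => w _.
  rewrite /h /= pdf_le ?divr_gt0//; congr (1 - _)%:E.
  rewrite /powR gt_eqF; last by case/andP: (hW0 w).
  by congr expR; rewrite XE mulNr opprK mulrC.
rewrite fubini_tonelli//; apply: eq_integral => y _; rewrite /h /=.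
under eq_integral do rewrite EFinM.
rewrite ge0_integralZl//; last 2 first.
- have mB : measurable_fun setT (fun w => y < X w / x).
    by apply: measurable_fun_ltr => //; exact: measurable_funM.
  apply/measurable_EFinP.
  by apply: measurable_natr_bool.
- by rewrite lee_fin exponential_pdf_ge0.
rewrite EFinM; congr (_ * _)%E.
have mS : measurable [set w | x * y < X w].
  rewrite [X in measurable X](_ : _ = X @^-1` `]x * y, +oo[).
    by rewrite -[X in measurable X]setTI; exact: mX.
  by apply/seteqP; split=> w /=; rewrite in_itv/= andbT.
rewrite (eq_integral (fun w => (\1_[set w | x * y < X w] w)%:E)); last first.
  move=> w _; rewrite indicE ltr_pdivlMr// [y * x]mulrC; congr (nat_of_bool _)%:R%:E.
  by apply/idP/idP; rewrite inE.
by rewrite integral_indic// setIT /log_tail fineK// fin_num_measure.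
Qed.

Context (alpha : R) (l : R -> R).
Hypothesis halpha : 0 < alpha < 1.
Hypothesis hl : slowly_varying l.
Hypothesis htail : log_tail x / (x `^ (- alpha) * l x) @[x --> +oo] --> (1 : R).
Local Notation b := (scaling alpha l).

Lemma Gamma_pdf : (\int[mu]_y (pdf1 y * y `^ (- alpha))%:E =
  \int[mu]_(y in `]0%R, +oo[) (y `^ (1 - alpha - 1) * expR (- y))%:E)%E.
Proof.
rewrite [RHS]integral_mkcond; apply: eq_integral => y _; rewrite patchE.
have /andP[a0 _] := halpha.
case: ifPn; last first.
  rewrite notin_setE /= in_itv/= andbT => /negP; rewrite -leNgt le_eqVlt.
  case/predU1P => [->|y0]; last by rewrite lt0_exponential_pdf// mul0r.
  by rewrite powR0 ?mulr0// oppr_eq0 gt_eqF.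
rewrite inE/= in_itv/= andbT => y0.
rewrite /exponential_pdf patchE mem_set ?mul1r; last first.
  by rewrite /= in_itv/= ltW.
by rewrite mulN1r mulrC; congr ((_ `^ _) * _)%:E; ring.
Qed.

(** Dominated convergence in the formula for the Laplace transform: after
    multiplication by [b], the integrand tends to [exp (- y) * y `^ (- alpha)]. *)
Lemma abelian (x_ : nat -> R) : x_ n @[n --> \oo] --> +oo ->
  b (x_ n) * Ex P0 (fun w => 1 - W0 w `^ (x_ n)^-1) @[n --> \oo] -->
    Gamma (1 - alpha).
Proof.
move=> xoo; have /andP[a0 a1] := halpha.
pose beta := (1 + alpha) / 2.
have be01 : 0 < beta < 1 by rewrite /beta; apply/andP; split; lra.
have [C C0 hC] := scaling_tail_bound halpha hl log_tail01 log_tail_noninc htail.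
have [N _ hN] : \forall n \near \oo, 0 < x_ n /\
  [/\ 0 < b (x_ n),
   forall y : R, 0 < y -> y <= 1 ->
     b (x_ n) * log_tail (x_ n * y) <= C * y `^ (- beta) &
   forall y : R, 1 <= y -> b (x_ n) * log_tail (x_ n * y) <= 2].
  near=> n; split; last by near: n; exact: (xoo _ hC).
  by near: n; apply: (xoo [set x | 0 < x]); exact: nbhs_pinfty_gt.
rewrite -(cvg_shiftn N).
pose g n (y : R) : \bar R := (pdf1 y * (b (x_ (n + N)%N) * log_tail (x_ (n + N)%N * y)))%:E.
pose g0 (y : R) : \bar R := (pdf1 y * y `^ (- alpha))%:E.
pose D : set R := `]0, 1]%classic.
pose near0 (y : R) : \bar R := (C * y `^ (- beta))%:E.
pose dom (y : R) : \bar R := ((near0 \_ D) y + (2 * pdf1 y)%:E)%E.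
have mpdf := measurable_exponential_pdf (1 : R).
have intE n : (\int[mu]_y g n y =
    (b (x_ (n + N)%N) * Ex P0 (fun w => 1 - W0 w `^ (x_ (n + N)%N)^-1))%:E)%E.
  have [xn [bn _ _]] := hN (n + N)%N (leq_addl _ _).
  rewrite EFinM laplace_log_tail// -ge0_integralZl//.
  - by apply: eq_integral => y _; rewrite -EFinM /g; congr (_%:E); ring.
  - apply/measurable_EFinP; apply: measurable_funM => //.
    apply: (@measurableT_comp _ _ _ _ _ _ log_tail).
      exact: measurable_log_tail.
    exact: measurable_funM.
  - move=> y _; rewrite lee_fin mulr_ge0 ?exponential_pdf_ge0//.
    by case/andP: (log_tail01 (x_ (n + N)%N * y)).
  - by rewrite lee_fin ltW.
have near0_ge0 y : (0 <= (near0 \_ D) y)%E.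
  by apply: erestrict_ge0 => z _; rewrite lee_fin mulr_ge0// powR_ge0.
have pdf0 y : 0 <= pdf1 y by exact: exponential_pdf_ge0.
have pdf1_le1 y : pdf1 y <= 1.
  have [y0|y0] := leP 0 y; last by rewrite lt0_exponential_pdf.
  by rewrite exponential_pdfE// mul1r -[leRHS]expR0 ler_expR mulN1r oppr_le0.
have [] := @dominated_convergence _ (measurableTypeR R) R mu setT measurableT g g0 dom.
  - move=> n; apply/measurable_EFinP; apply: measurable_funM => //.
    apply: measurable_funM => //; apply: (@measurableT_comp _ _ _ _ _ _ log_tail).
      exact: measurable_log_tail.
    exact: measurable_funM.
  - by apply/measurable_EFinP; apply: measurable_funM => //; exact: measurable_powR.
  - exists [set 0]; split; [exact: measurable_set1|exact: lebesgue_measure_set1|].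
    move=> y /= hy; apply: contrapT => y0; apply: hy => _.
    have [yl|yg|ye] := ltgtP y 0; last by exfalso; apply: y0.
      rewrite /g /g0 lt0_exponential_pdf//; under eq_fun do rewrite mul0r.
      by rewrite mul0r; exact: cvg_cst.
    apply: cvg_EFin; first exact: nearW.
    rewrite /g /=; apply: cvgM; first exact: cvg_cst.
    have h := scaling_tail_at hl htail yg.
    by have := cvg_comp _ _ xoo h; rewrite -(cvg_shiftn N).
  - apply: integrableD => //.
      have mD : measurable (D : set (measurableTypeR R)) by exact: measurable_itv.
      rewrite -integrable_mkcond//.
      have -> : near0 = (fun y => C%:E * (EFin \o (fun z : R => (z `^ (- beta))%R)) y)%E.
        by apply/funext => y; rewrite /near0 EFinM.
      by apply: integrableZl => //; exact: integrable_powR_near0.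
    have -> : (fun y => (2 * pdf1 y)%:E) = (fun y => 2%:E * (EFin \o pdf1) y)%E.
      by apply/funext => y; rewrite EFinM.
    by apply: integrableZl => //; exact: integrable_exponential_pdf.
  - exists [set 0]; split; [exact: measurable_set1|exact: lebesgue_measure_set1|].
    move=> y /= hy; apply: contrapT => y0; apply: hy => n _.
    have [xn [bn h1 h2]] := hN (n + N)%N (leq_addl _ _).
    have bf0 : 0 <= b (x_ (n + N)%N) * log_tail (x_ (n + N)%N * y).
      by rewrite mulr_ge0 ?(ltW bn)//; case/andP: (log_tail01 (x_ (n + N)%N * y)).
    rewrite /g /= (ger0_norm (mulr_ge0 (pdf0 _) bf0)).
    have [yl|yg|ye] := ltgtP y 0; last by exfalso; apply: y0.
      by rewrite lt0_exponential_pdf// mul0r adde_ge0// lee_fin mulr_ge0.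
    have [y1|y1] := leP y 1.
      rewrite (@le_trans _ _ ((near0 \_ D) y))//; last first.
        by rewrite leeDl// lee_fin mulr_ge0.
      rewrite patchE mem_set; last by rewrite /D /= in_itv/= yg y1.
      by rewrite lee_fin (le_trans _ (h1 y yg y1))// ler_piMl.
    rewrite (@le_trans _ _ (2 * pdf1 y)%:E)//; last by rewrite leeDr.
    by rewrite lee_fin mulrC ler_wpM2r// h2// ltW.
move=> ig0 _ hcv.
have gE : (\int[mu]_y g0 y = (Gamma (1 - alpha))%:E)%E.
  rewrite /Gamma /Rintegral -Gamma_pdf fineK//.
  exact: integrable_fin_num.
rewrite gE in hcv.
have hfin := fine_cvg hcv.
rewrite (_ : [sequence _]_n = fine \o [sequence (\int[mu]_y g n y)%E]_n).
  exact: hfin.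
by apply/funext => n /=; rewrite intE.
Unshelve. all: by end_near.
Qed.

End abelian.

Lemma pow_expR_le (R : realType) (a : R) k : a <= 1 ->
  (1 - a) ^+ k <= expR (- (k%:R * a)).
Proof.
move=> a1; rewrite -mulrN expRM_natl lerXn2r ?nnegrE ?expR_ge0 ?subr_ge0//.
by have := expR_ge1Dx (- a); lra.
Qed.

Lemma pow_expR_ge (R : realType) (a : R) k : a < 1 ->
  expR (- (k%:R * a / (1 - a))) <= (1 - a) ^+ k.
Proof.
move=> a1; have a10 : 0 < 1 - a by rewrite subr_gt0.
rewrite -mulrA -mulrN expRM_natl lerXn2r ?nnegrE ?expR_ge0 ?(ltW a10)//.
rewrite expRN -[leRHS]invrK lef_pV2 ?posrE ?invr_gt0 ?expR_gt0//.
apply: le_trans (expR_ge1Dx _).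
by rewrite le_eqVlt; apply/orP; left; apply/eqP; field; rewrite gt_eqF.
Qed.

Lemma cvg_pow_expR (R : realType) (a : nat -> R) (k : nat -> nat) (c : R) :
  (forall n, 0 <= a n <= 1) -> a n @[n --> \oo] --> (0 : R) ->
  (k n)%:R * a n @[n --> \oo] --> c ->
  (1 - a n) ^+ k n @[n --> \oo] --> expR (- c).
Proof.
move=> a01 a0 kac.
have up : expR (- ((k n)%:R * a n)) @[n --> \oo] --> expR (- c).
  by apply: continuous_cvg; [exact: continuous_expR|exact: cvgN].
have lo : expR (- ((k n)%:R * a n / (1 - a n))) @[n --> \oo] --> expR (- c).
  apply: continuous_cvg; [exact: continuous_expR|apply: cvgN].
  rewrite -[X in _ --> X]divr1; apply: cvgM => //; apply: cvgV.
    exact: oner_neq0.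
  by rewrite -[X in _ --> X]subr0; apply: cvgB => //; exact: cvg_cst.
apply: squeeze_cvgr lo up; near=> n; apply/andP; split.
  apply: pow_expR_ge; near: n; move/cvgr_lt : a0; apply; exact: ltr01.
by apply: pow_expR_le; case/andP: (a01 n).
Unshelve. all: by end_near. Qed.

Lemma Ex_same_law (R : realType) d (T : measurableType d) (P : probability T R)
    d' (T' : measurableType d') (Q : probability T' R) (X : T -> R) (Y : T' -> R)
    (f : R -> R) :
  measurable_fun setT X -> measurable_fun setT Y -> same_law P Q X Y ->
  measurable_fun setT f -> (forall x, 0 <= f x) ->
  'E_P[fun w => f (X w)]%E = 'E_Q[fun w => f (Y w)]%E.
Proof.
move=> mX mY XY mf f0; rewrite unlock.
pose Xm : {mfun T >-> R} := HB.pack X (isMeasurableFun.Build _ _ _ _ _ mX).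
pose Ym : {mfun T' >-> R} := HB.pack Y (isMeasurableFun.Build _ _ _ _ _ mY).
transitivity (\int[distribution P Xm]_x (f x)%:E)%E.
  rewrite ge0_integral_distribution//; last exact/measurable_EFinP.
transitivity (\int[distribution Q Ym]_x (f x)%:E)%E.
  by apply: eq_measure_integral => A mA _; exact: XY.
rewrite ge0_integral_distribution//; last exact/measurable_EFinP.
Qed.

Lemma prod_blocks (R : realType) (F : nat -> R) L k :
  \prod_(l < L * k) F l = \prod_(i < L) \prod_(j < k) F (i * k + j)%N.
Proof.
elim: L => [|L IH]; first by rewrite mul0n !big_ord0.
rewrite big_ord_recr /= -IH mulSn addnC.
by rewrite big_split_ord.
Qed.

Lemma cvg_ln_natr (R : realType) : (ln n%:R : R) @[n --> \oo] --> +oo.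
Proof.
apply/cvgryPge => A; near=> n.
have h : expR A <= n%:R by near: n; exact: nbhs_infty_ger.
by rewrite -ler_expR lnK// posrE (lt_le_trans (expR_gt0 A)).
Unshelve. all: by end_near. Qed.

Section block_laplace.
Context (R : realType) d0 (T0 : measurableType d0) (P0 : probability T0 R)
  (W0 : {RV P0 >-> R}) (alpha : R) (l : R -> R).
Hypothesis hW0 : forall w, 0 < W0 w < 1.
Hypothesis halpha : 0 < alpha < 1.
Hypothesis hl : slowly_varying l.
Hypothesis htail :
  log_tail W0 x / (x `^ (- alpha) * l x) @[x --> +oo] --> (1 : R).
Local Notation b := (scaling alpha l).

Lemma W0_pow01 (z : R) : 0 <= z -> forall w, 0 <= W0 w `^ z <= 1.
Proof. by move=> z0 w; have /andP[w0 w1] := hW0 w; apply: powR01 => //; rewrite w0 ltW. Qed.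

Lemma bmeas_W0_pow (z : R) : 0 <= z -> bmeas (fun w => W0 w `^ z).
Proof.
move=> z0; split.
  by apply: (@measurableT_comp _ _ _ _ _ _ (fun x : R => x `^ z)) => //;
    exact: measurable_powR.
by exists 1 => w; have /andP[h0 h1] := W0_pow01 z0 w; rewrite ger0_norm.
Qed.

Let a_ (x : R) := Ex P0 (fun w => 1 - W0 w `^ x^-1).

Let a01 (x : R) : 0 < x -> 0 <= a_ x <= 1.
Proof.
move=> x0; have x0' : 0 <= x^-1 by rewrite invr_ge0 ltW.
apply/andP; split.
  rewrite -[leLHS](Ex_cst P0); apply: (@Ex_le _ _ _ _ _ _ 1) => w.
  - by rewrite normr0.
  - by have := W0_pow01 x0' w; rewrite ler_norml => /andP[]; lra.
  - by have := W0_pow01 x0' w; lra.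
rewrite -[leRHS](Ex_cst P0); apply: (@Ex_le _ _ _ _ _ _ 1) => w.
- by have := W0_pow01 x0' w; rewrite ler_norml => /andP[]; lra.
- by rewrite normr1.
- by have := W0_pow01 x0' w; lra.
Qed.

(** The Abelian theorem identifies the constant as the limit of
    [b n * E (1 - W `^ (1 / n))], and on the event that [- ln W > n] the integrand is
    at least [1 - exp (- 1)]. *)
Lemma Gamma_gt0 : 0 < Gamma (1 - alpha).
Proof.
have xoo : n%:R @[n --> \oo] --> (+oo : set_system R) by exact: cvgr_idn.
have h := abelian hW0 halpha hl htail xoo.
have h2 : b n%:R * log_tail W0 n%:R @[n --> \oo] --> (1 : R).
  exact: (cvg_comp (fun n : nat => n%:R) (fun z => b z * log_tail W0 z) xoo
    (scaling_tail hl htail)).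
have h3 : (1 - expR (-1)) * (b n%:R * log_tail W0 n%:R) @[n --> \oo] -->
    ((1 - expR (-1)) * 1 : R) by apply: cvgM => //; exact: cvg_cst.
have e1 : expR (-1) < 1 :> R by rewrite -[ltRHS]expR0 ltr_expR; lra.
have : (1 - expR (-1)) * 1 <= Gamma (1 - alpha).
  apply: (ler_cvg_to h3 h); near=> n.
  have n0 : 0 < n%:R :> R by rewrite ltr0n; near: n; exact: nbhs_infty_gt.
  have n0' : 0 <= n%:R^-1 :> R by rewrite invr_ge0 ltW.
  have bn : 0 < b n%:R by near: n; exact: (xoo _ (near_scaling_gt0 alpha hl)).
  rewrite mulrCA ler_wpM2l ?(ltW bn)//.
  have mS : measurable [set w | n%:R < `|ln (W0 w)|].
    rewrite [X in measurable X](_ : _ = (fun w => `|ln (W0 w)|) @^-1` `]n%:R, +oo[).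
      rewrite -[X in measurable X]setTI.
      have mX : measurable_fun setT (fun w => `|ln (W0 w)|).
        by apply: measurableT_comp => //; exact: measurableT_comp.
      exact: mX.
    by apply/seteqP; split=> w /=; rewrite in_itv/= andbT.
  have bI : bmeas (\1_[set w | n%:R < `|ln (W0 w)|] : T0 -> R).
    split; first exact: measurable_indic.
    by exists 1 => w; rewrite indicE ger0_norm//; case: (_ \in _).
  have -> : log_tail W0 n%:R = Ex P0 \1_[set w | n%:R < `|ln (W0 w)|].
    by rewrite /Ex expectation_indic.
  rewrite -ExZ//; apply: (@Ex_le _ _ _ _ _ _ 1) => w.
  - rewrite normrM ger0_norm ?subr_ge0 ?ltW// indicE.
    by case: (_ \in _); rewrite ?normr1 ?normr0 ?mulr1 ?mulr0//; have := expR_gt0 (-1 : R); lra.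
  - by have := W0_pow01 n0' w; rewrite ler_norml => /andP[]; lra.
  - have /andP[w0 w1] := W0_pow01 n0' w.
    rewrite indicE; case: (boolP (_ \in _)) => [|_]; last by rewrite mulr0 subr_ge0.
    rewrite inE /= mulr1 => hw; rewrite lerD2l lerN2 /powR gt_eqF; last first.
      by case/andP: (hW0 w).
    rewrite ler_expR; have : ln (W0 w) < 0 by apply: ln_lt0; exact: hW0.
    move=> h0; move: hw; rewrite ltr0_norm// => hw.
    by rewrite mulrC ler_pdivrMr// mulN1r lerNr ltW.
rewrite mulr1; apply: lt_le_trans; rewrite subr_gt0//.
Unshelve. all: by end_near. Qed.

(** The left-hand side is the [m]-th moment of the product of [W l `^ (1 / ln n)] over
    a block of [h * b (ln n)] boxes, the right-hand side the Laplace transform at [m]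
    of a stable increment over time [h]. The moment of one factor is a Laplace
    transform at [m / ln n], so the Abelian theorem applies along [ln n / m], and
    regular variation of [b] produces the factor [m `^ alpha]. *)
Lemma cvg_block_laplace (h : R) (m : nat) : 0 < h ->
  (Ex P0 (fun w => (W0 w `^ (ln n%:R)^-1) ^+ m)) ^+ Num.truncn (h * b (ln n%:R))
    @[n --> \oo] --> expR (- (h * (Gamma (1 - alpha) * m%:R `^ alpha))).
Proof.
move=> h0; have /andP[al0 al1] := halpha.
case: m => [|m].
  rewrite powR0 ?gt_eqF// !mulr0 oppr0 expR0.
  under eq_fun do rewrite [Ex _ _](_ : _ = 1) ?expr1n ?Ex_cst//.
  exact: cvg_cst.
pose x_ (n : nat) : R := ln n%:R.
have xoo : x_ n @[n --> \oo] --> +oo by exact: cvg_ln_natr.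
pose z_ n := m.+1%:R^-1 * x_ n.
have m0 : 0 < m.+1%:R^-1 :> R by rewrite invr_gt0.
have zoo : z_ n @[n --> \oo] --> +oo.
  exact: (cvg_comp x_ (fun x => m.+1%:R^-1 * x) xoo (cvg_scale_pinfty m0)).
have ha := abelian hW0 halpha hl htail zoo.
have hr : b (x_ n) / b (z_ n) @[n --> \oo] --> m.+1%:R `^ alpha.
  have -> : m.+1%:R `^ alpha = m.+1%:R^-1 `^ (- alpha) :> R.
    by rewrite -powR_inv1// -powRrM mulN1r opprK.
  exact: (cvg_comp x_ (fun x => b x / b (m.+1%:R^-1 * x)) xoo
    (@scaling_ratio _ alpha _ hl _ m0)).
have bxoo : b (x_ n) @[n --> \oo] --> +oo.
  exact: (cvg_comp x_ b xoo (cvg_scaling_pinfty hl htail (log_tail_cvg0 W0))).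
have bpos : \forall n \near \oo, 0 < b (z_ n).
  exact: (zoo _ (near_scaling_gt0 alpha hl)).
have xpos : \forall n \near \oo, 0 < x_ n.
  by apply: (xoo [set x | 0 < x]); exact: nbhs_pinfty_gt.
have hba : b (x_ n) * a_ (z_ n) @[n --> \oo] -->
    m.+1%:R `^ alpha * Gamma (1 - alpha).
  have : b (x_ n) / b (z_ n) * (b (z_ n) * a_ (z_ n)) @[n --> \oo] -->
     m.+1%:R `^ alpha * Gamma (1 - alpha) by apply: cvgM.
  apply: cvg_trans; apply: near_eq_cvg; near=> n.
  have bz : 0 < b (z_ n) by near: n.
  by field; rewrite gt_eqF.
have bpos' : \forall n \near \oo, 0 < b (x_ n).
  exact: (xoo _ (near_scaling_gt0 alpha hl)).
have hb0 : (b (x_ n))^-1 @[n --> \oo] --> (0 : R) by exact/gtr0_cvgV0.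
pose k_ n := Num.truncn (h * b (x_ n)).
have hk : (k_ n)%:R / b (x_ n) @[n --> \oo] --> h.
  have lo : h - (b (x_ n))^-1 @[n --> \oo] --> h.
    by rewrite -[X in _ --> X]subr0; apply: cvgB => //; exact: cvg_cst.
  have up : (h : R) @[n --> \oo] --> h by exact: cvg_cst.
  apply: squeeze_cvgr lo up; near=> n.
  have bx : 0 < b (x_ n) by near: n.
  rewrite ler_pdivlMr// ler_pdivrMr// mulrBl mulVf ?gt_eqF//.
  have := truncn_itv (ltW (mulr_gt0 h0 bx)); rewrite -/(k_ n) -natr1; lra.
have hka : (k_ n)%:R * a_ (z_ n) @[n --> \oo] -->
    h * (m.+1%:R `^ alpha * Gamma (1 - alpha)).
  have : (k_ n)%:R / b (x_ n) * (b (x_ n) * a_ (z_ n)) @[n --> \oo] -->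
     h * (m.+1%:R `^ alpha * Gamma (1 - alpha)) by apply: cvgM.
  apply: cvg_trans; apply: near_eq_cvg; near=> n.
  have bx : 0 < b (x_ n) by near: n.
  by field; rewrite gt_eqF.
have ha0 : a_ (z_ n) @[n --> \oo] --> (0 : R).
  have : (b (x_ n))^-1 * (b (x_ n) * a_ (z_ n)) @[n --> \oo] -->
     0 * (m.+1%:R `^ alpha * Gamma (1 - alpha)) by apply: cvgM.
  rewrite mul0r; apply: cvg_trans; apply: near_eq_cvg; near=> n.
  have bx : 0 < b (x_ n) by near: n.
  by field; rewrite gt_eqF.
(* For small [n] the argument [z_ n] may vanish; the sequence is modified there so as
   to have values in [0, 1] throughout. *)
pose a' n := if 0 < x_ n then a_ (z_ n) else 0.
have a'E : \forall n \near \oo, a_ (z_ n) = a' n.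
  by near=> n; rewrite /a' ifT//; near: n.
have a'01 n : 0 <= a' n <= 1.
  rewrite /a'; case: ifPn => xn; last by rewrite lexx ler01.
  by apply: a01; rewrite /z_ mulr_gt0.
have ha0' : a' n @[n --> \oo] --> (0 : R).
  by apply: cvg_trans ha0; exact: near_eq_cvg.
have hka' : (k_ n)%:R * a' n @[n --> \oo] -->
    h * (m.+1%:R `^ alpha * Gamma (1 - alpha)).
  apply: cvg_trans hka; apply: near_eq_cvg; near=> n.
  by congr (_ * _); near: n.
have := cvg_pow_expR a'01 ha0' hka'.
rewrite [m.+1%:R `^ alpha * _]mulrC.
apply: cvg_trans; apply: near_eq_cvg; near=> n.
have <- : a_ (z_ n) = a' n by near: n.
have xn : 0 < x_ n by near: n.
rewrite -/(x_ n) -/(k_ n); congr (_ ^+ _).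
have e : (fun w => 1 - W0 w `^ (z_ n)^-1) = (fun w => 1 + (-1) * (W0 w `^ (x_ n)^-1) ^+ m.+1).
  apply/funext => w; rewrite mulN1r; congr (1 - _).
  rewrite /z_ invfM invrK -powR_mulrn ?powR_ge0// -powRrM.
  by congr (_ `^ _); rewrite mulrC.
have bp : bmeas (fun w => (W0 w `^ (x_ n)^-1) ^+ m.+1).
  by apply: bmeas_exp; apply: bmeas_W0_pow; rewrite invr_ge0 ltW.
rewrite /a_ e ExD ?Ex_cst ?ExZ//; first lra.
- exact: bmeas_cst.
- by apply: bmeasM => //; exact: bmeas_cst.
Unshelve. all: by end_near. Qed.

End block_laplace.

(** * The stable subordinator *)

(** The almost sure properties of the subordinator on which the pathwise part of the
    argument relies. *)
Record strict_path (R : realType) (sigma : R -> R) : Prop := StrictPath {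
  sp0 : sigma 0 = 0 ;
  sp_lt : forall s t, 0 <= s -> s < t -> sigma s < sigma t ;
  sp_unbounded : forall u, exists2 s, 0 <= s & u < sigma s ;
  sp_right0 : sigma x @[x --> 0^'+] --> (0 : R) }.

Section subordinator_laplace.
Context (R : realType) d' (T' : measurableType d') (Q : probability T' R)
  (S : R -> {RV Q >-> R}) (alpha g : R).
Hypothesis a0 : 0 < alpha.
Hypothesis hS : subordinator S.
Hypothesis g0 : 0 < g.
Hypothesis hSexp : forall z, 0 <= z -> laplace_exponent S z = g * z `^ alpha.

Definition incr (N i : nat) (w : T') : R := S (i.+1%:R / N%:R) w - S (i%:R / N%:R) w.
(** Almost surely the increment is nonnegative; the truncation makes the exponential
    at most 1 at every point. *)
Definition incr_exp (N i : nat) (w : T') : R := expR (- Num.max 0 (incr N i w)).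

Lemma incr_exp01 N i w : 0 < incr_exp N i w <= 1.
Proof.
rewrite expR_gt0/= -[leRHS]expR0 ler_expR oppr_le0.
by rewrite le_max lexx.
Qed.

Let fexp (m : nat) (v : R) : R := expR (- Num.max 0 v) ^+ m.

Let fexp01 m v : 0 <= fexp m v <= 1.
Proof.
rewrite /fexp exprn_ge0 ?expR_ge0//= exprn_ile1 ?expR_ge0//.
by rewrite -[leRHS]expR0 ler_expR oppr_le0 le_max lexx.
Qed.

Let mfexp m : measurable_fun setT (fexp m).
Proof.
apply: measurable_funX; apply: measurableT_comp; first exact: measurable_expR.
by apply: measurableT_comp => //; apply: measurable_maxr.
Qed.

Lemma measurable_incr N i : measurable_fun setT (incr N i).
Proof. by apply: measurable_funB. Qed.

Lemma bmeas_incr_exp N i : bmeas (incr_exp N i).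
Proof.
split; last first.
  by exists 1 => w; have /andP[h0 h1] := incr_exp01 N i w; rewrite (ger0_norm (ltW h0)).
apply: measurableT_comp; first exact: measurable_expR.
apply: measurableT_comp => //; apply: measurable_maxr => //.
exact: measurable_incr.
Qed.

Let psi N m := Ex Q (fun w => fexp m (S N%:R^-1 w - S 0 w)).

Let Ex_incr_prod_psi N L (m : nat -> nat) : (0 < N)%N ->
  Ex Q (fun w => \prod_(i < L) incr_exp N i w ^+ m i) = \prod_(i < L) psi N (m i).
Proof.
move=> N0; have Nr : 0 < N%:R :> R by rewrite ltr0n.
pose t k : R := k%:R / N%:R.
have [_ hind hst _ _] := hS.
have ht : {homo t : m n / (m <= n)%N >-> m <= n}.
  by move=> p q pq; rewrite /t ler_pM2r ?invr_gt0// ler_nat.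
have := hind t _ ht; rewrite {1}/t mul0r lexx => /(_ isT) indX.
have mX i : measurable_fun setT (S (t i.+1) \- S (t i)) by exact: measurable_funB.
have := @Ex_prod_independent _ _ _ Q _ (fun k => S (t k.+1) \- S (t k)) mX indX
  id (fun i => fexp (m i)) (fun _ _ => id) (fun i => mfexp (m i)) L
  (fun i w => fexp01 (m i) _).
rewrite /partial_prod /= => ->.
apply: eq_bigr => i _; rewrite /psi /Ex; congr fine.
apply: (@Ex_same_law _ _ _ Q _ _ Q (S (t i.+1) \- S (t i)) (S N%:R^-1 \- S 0)
  (fexp (m i))).
- exact: mX.
- exact: measurable_funB.
- have e : t i.+1 = t i + N%:R^-1 by rewrite /t -natr1 mulrDl mul1r.
  by rewrite e; apply: hst; rewrite ?invr_ge0// /t divr_ge0.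
- exact: mfexp.
- by move=> x; case/andP: (fexp01 (m i) x).
Qed.

Lemma ae_grid (N : nat) : (0 < N)%N ->
  {ae Q, forall w, forall i, incr_exp N i w = expR (- incr N i w)}.
Proof.
move=> N0; have Nr : 0 < N%:R :> R by rewrite ltr0n.
have [_ _ _ _ mono] := hS; apply: filterS mono => w hw i.
rewrite /incr_exp max_r// subr_ge0; apply: hw; first by rewrite divr_ge0.
by rewrite ler_pM2r ?invr_gt0// ler_nat.
Qed.

Lemma grid_prod (N L : nat) w : (0 < N)%N -> S 0 w = 0 ->
  (forall i, incr_exp N i w = expR (- incr N i w)) ->
  \prod_(i < L) incr_exp N i w = expR (- S (L%:R / N%:R) w).
Proof.
move=> N0 S0 hw; elim: L => [|L IH]; first by rewrite big_ord0 mul0r S0 oppr0 expR0.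
rewrite big_ord_recr /= IH hw -expRD; congr expR; rewrite /incr; ring.
Qed.

(** The increments over the [N] cells of the unit interval are independent with the
    same law, so the Laplace transform of one of them is an [N]-th root. *)
Let psiE N m : (0 < N)%N -> psi N m = expR (- (N%:R^-1 * (g * m%:R `^ alpha))).
Proof.
move=> N0; have Nr : 0 < N%:R :> R by rewrite ltr0n.
have [S0 _ _ _ mono] := hS.
have psi0 : 0 <= psi N m.
  by rewrite fine_ge0// expectation_ge0// => w; case/andP: (fexp01 m (S N%:R^-1 w - S 0 w)).
have hE : ('E_Q[fun w => expR (- m%:R * S 1 w)] = (psi N m ^+ N)%:E)%E.
  have -> : psi N m ^+ N = \prod_(i < N) psi N m by rewrite prodr_const card_ord.
  rewrite -(@Ex_incr_prod_psi N N (fun=> m))//.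
  have bp : bmeas (fun w => \prod_(i < N) incr_exp N i w ^+ m).
    by apply: bmeas_prod => i; apply: bmeas_exp; exact: bmeas_incr_exp.
  rewrite -bmeas_fin//.
  have ae_eq : {ae Q, forall w, expR (- m%:R * S 1 w) = \prod_(i < N) incr_exp N i w ^+ m}.
    have := ae_grid N0; apply: filterS2 S0 => w S0w hw.
    rewrite prodrXl (grid_prod N N0 S0w hw) divff ?gt_eqF//.
    by rewrite -expRM_natl mulrN mulNr.
  by apply/le_anti/andP; split; apply: expectation_le_ae;
    apply: filterS ae_eq => w ->.
case: m => [|m] in psi0 hE *.
  rewrite powR0 ?gt_eqF// !mulr0 oppr0 expR0 /psi.
  by rewrite (_ : (fun w => _) = fun=> 1) ?Ex_cst//.
have m0 : 0 < m.+1%:R `^ alpha :> R by rewrite powR_gt0.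
have := hSexp (ler0n _ m.+1); rewrite /laplace_exponent hE /= => hln.
have pN : 0 < psi N m.+1 ^+ N.
  rewrite ltNge; apply/negP => /ln0 e; move: hln; rewrite e oppr0 => /esym/eqP.
  by rewrite mulf_eq0 !gt_eqF.
have pN' : psi N m.+1 ^+ N = expR (- (N%:R^-1 * (g * m.+1%:R `^ alpha))) ^+ N.
  rewrite -expRM_natl mulrN mulrA mulfV ?gt_eqF// mul1r -hln opprK.
  by rewrite lnK.
by apply/eqP; rewrite -(eqrXn2 N0) ?expR_ge0// pN'.
Qed.

Lemma Ex_incr_prod N L (m : nat -> nat) : (0 < N)%N ->
  Ex Q (fun w => \prod_(i < L) incr_exp N i w ^+ m i) =
  \prod_(i < L) expR (- (N%:R^-1 * (g * (m i)%:R `^ alpha))).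
Proof.
by move=> N0; rewrite Ex_incr_prod_psi//; apply: eq_bigr => i _; exact: psiE.
Qed.

Let expR_small (c e : R) : 0 < c -> 0 < e ->
  exists m : nat, expR (- (c * m%:R `^ alpha)) <= e.
Proof.
move=> c0 e0; pose K := `|ln e| / c + 1.
have K0 : 0 < K by rewrite ltr_wpDl// divr_ge0// ltW.
exists (Num.truncn (K `^ alpha^-1)).+1.
set m := _.+1.
have hm : K <= m%:R `^ alpha.
  have -> : K = (K `^ alpha^-1) `^ alpha.
    by rewrite -powRrM mulVf ?gt_eqF// powRr1// ltW.
  by rewrite ge0_ler_powR ?nnegrE ?powR_ge0 ?(ltW a0)// ltW// truncnS_gt.
rewrite -[leRHS]lnK// ler_expR lerNl.
have h1 : c * K <= c * m%:R `^ alpha by rewrite ler_wpM2l// ltW.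
apply: le_trans h1; rewrite /K mulrDr mulrCA mulfV ?gt_eqF// !mulr1.
by have := ler_norm (- ln e); rewrite normrN; lra.
Qed.

Lemma null_small (A : set T') : measurable A ->
  (forall e, 0 < e -> Ex Q \1_A <= e) -> Q A = 0%E.
Proof.
move=> mA hA; have h : (Ex Q \1_A)%:E = Q A.
  by rewrite /Ex expectation_indic// fineK// fin_num_measure.
rewrite -h; congr (_%:E); apply/le_anti/andP; split; last first.
  by rewrite /Ex expectation_indic// fine_ge0.
by apply/ler_addgt0Pr => e e0; rewrite add0r hA.
Qed.

Let indic_norm (A : set T') w : `|\1_A w : R| <= 1.
Proof. by rewrite indicE ger0_norm//; case: (_ \in _). Qed.

(** The indicator of [incr <= 0] is below every power of [incr_exp], and the means of
    these powers tend to 0. *)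
Lemma ae_incr_gt0 N i : (0 < N)%N -> {ae Q, forall w, 0 < incr N i w}.
Proof.
move=> N0; have Nr : 0 < N%:R :> R by rewrite ltr0n.
pose A := [set w | incr N i w <= 0].
have mA : measurable A.
  rewrite [X in measurable X](_ : A = incr N i @^-1` `]-oo, 0]).
    rewrite -[X in measurable X]setTI; exact: measurable_incr.
  by apply/seteqP; split=> w /=; rewrite in_itv.
exists A; split => //; last by move=> w /= /negP; rewrite -leNgt.
apply: null_small => // e e0.
have c0 : 0 < N%:R^-1 * g by rewrite mulr_gt0// invr_gt0.
have [m hm] := expR_small c0 e0.
apply: le_trans hm.
have := @Ex_incr_prod N i.+1 (fun j => if j == i then m else 0%N) N0.
rewrite !big_ord_recr /= eqxx big1 ?mul1r; last first.
  by move=> j _; rewrite ltn_eqF// powR0 ?gt_eqF// !mulr0 oppr0 expR0.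
rewrite mulrA => <-.
apply: (@Ex_le _ _ _ _ _ _ 1) => w; first exact: indic_norm.
  rewrite big_ord_recr/= eqxx big1; last by move=> j _; rewrite ltn_eqF.
  have /andP[h0 h1] := incr_exp01 N i w.
  by rewrite mul1r ger0_norm ?exprn_ge0 ?(ltW h0)// exprn_ile1 ?(ltW h0).
rewrite big_ord_recr/= eqxx big1; last by move=> j _; rewrite ltn_eqF.
rewrite mul1r indicE; case: (boolP (w \in A)) => [|_].
  by rewrite inE /A /= => wA; rewrite /incr_exp max_l// oppr0 expR0 expr1n.
by rewrite exprn_ge0// expR_ge0.
Qed.

(** The products have means [expR (- (g * M))], so by Markov's inequality they cannot
    all stay above a positive level. *)
Lemma ae_unbounded (u : R) :
  {ae Q, forall w, exists M : nat, \prod_(i < M) incr_exp 1 i w < expR (- u)}.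
Proof.
pose pr M w := \prod_(i < M) incr_exp 1 i w.
have bpr M : bmeas (pr M) by apply: bmeas_prod => i; exact: bmeas_incr_exp.
have pr01 M w : 0 <= pr M w <= 1.
  apply/andP; split.
    by apply: prodr_ge0 => i _; case/andP: (incr_exp01 1 i w) => /ltW.
  by apply: prodr_ile1 => i _; case/andP: (incr_exp01 1 i w) => /ltW -> ->.
pose AM M := [set w | expR (- u) <= pr M w].
have mAM M : measurable (AM M).
  rewrite [X in measurable X](_ : _ = pr M @^-1` `[expR (- u), +oo[).
    by rewrite -[X in measurable X]setTI; case: (bpr M) => + _; apply.
  by apply/seteqP; split=> w /=; rewrite in_itv/= andbT.
pose A := \bigcap_M AM M.
have mA : measurable A by exact: bigcapT_measurable.
exists A; split => //; last first.
  move=> w /= hw M _; rewrite /AM /= leNgt; apply/negP => h; apply: hw.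
  by exists M.
apply: null_small => // e e0.
have e1 : 0 < e * expR (- u) by rewrite mulr_gt0// expR_gt0.
have [M hM] : exists M : nat, expR (- (g * M%:R)) <= e * expR (- u).
  pose K := `|ln (e * expR (- u))| / g.
  exists (Num.truncn K).+1.
  rewrite -[leRHS]lnK// ler_expR lerNl.
  have : g * K <= g * (Num.truncn K).+1%:R.
    by rewrite ler_wpM2l ?(ltW g0)// ltW// truncnS_gt.
  apply: le_trans; rewrite /K mulrCA mulfV ?gt_eqF// mulr1.
  by have := ler_norm (- ln (e * expR (- u))); rewrite normrN.
have := @Ex_incr_prod 1 M (fun=> 1%N) (ltn0Sn 0).
rewrite invr1 powR1 prodr_const card_ord -expRM_natl mul1r mulr1 => hE.
have {}hE : Ex Q (pr M) = expR (- (g * M%:R)).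
  by rewrite /pr mulrC -mulrN -hE; congr Ex; apply/funext => w.
rewrite (@le_trans _ _ (Ex Q (fun w => expR u * pr M w)))//; last first.
  rewrite ExZ// hE (le_trans (ler_wpM2l (expR_ge0 u) hM))//.
  by rewrite mulrCA expRxMexpNx_1 mulr1.
apply: (@Ex_le _ _ _ _ _ _ (1 + expR u)) => w.
- by rewrite (le_trans (indic_norm A w))// lerDl expR_ge0.
- have /andP[h0 h1] := pr01 M w.
  rewrite ger0_norm ?mulr_ge0 ?expR_ge0// (@le_trans _ _ (expR u))//.
    by rewrite ler_piMr// expR_ge0.
  by rewrite lerDr ler01.
- have /andP[h0 h1] := pr01 M w.
  rewrite indicE; case: (boolP (w \in A)) => [|_]; last first.
    by rewrite mulr_ge0// expR_ge0.
  rewrite inE => /(_ M I) /= h.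
  by rewrite -[leLHS](expRxMexpNx_1 u) ler_wpM2l// expR_ge0.
Qed.

Lemma ae_strict_path : {ae Q, forall w, strict_path (fun s => S s w)}.
Proof.
have [S0 _ _ rc mono] := hS.
have h1 : {ae Q, forall w, forall N i : nat, (0 < N)%N -> 0 < incr N i w}.
  apply/ae_foralln => N; apply/ae_foralln => i.
  case: N => [|N]; first by apply: aeW.
  by have := @ae_incr_gt0 N.+1 i (ltn0Sn _); apply: filterS.
have h2 : {ae Q, forall w, forall u : nat,
    exists M : nat, \prod_(i < M) incr_exp 1 i w < expR (- u%:R)}.
  by apply/ae_foralln => u; exact: ae_unbounded.
have h3 := ae_grid (ltn0Sn 0).
apply: filterS2 (filterI S0 (filterI rc mono)) (filterI h1 (filterI h2 h3)) => w.
move=> [S0w [rcw monow]] [h1w [h2w h3w]]; split => //.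
(* Between [s] and [t] there is a cell of a fine enough grid, and the increments over
   the countably many cells are positive. *)
- move=> s t s0 st.
  pose N := (Num.truncn (2 / (t - s))).+1.
  have ts : 0 < t - s by rewrite subr_gt0.
  have Nr : 0 < N%:R :> R by rewrite ltr0n.
  have hN : 2 < N%:R * (t - s) by rewrite -ltr_pdivrMr// truncnS_gt.
  pose i := (Num.truncn (s * N%:R)).+1.
  have hi : s * N%:R < i%:R by rewrite truncnS_gt.
  have hi2 : i%:R <= s * N%:R + 1.
    have := truncn_itv (mulr_ge0 s0 (ltW Nr)); rewrite /i -natr1; lra.
  have a1 : S s w <= S (i%:R / N%:R) w.
    by apply: monow => //; rewrite ler_pdivlMr// ltW.
  have a2 : S (i.+1%:R / N%:R) w <= S t w.
    apply: monow; first by rewrite divr_ge0.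
    by rewrite ler_pdivrMr// -natr1; nra.
  have := h1w N i (ltn0Sn _); rewrite /incr; lra.
- move=> u; have [M hM] := h2w (Num.truncn `|u|).+1.
  exists M%:R => //; rewrite (@le_lt_trans _ _ (Num.truncn `|u|).+1%:R)//.
    by rewrite (le_trans (ler_norm u))// ltW// truncnS_gt.
  by move: hM; rewrite (grid_prod M (ltn0Sn 0) S0w h3w) divr1 ltr_expR ltrN2.
- by have [h _] := rcw 0 (lexx 0); rewrite S0w in h.
Qed.

End subordinator_laplace.

(** * Paths and their first passage times *)

Section passage.
Context (R : realType) (sigma : R -> R).
Hypothesis hs : strict_path sigma.

Definition passage (u : R) : R := inf [set s | 0 <= s /\ u < sigma s].
Local Notation tau := passage.

Let lbS u : has_lbound [set s | 0 <= s /\ u < sigma s].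
Proof. by exists 0 => s []. Qed.

Let neS u : [set s | 0 <= s /\ u < sigma s] !=set0.
Proof. by have [s s0 us] := sp_unbounded hs u; exists s. Qed.

Lemma passage_le u s : 0 <= s -> u < sigma s -> tau u <= s.
Proof. by move=> s0 us; apply: ge_inf. Qed.

Lemma passage_ge0 u : 0 <= tau u.
Proof. by apply: lb_le_inf => // s []. Qed.

Lemma sigma_mono s t : 0 <= s -> s <= t -> sigma s <= sigma t.
Proof.
move=> s0; rewrite le_eqVlt => /predU1P[->//|st].
by rewrite ltW// (sp_lt hs).
Qed.

Lemma lt_passage u s : tau u < s -> u < sigma s.
Proof.
move=> us; have [t [t0 ut] ts] := inf_lt (neS u) us.
by rewrite (lt_le_trans ut)// sigma_mono// ltW.
Qed.

Lemma passage_ge u s : sigma s <= u -> s <= tau u.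
Proof. by move=> su; rewrite leNgt; apply/negP => /lt_passage; rewrite ltNge su. Qed.

Lemma sigma_le u s : 0 <= s -> s < tau u -> sigma s <= u.
Proof.
move=> s0 su; rewrite leNgt; apply/negP => us.
by move: su; rewrite ltNge passage_le.
Qed.

Lemma passage_mono u v : u <= v -> tau u <= tau v.
Proof.
move=> uv; apply: lb_le_inf; first exact: neS.
by move=> s [s0 vs]; apply: passage_le => //; exact: le_lt_trans vs.
Qed.

Lemma passage0 : tau 0 = 0.
Proof.
apply/le_anti/andP; split; last exact: passage_ge0.
apply/ler_addgt0Pr => e e0; rewrite add0r.
by apply: passage_le; [exact: ltW|rewrite -(sp0 hs) (sp_lt hs)].
Qed.

Lemma passage1_gt0 : 0 < tau 1.
Proof.
have /cvgr_lt/(_ _ ltr01) h := sp_right0 hs.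
near (0 : R)^'+ => s.
have s0 : 0 < s by near: s; exact: nbhs_right_gt.
rewrite (lt_le_trans s0)// passage_ge// ltW//; near: s.
Unshelve. all: by end_near. Qed.

Lemma finite_gap (a : nat -> R) K : (forall i, 0 < a i) ->
  exists2 c, 0 < c & forall i, (i <= K)%N -> c <= a i.
Proof.
move=> a0; elim: K => [|K [c c0 hc]].
  by exists (a 0%N) => // i; rewrite leqn0 => /eqP ->.
exists (Num.min c (a K.+1)); first by rewrite lt_min c0 a0.
move=> i; rewrite leq_eqVlt => /predU1P[->|]; first by rewrite ge_min lexx orbT.
by rewrite ltnS => /hc h; rewrite ge_min h.
Qed.

(** Strict monotonicity is uniform on compact intervals: an interval of length
    [e] contains a cell of a finite grid. *)
Lemma uniform_gap (e M : R) : 0 < e -> 0 <= M ->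
  exists2 c, 0 < c & forall s, 0 <= s -> s <= M -> sigma s + c <= sigma (s + e).
Proof.
move=> e0 M0; pose N := (Num.truncn (2 / e)).+1.
have Nr : 0 < N%:R :> R by rewrite ltr0n.
have hN : 2 < N%:R * e by rewrite -ltr_pdivrMr// truncnS_gt.
have [|c c0 hc] := @finite_gap
  (fun i => sigma (i.+2%:R / N%:R) - sigma (i.+1%:R / N%:R)) (Num.truncn (M * N%:R)).
  move=> i; rewrite subr_gt0 (sp_lt hs)// ?divr_ge0//.
  by rewrite ltr_pM2r ?invr_gt0// ltr_nat.
exists c => // s s0 sM; pose i := Num.truncn (s * N%:R).
have si := truncn_itv (mulr_ge0 s0 (ltW Nr)).
have {}hc : c <= sigma (i.+2%:R / N%:R) - sigma (i.+1%:R / N%:R).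
  by apply: hc; apply: le_truncn; rewrite ler_wpM2r// ltW.
have /andP[si1 si2] : i%:R <= s * N%:R < i.+1%:R by [].
have h1 : sigma s <= sigma (i.+1%:R / N%:R).
  by apply: sigma_mono => //; rewrite ler_pdivlMr// ltW.
have h2 : sigma (i.+2%:R / N%:R) <= sigma (s + e).
  apply: sigma_mono; first by rewrite divr_ge0.
  have -> : i.+2%:R = i%:R + 2 :> R by rewrite -addn2 natrD.
  by rewrite ler_pdivrMr// mulrDl; lra.
lra.
Qed.

(** Quantitative form of strict monotonicity around the passage time: within time [e]
    the path clears the level by a margin that is uniform over levels in [0, 1]. *)
Lemma passage_gap (e : R) : 0 < e ->
  exists2 c, 0 < c & forall u, 0 <= u <= 1 ->
    u + c <= sigma (tau u + e) /\ (e <= tau u -> sigma (tau u - e) <= u - c).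
Proof.
move=> e0; have e20 : 0 < e / 2 by rewrite divr_gt0.
have M0 : 0 <= tau 1 + e by rewrite addr_ge0 ?passage_ge0 ?ltW.
have [c c0 hc] := uniform_gap e20 M0.
exists c => // u /andP[u0 u1]; have t1 := passage_mono u1.
have tu := passage_ge0 u.
split.
  have := hc (tau u + e / 2); rewrite -addrA -splitr => h.
  have h2 : u < sigma (tau u + e / 2) by apply: lt_passage; lra.
  have h3 : sigma (tau u + e / 2) + c <= sigma (tau u + e) by apply: h; lra.
  lra.
move=> eu; have := hc (tau u - e).
have -> : tau u - e + e / 2 = tau u - e / 2 by field.
move=> h; have h2 : sigma (tau u - e / 2) <= u by apply: sigma_le; lra.
have h3 : sigma (tau u - e) + c <= sigma (tau u - e / 2) by apply: h; lra.
lra.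
Qed.

Lemma passage_uniform (e : R) : 0 < e -> exists2 c, 0 < c &
  forall u v, 0 <= u <= 1 -> 0 <= v <= 1 -> `|u - v| < c -> `|tau u - tau v| <= e.
Proof.
move=> e0; have [c c0 hc] := passage_gap e0; exists c => //.
have le_case u v : 0 <= u <= 1 -> 0 <= v <= 1 -> u <= v -> v < u + c ->
    `|tau u - tau v| <= e.
  move=> u01 v01 uv vu; have [h _] := hc u u01.
  rewrite distrC ger0_norm ?subr_ge0 ?passage_mono//.
  rewrite lerBlDl; apply: passage_le; last exact: lt_le_trans h.
  by rewrite addr_ge0 ?passage_ge0// ltW.
move=> u v u01 v01 uv; have [uv'|/ltW vu'] := leP u v.
  by apply: le_case => //; move: uv; rewrite distrC ger0_norm ?subr_ge0//; lra.
by rewrite distrC; apply: le_case => //; move: uv; rewrite ger0_norm ?subr_ge0//; lra.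
Qed.

Definition passage_left (t : R) : R :=
  if t <= 0 then 0 else lim (passage x @[x --> t^'-]).

Lemma passage_leftE u : 0 <= u <= 1 -> passage_left u = tau u.
Proof.
move=> /andP[u0 u1]; rewrite /passage_left; case: ifPn => [u0'|].
  by rewrite (@le_anti _ _ u 0) ?u0 ?u0'// passage0.
rewrite -ltNge => u_gt0; apply/cvg_lim => //.
apply/cvgrPdist_le => e e0; have [c c0 hc] := passage_uniform e0.
near=> x.
have xu : x < u by near: x; exact: nbhs_left_lt.
have x0 : 0 < x by near: x; exact: nbhs_left_gt.
have xc : u - c < x by near: x; apply: nbhs_left_gt; rewrite ltrBlDr ltrDl.
apply: hc; first by rewrite u0 u1.
  by rewrite (ltW x0) (le_trans (ltW xu)).
by rewrite ger0_norm ?subr_ge0 ?(ltW xu)//; lra.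
Unshelve. all: by end_near. Qed.

End passage.

(** The values outside [0, 1] are not controlled, but the one-sided limits that enter
    are taken from inside. *)
Lemma uniform_cadlag (R : realType) (y : R -> R) :
  (forall e, 0 < e -> exists2 c, 0 < c & forall s t, 0 <= s <= 1 -> 0 <= t <= 1 ->
     `|s - t| < c -> `|y s - y t| <= e) -> cadlag01 y.
Proof.
move=> hy; split.
  move=> t /andP[t0 t1]; apply/cvgrPdist_le => e e0; have [c c0 hc] := hy e e0.
  near=> x.
  have xt : t < x by near: x; exact: nbhs_right_gt.
  have x1 : x < 1 by near: x; exact: nbhs_right_lt.
  have xc : x < t + c by near: x; apply: nbhs_right_lt; rewrite ltrDl.
  apply: hc; first by rewrite t0 ltW.
    by rewrite (le_trans t0 (ltW xt)) ltW.
  by rewrite distrC ger0_norm ?subr_ge0 ?(ltW xt)//; lra.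
move=> t /andP[t0 t1]; apply/cvg_ex; exists (y t).
apply/cvgrPdist_le => e e0; have [c c0 hc] := hy e e0.
near=> x.
have xt : x < t by near: x; exact: nbhs_left_lt.
have x0 : 0 < x by near: x; exact: nbhs_left_gt.
have xc : t - c < x by near: x; apply: nbhs_left_gt; rewrite ltrBlDr ltrDl.
apply: hc; first by rewrite (ltW t0) t1.
  by rewrite (ltW x0) (le_trans (ltW xt)).
by rewrite ger0_norm ?subr_ge0 ?(ltW xt)//; lra.
Unshelve. all: by end_near. Qed.

(** * Paths compatible with a discretised inverse *)

Definition path01 (R : realType) (y : R -> R) :=
  [/\ cadlag01 y, forall s t, 0 <= s -> s <= t -> t <= 1 -> y s <= y t & 0 <= y 0].

(** [q i] stands for [expR (- sigma (i / N))], and [y 1 - y (1 - u)] for the passage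
    time of [sigma] above [u]. If [sigma (i / N)] is clearly below [u] then the passage
    time is at least [i / N], and if it is clearly above [u] then at most [i / N]. In
    the second case with [u = 1] the bound is also required for [y 1], since [y 0] need
    not vanish. There are [N * N] values because the passage times are not bounded:
    the horizon [N] grows as the mesh [N^-1] shrinks. *)
Definition consistent (R : realType) (N : nat) (q : nat -> R) (y : R -> R) (dl : R) :=
  forall i, (i <= N * N)%N ->
  [/\ forall u, 0 <= u <= 1 -> expR (- u) + dl <= q i ->
        i%:R / N%:R - dl <= y 1 - y (1 - u),
      forall u, 0 <= u <= 1 -> q i <= expR (- u) - dl ->
        y 1 - y (1 - u) <= i%:R / N%:R + dl &
      q i <= expR (- 1) - dl -> y 1 <= i%:R / N%:R + dl].

Section consistent_close.
Context (R : realType) (sigma : R -> R).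
Hypothesis hs : strict_path sigma.
Local Notation tau := (passage sigma).

(** Near the passage time above [u] there are grid points where [sigma] is below [u]
    and above [u] by a definite margin ([passage_gap]); their exponentials then differ
    from [expR (- u)] by more than the tolerance, and consistency locates
    [y 1 - y (1 - u)] between these grid points. *)
Lemma consistent_close (e : R) : 0 < e -> exists2 dl0, 0 < dl0 &
  exists N0 : nat, forall N, (N0 <= N)%N -> forall dl y, 0 <= dl <= dl0 ->
    path01 y -> consistent N (fun i => expR (- sigma (i%:R / N%:R))) y dl ->
    forall t, 0 <= t <= 1 -> `|y t - (tau 1 - tau (1 - t))| <= e.
Proof.
move=> e0; pose e1 := e / 6.
have e10 : 0 < e1 by rewrite divr_gt0.
have [c c0 hc] := passage_gap hs e10.
have cm : expR (- c) < 1 by rewrite -[ltRHS]expR0 ltr_expR oppr_lt0.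
pose dl1 := expR (- 1) * (1 - expR (- c)).
have dl10 : 0 < dl1 by rewrite mulr_gt0 ?expR_gt0// subr_gt0.
exists (Num.min e1 dl1); first by rewrite lt_min e10.
pose N0 := (maxn (Num.truncn e1^-1).+1 (Num.truncn (tau 1 + 2 * e1)).+1).
exists N0 => N; rewrite geq_max => /andP[hN1 hN2] dl y /andP[dl_ge0].
rewrite le_min => /andP[dle dlc] [_ ymono y0] hcons t t01.
have Nr : 0 < N%:R :> R by rewrite ltr0n (leq_trans _ hN1).
have hN1' : e1^-1 <= N%:R.
  by rewrite (le_trans (ltW (truncnS_gt _)))// ler_nat.
have hN2' : tau 1 + 2 * e1 <= N%:R.
  by rewrite (le_trans (ltW (truncnS_gt _)))// ler_nat.
have Ne : 1 <= N%:R * e1 by rewrite -ler_pdivrMr// div1r.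
have expu (u : R) : 0 <= u <= 1 -> expR (- 1) <= expR (- u).
  by move=> /andP[u0 u1]; rewrite ler_expR lerN2.
(* A grid point just after the passage time. *)
have up u : 0 <= u <= 1 -> exists2 i, (i <= N * N)%N &
    i%:R / N%:R <= tau u + 2 * e1 /\
    expR (- sigma (i%:R / N%:R)) <= expR (- u) - dl.
  move=> u01; have /andP[u0 u1] := u01; have tu := passage_ge0 hs u.
  have t1 := passage_mono hs u1.
  have x0 : 0 <= (tau u + 2 * e1) * N%:R by rewrite mulr_ge0 ?(ltW Nr)//; lra.
  have /andP[i1 i2] := truncn_itv x0.
  exists (Num.truncn ((tau u + 2 * e1) * N%:R)).
    rewrite -(ler_nat R) natrM (le_trans i1)// ler_wpM2r ?(ltW Nr)//.
    by rewrite (le_trans _ hN2')// lerD2r.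
  split; first by rewrite ler_pdivrMr.
  set i := Num.truncn _ in i1 i2 *.
  have hi : tau u + e1 <= i%:R / N%:R.
    by rewrite ler_pdivlMr//; move: i2; rewrite -natr1 !mulrDl; lra.
  have [h1 _] := hc u u01.
  have h2 : u + c <= sigma (i%:R / N%:R).
    by apply: le_trans h1 _; apply: (sigma_mono hs) => //; lra.
  rewrite (@le_trans _ _ (expR (- (u + c))))//; first by rewrite ler_expR lerN2.
  rewrite opprD expRD lerBrDr -lerBrDl.
  have -> : expR (- u) - expR (- u) * expR (- c) = expR (- u) * (1 - expR (- c)).
    by ring.
  by rewrite (le_trans dlc)// ler_wpM2r ?expu// subr_ge0 ltW.
(* A grid point just before the passage time, unless the latter is close to 0. *)
have lo u : 0 <= u <= 1 -> 2 * e1 <= tau u -> exists2 i, (i <= N * N)%N &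
    tau u - 2 * e1 <= i%:R / N%:R /\
    expR (- u) + dl <= expR (- sigma (i%:R / N%:R)).
  move=> u01 te; have /andP[u0 u1] := u01.
  have t1 := passage_mono hs u1.
  have x0 : 0 <= (tau u - e1) * N%:R by rewrite mulr_ge0 ?(ltW Nr)//; lra.
  have /andP[i1 i2] := truncn_itv x0.
  exists (Num.truncn ((tau u - e1) * N%:R)).
    rewrite -(ler_nat R) natrM (le_trans i1)// ler_wpM2r ?(ltW Nr)//.
    by rewrite (le_trans _ hN2')//; lra.
  set i := Num.truncn _ in i1 i2 *.
  split.
    by rewrite ler_pdivlMr//; move: i2; rewrite -natr1 !mulrDl !mulNr; lra.
  have hi : i%:R / N%:R <= tau u - e1 by rewrite ler_pdivrMr.
  have [_ h1] := hc u u01.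
  have h2 : sigma (i%:R / N%:R) <= u - c.
    apply: le_trans (h1 _); last lra.
    by apply: (sigma_mono hs) => //; rewrite divr_ge0.
  rewrite (@le_trans _ _ (expR (- (u - c))))//; last by rewrite ler_expR lerN2.
  rewrite opprB addrC expRD.
  have h3 : expR (- u) * (1 - expR (- c)) <= expR (- u) * (expR c - 1).
    rewrite ler_wpM2l ?expR_ge0//.
    have h4 := expRxMexpNx_1 c; have h5 := expR_gt0 c.
    have h6 : 1 <= expR c by rewrite -[leLHS]expR0 ler_expR ltW.
    nra.
  have h4 : dl1 <= expR (- u) * (1 - expR (- c)).
    by rewrite ler_wpM2r ?expu// subr_ge0 ltW.
  by move: h3 h4 dlc; rewrite mulrBr mulr1; lra.
have bd u : 0 <= u <= 1 -> `|y 1 - y (1 - u) - tau u| <= 3 * e1.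
  move=> u01; have /andP[u0 u1] := u01.
  rewrite ler_distl; apply/andP; split.
    have [te|te] := leP (2 * e1) (tau u).
      have [i iN [i1 i2]] := lo u u01 te.
      by have [/(_ u u01 i2) h _ _] := hcons i iN; lra.
    have : y (1 - u) <= y 1 by apply: ymono => //; lra.
    lra.
  have [i iN [i1 i2]] := up u u01.
  by have [_ /(_ u u01 i2) h _] := hcons i iN; lra.
have o01 : 0 <= (1 : R) <= 1 by rewrite ler01 lexx.
have bd1 : `|y 1 - tau 1| <= 3 * e1.
  rewrite ler_distl; apply/andP; split.
    have := bd 1 o01; rewrite subrr ler_distl => /andP[h _]; lra.
  have [i iN [i1 i2]] := up 1 o01.
  by have [_ _ /(_ i2) h] := hcons i iN; lra.
have t01' : 0 <= 1 - t <= 1 by case/andP: t01 => ? ?; apply/andP; split; lra.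
have := bd (1 - t) t01'; rewrite subKr => h2.
have -> : y t - (tau 1 - tau (1 - t)) =
    (y 1 - tau 1) - (y 1 - y t - tau (1 - t)) by ring.
rewrite (le_trans (ler_normB _ _))//.
have -> : e = 3 * e1 + 3 * e1 by rewrite /e1; field.
exact: lerD.
Qed.

End consistent_close.

(** * The limit path *)

Section reversed.
Context (R : realType) (sigma : R -> R).
Hypothesis hs : strict_path sigma.
Local Notation tau := (passage sigma).

Definition reversed (t : R) : R := tau 1 - tau (1 - t).

Lemma reversed_path01 : path01 reversed.
Proof.
split.
- apply: uniform_cadlag => e e0; have [c c0 hc] := passage_uniform hs e0.
  exists c => // s t /andP[s0 s1] /andP[t0 t1] st.
  have -> : reversed s - reversed t = tau (1 - t) - tau (1 - s).
    by rewrite /reversed; ring.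
  apply: hc; [by apply/andP; split; lra|by apply/andP; split; lra|].
  by rewrite (_ : _ - _ = s - t)//; ring.
- by move=> s t s0 st t1; rewrite /reversed lerB// (passage_mono hs)//; lra.
- by rewrite /reversed subr0 subrr.
Qed.

Let passage_le_weak u s : 0 <= s -> u <= sigma s -> tau u <= s.
Proof.
move=> s0 us; apply/ler_addgt0Pr => e e0; apply: passage_le.
  by rewrite addr_ge0// ltW.
by rewrite (le_lt_trans us)// (sp_lt hs)// ltrDl.
Qed.

(** The exact discretisation is consistent with no tolerance at all, so the penalized
    infimum never exceeds the functional at the limit path. *)
Lemma reversed_consistent N :
  consistent N (fun i => expR (- sigma (i%:R / N%:R))) reversed 0.
Proof.
move=> i _; have i0 : 0 <= i%:R / N%:R :> R by rewrite divr_ge0.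
have E u : reversed 1 - reversed (1 - u) = tau u.
  by rewrite /reversed subrr (passage0 hs) (_ : 1 - (1 - u) = u); ring.
split=> [u _|u _|].
- rewrite addr0 ler_expR lerN2 subr0 E; exact: passage_ge.
- rewrite subr0 ler_expR lerN2 addr0 E; exact: passage_le_weak.
- rewrite subr0 ler_expR lerN2 addr0 /reversed subrr (passage0 hs) subr0.
  exact: passage_le_weak.
Qed.

End reversed.

(** * Counting boxes *)

Lemma cadlag01D (R : realType) (f g : R -> R) :
  cadlag01 f -> cadlag01 g -> cadlag01 (fun t => f t + g t).
Proof.
move=> [f1 f2] [g1 g2]; split=> t ht; first by apply: cvgD; [exact: f1|exact: g1].
by apply: is_cvgD; [exact: f2|exact: g2].
Qed.

Lemma cadlag01Z (R : realType) (c : R) (f : R -> R) :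
  cadlag01 f -> cadlag01 (fun t => c * f t).
Proof.
move=> [f1 f2]; split=> t ht.
  by apply: cvgM; [exact: cvg_cst|exact: f1].
by apply: is_cvgM; [exact: is_cvg_cst|exact: f2].
Qed.

Lemma cadlag01_sum (R : realType) n (f : nat -> R -> R) :
  (forall i, cadlag01 (f i)) -> cadlag01 (fun t => \sum_(i < n) f i t).
Proof.
move=> hf; elim: n => [|n IH].
  rewrite (_ : (fun t => _) = fun=> 0); first exact: cadlag01_cst.
  by apply/funext => t; rewrite big_ord0.
rewrite (_ : (fun t => _) = fun t => \sum_(i < n) f i t + f n t).
  exact: cadlag01D.
by apply/funext => t; rewrite big_ord_recr.
Qed.

Lemma cadlag01_step (R : realType) (c : R) : cadlag01 (fun t => (c <= t)%R%:R : R).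
Proof.
split=> t _.
  have [ct|tc] := leP c t.
    apply: cvg_near_cst; near=> x.
    have tx : t < x by near: x; exact: nbhs_right_gt.
    by rewrite (le_trans ct (ltW tx)).
  apply: cvg_near_cst; near=> x.
  have xc : x < c by near: x; exact: nbhs_right_lt.
  by rewrite leNgt xc.
have [ct|tc] := ltP c t.
  apply/cvg_ex; exists 1; apply: cvg_near_cst; near=> x.
  have tx : c < x by near: x; exact: nbhs_left_gt.
  by rewrite (ltW tx).
apply/cvg_ex; exists 0; apply: cvg_near_cst; near=> x.
have tx : x < t by near: x; exact: nbhs_left_lt.
by rewrite leNgt (lt_le_trans tx).
Unshelve. all: by end_near. Qed.

Section sieve_count.
Context (R : realType) d (T : measurableType d) (P : probability T R)
  (W U : nat -> {RV P >-> R})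
  d0 (T0 : measurableType d0) (P0 : probability T0 R) (W0 : {RV P0 >-> R}).
Hypothesis hsieve : bernoulli_sieve W U W0.
Local Notation V := (sieve_V W).
Local Notation Z := (sieve_Z W U).
Local Notation K := (sieve_K W U).

Lemma sieve_Z_le n l w : (Z n l w <= n)%N.
Proof. by rewrite -[leqRHS]card_ord max_card. Qed.

(** The boxes are disjoint and ordered downwards, so no box after the one that
    receives a given ball can receive it. *)
Lemma sieve_Z_eventually0 n w : exists M, forall l, (M <= l)%N -> Z n l w = 0%N.
Proof.
have hj (j : nat) : exists M, forall l, (M <= l)%N -> ball_in W U l j w = 0.
  have [[l0 hl0]|h] := pselect (exists l0, V l0.+1 w < U j w <= V l0 w).
    exists l0.+1 => l l0l; rewrite /ball_in.
    case: (boolP (_ < _ <= _)) => //= /andP[_ h2].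
    case/andP: hl0 => h3 _.
    by have := lt_le_trans h3 (le_trans h2 (sieve_V_le hsieve w l0l)); rewrite ltxx.
  exists 0%N => l _; rewrite /ball_in; case: (boolP (_ < _ <= _)) => //= h2.
  by exfalso; apply: h; exists l.
have [M hM] := choice hj.
exists (\sum_(j < n) M j)%N => l hl.
apply/eqP; rewrite -(eqr_nat R) sieve_ZE big1// => j _.
by apply: hM; rewrite (leq_trans _ hl)// (bigD1 j)//= leq_addr.
Qed.

Definition in_range (n : nat) (t : R) l w : bool :=
  (1 <= Z n l w)%N && ((Z n l w)%:R <= n%:R `^ t).

(** The series is a finite sum, of any sufficiently large length; lengths of the form
    [r + M] allow comparison with a sum over the first [r] boxes. *)
Lemma sieve_KE_add n w : exists M, forall r t,
  K n t w = \sum_(l < r + M) (in_range n t l w)%:R.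
Proof.
have [M hM] := sieve_Z_eventually0 n w; exists M => r t.
rewrite /sieve_K (@nneseries_split _ _ 0%N (r + M)%N)//.
rewrite eseries0 ?adde0; last first.
  by move=> i Mi _; rewrite hM// (leq_trans _ Mi)// add0n leq_addl.
by rewrite add0n big_mkord sumEFin.
Qed.

Lemma sieve_KE n w : exists M, forall t, K n t w = \sum_(l < M) (in_range n t l w)%:R.
Proof. by have [M hM] := sieve_KE_add n w; exists M => t; rewrite (hM 0%N). Qed.

Lemma in_range_mono n s t l w : (0 < n)%N -> s <= t ->
  in_range n s l w -> in_range n t l w.
Proof.
move=> n0 st /andP[h1 h2]; rewrite /in_range h1 (le_trans h2)//.
by rewrite ler_powR// ler1n.
Qed.

Lemma in_range0 t l w : in_range 0 t l w = false.
Proof. by rewrite /in_range; have := sieve_Z_le 0 l w; rewrite leqn0 => /eqP ->. Qed.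

(** The indicator jumps from 0 to 1 at [ln Z / ln n], which requires [ln n] to be
    positive; for [n <= 1] it is constant in time. *)
Lemma cadlag01_in_range n l w : cadlag01 (fun t => (in_range n t l w)%:R : R).
Proof.
case: n => [|[|n]].
- rewrite (_ : (fun t => _) = fun=> 0); first exact: cadlag01_cst.
  by apply/funext => t; rewrite in_range0.
- rewrite (_ : (fun t => _) = fun=> (in_range 1 0 l w)%:R); first exact: cadlag01_cst.
  by apply/funext => t; rewrite /in_range !powR1.
have [h1|h1] := boolP (1 <= Z n.+2 l w)%N; last first.
  rewrite (_ : (fun t => _) = fun=> 0); first exact: cadlag01_cst.
  by apply/funext => t; rewrite /in_range (negbTE h1).
have ln0 : 0 < ln n.+2%:R :> R by rewrite ln_gt0// ltr1n.
rewrite (_ : (fun t => _) = fun t => (ln (Z n.+2 l w)%:R / ln n.+2%:R <= t)%R%:R).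
  exact: cadlag01_step.
apply/funext => t; rewrite /in_range h1 /= /powR gt_eqF//.
by rewrite ler_pdivrMr// -[in RHS]ler_expR lnK// posrE ltr0n.
Qed.

Lemma sieve_K_cadlag n w : cadlag01 (fun t => K n t w).
Proof.
have [M hM] := sieve_KE n w.
rewrite (_ : (fun t => _) = fun t => \sum_(l < M) (in_range n t l w)%:R).
  apply: (@cadlag01_sum _ M (fun l t => (in_range n t l w)%:R)) => l.
  exact: cadlag01_in_range.
by apply/funext => t; rewrite hM.
Qed.

Lemma sieve_K_mono n s t w : s <= t -> K n s w <= K n t w.
Proof.
move=> st; have [M hM] := sieve_KE n w; rewrite !hM.
apply: ler_sum => l _; rewrite ler_nat.
case: n hM => [|n] _; first by rewrite !in_range0.
by case: (boolP (in_range n.+1 s l w)) => // h; rewrite (in_range_mono _ st h).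
Qed.

Lemma sieve_K_ge0 n t w : 0 <= K n t w.
Proof. by have [M hM] := sieve_KE n w; rewrite hM sumr_ge0. Qed.

Lemma sieve_path01 n w (b : R) : 0 <= b -> path01 (fun t => b * K n t w).
Proof.
move=> b0; split.
- by apply: cadlag01Z; exact: sieve_K_cadlag.
- by move=> s t _ st _; rewrite ler_wpM2l// sieve_K_mono.
- by rewrite mulr_ge0// sieve_K_ge0.
Qed.

Lemma sum_ord_bound (M k : nat) (a : nat -> R) : (forall l, 0 <= a l <= 1) ->
  (forall l, (k <= l)%N -> a l = 0) -> \sum_(l < M) a l <= k%:R.
Proof.
move=> a01 ak; elim: M => [|M IH]; first by rewrite big_ord0.
rewrite big_ord_recr /=; have [kM|Mk] := leqP k M.
  by rewrite ak// addr0.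
have : \sum_(l < M) a l <= M%:R.
  rewrite (le_trans (ler_sum _ (G := fun=> 1) _))//.
    by move=> l _; case/andP: (a01 l).
  by rewrite sumr_const card_ord.
have /andP[_ aM] := a01 M.
have : M.+1%:R <= k%:R :> R by rewrite ler_nat.
rewrite -natr1; lra.
Qed.

Lemma count_upper n k u w : (0 < n)%N -> 0 <= u <= 1 ->
  (forall l, (k <= l)%N -> (Z n l w)%:R <= n%:R `^ (1 - u)) ->
  K n 1 w - K n (1 - u) w <= k%:R.
Proof.
move=> n0 /andP[u0 u1] hZ; have [M hM] := sieve_KE n w; rewrite !hM -sumrB.
have hm l : in_range n (1 - u) l w -> in_range n 1 l w.
  by apply: in_range_mono => //; lra.
apply: (@sum_ord_bound _ _ (fun l => (in_range n 1 l w)%:R - (in_range n (1 - u) l w)%:R)).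
  move=> l; case: (boolP (in_range n (1 - u) l w)) => [/hm ->|_].
    by rewrite subrr lexx ler01.
  by rewrite subr0; case: (in_range n 1 l w); rewrite ?lexx ?ler01.
move=> l /hZ h; rewrite /in_range h powRr1// ler_nat sieve_Z_le !andbT subrr//.
Qed.

Lemma count_all n k w : (0 < n)%N -> (forall l, (k <= l)%N -> Z n l w = 0%N) ->
  K n 1 w <= k%:R.
Proof.
move=> n0 hZ; have [M hM] := sieve_KE n w; rewrite hM.
apply: (@sum_ord_bound _ _ (fun l => (in_range n 1 l w)%:R)).
  by move=> l; case: (in_range n 1 l w); rewrite ?lexx ?ler01.
by move=> l /hZ h; rewrite /in_range h.
Qed.

(** Box [l] counts as soon as it is filled; the weight [phi l] pays for the boxes
    among the first [k] that are not. *)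
Lemma count_lower n k u w (phi : nat -> R) : (0 < n)%N -> 0 <= u <= 1 ->
  (forall l, 0 <= phi l) ->
  (forall l, (l < k)%N -> (Z n l w)%:R <= n%:R `^ (1 - u) -> 1 <= phi l) ->
  k%:R - \sum_(l < k) phi l <= K n 1 w - K n (1 - u) w.
Proof.
move=> n0 /andP[u0 u1] phi0 hphi; have [M hM] := sieve_KE_add n w.
have hm l : in_range n (1 - u) l w -> in_range n 1 l w.
  by apply: in_range_mono => //; lra.
pose a l : R := (in_range n 1 l w)%:R - (in_range n (1 - u) l w)%:R.
have a0 l : 0 <= a l.
  rewrite /a; case: (boolP (in_range n (1 - u) l w)) => [/hm ->|_].
    by rewrite subrr.
  by rewrite subr0.
have aphi l : (l < k)%N -> 1 <= a l + phi l.
  move=> lk; have [h|h] := leP (Z n l w)%:R (n%:R `^ (1 - u)).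
    by have := hphi l lk h; have := a0 l; lra.
  have Z1 : (1 <= Z n l w)%N.
    have : 0 < (Z n l w)%:R :> R by rewrite (le_lt_trans _ h)// powR_ge0.
    by rewrite ltr0n.
  have -> : a l = 1.
    rewrite /a /in_range Z1 powRr1// ler_nat sieve_Z_le /= leNgt h.
    by rewrite subr0.
  by rewrite lerDl.
have hk : \sum_(l < k) a l <= K n 1 w - K n (1 - u) w.
  rewrite !(hM k) -sumrB big_split_ord /= lerDl sumr_ge0// => l _; exact: a0.
have : k%:R <= \sum_(l < k) (a l + phi l).
  have -> : k%:R = \sum_(l < k) 1 :> R by rewrite sumr_const card_ord.
  by apply: ler_sum => l _; exact: aphi.
rewrite big_split /=; lra.
Qed.
End sieve_count.

(** * Consistency of the sieve with high probability *)

Section sieve_consistent.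
Context (R : realType) d (T : measurableType d) (P : probability T R)
  (W U : nat -> {RV P >-> R})
  d0 (T0 : measurableType d0) (P0 : probability T0 R) (W0 : {RV P0 >-> R}).
Hypothesis hsieve : bernoulli_sieve W U W0.
Local Notation V := (sieve_V W).
Local Notation Z := (sieve_Z W U).
Local Notation K := (sieve_K W U).

Variables (n N k : nat) (dl ep b : R).
Hypothesis n1 : (1 < n)%N.
Hypothesis N0 : (0 < N)%N.
Hypothesis dl0 : 0 < dl.
Hypothesis ep0 : 0 < ep.
Hypothesis b0 : 0 < b.

Let x : R := ln n%:R.
Let dd : R := ln (1 + dl).
Let n0 : 0 < n%:R :> R. Proof. by rewrite ltr0n (ltn_trans _ n1). Qed.
Let nx : n%:R = expR x. Proof. by rewrite lnK. Qed.
Let x0 : 0 < x. Proof. by rewrite ln_gt0// ltr1n. Qed.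
Let ddE : expR dd = 1 + dl. Proof. by rewrite lnK// posrE addr_gt0. Qed.
Let dd0 : 0 < dd. Proof. by rewrite ln_gt0// ltrDl. Qed.
Let n_pow (t : R) : n%:R `^ t = expR (t * x).
Proof. by rewrite /powR gt_eqF. Qed.

(** The second term is Chebyshev's majorant for the event that box [l] has less than
    half of its conditional mean, when this mean is at least [ep * n `^ ln (1 + dl)]. *)
Definition fail_weight (l : nat) (w : T) : R :=
  (1 - W l w < ep)%R%:R + 4 / (ep * expR (ln (1 + dl) * ln n%:R) * n%:R) * box_deviation W U n l w.

(** A Markov-type majorant of the indicator of the bad event: too many balls beyond
    one of the block ends, or too many exceptional boxes. *)
Definition bad_weight (w : T) : R :=
  \sum_(i < (N * N).+1) expR (- (ln (1 + dl) / 2 * ln n%:R)) / n%:R *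
     ((V (i * k)%N w)^-1 * tail_balls W U n (i * k)%N w) +
  2 / (dl * b) * \sum_(l < N * N * k) fail_weight l w.

Hypothesis hx : 2 <= ep * expR (dd * x).
Hypothesis kb : k%:R * N%:R <= b.
Hypothesis bk : b < (k%:R + 1) * N%:R.
Hypothesis bL : (N * N)%:R <= b * (dl / 2).

Let box_deviation_ge0 l w : 0 <= box_deviation W U n l w.
Proof. by rewrite mulr_ge0 ?sqr_ge0// invr_ge0 ltW// (box_prob_gt0 hsieve). Qed.

Lemma fail_weight_ge0 l w : 0 <= fail_weight l w.
Proof.
rewrite addr_ge0// mulr_ge0// divr_ge0// ?mulr_ge0 ?expR_ge0 ?ltW//.
Qed.

Let tail_term_ge0 i w : 0 <= expR (- (dd / 2 * x)) / n%:R *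
     ((V i w)^-1 * tail_balls W U n i w).
Proof.
rewrite mulr_ge0// ?divr_ge0 ?expR_ge0// mulr_ge0 ?sumr_ge0//.
by rewrite invr_ge0 ltW//; case/andP: (sieve_V01 hsieve i w).
Qed.

Lemma sieve_Z_le_tail i l w : (i <= l)%N -> (Z n l w)%:R <= tail_balls W U n i w.
Proof.
move=> il; rewrite sieve_ZE; apply: ler_sum => j _; rewrite ler_nat.
have /andP[V0 _] := sieve_V01 hsieve l.+1 w.
have Vl := sieve_V_le hsieve w il.
case: (boolP (_ < _ <= _)) => //= /andP[h1 h2].
by rewrite (lt_trans V0 h1) (le_trans h2 Vl).
Qed.

(** If [1 - W l] is not small then the conditional mean of the number of balls is at
    least twice [n `^ (1 - u)], so this level is reached unless the number of balls is
    less than half of its mean. *)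
Lemma fail_weight_ge1 u l i w : 0 <= u <= 1 -> (l < i)%N ->
  expR ((dd - u) * x) <= V i w -> (Z n l w)%:R <= n%:R `^ (1 - u) ->
  1 <= fail_weight l w.
Proof.
move=> /andP[u0 u1] li hV; rewrite n_pow => hZ; rewrite /fail_weight.
have dev0 := box_deviation_ge0 l w.
have c0 : 0 <= 4 / (ep * expR (dd * x) * n%:R) * box_deviation W U n l w.
  by rewrite mulr_ge0// divr_ge0// ?mulr_ge0 ?expR_ge0 ?(ltW ep0).
case: (ltP (1 - W l w) ep) => hep.
  by rewrite mulr1n lerDl.
rewrite add0r.
set p := box_prob W l w.
have p0 : 0 < p by exact: (box_prob_gt0 hsieve).
have hp : p = V l w * (1 - W l w) by rewrite /p /box_prob sieve_VS; ring.
have Vl : V i w <= V l w by apply: (sieve_V_le hsieve); exact: ltnW.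
have hnp : ep * expR (dd * x) * expR ((1 - u) * x) <= n%:R * p.
  have -> : ep * expR (dd * x) * expR ((1 - u) * x) =
      n%:R * (expR ((dd - u) * x) * ep).
    rewrite nx mulrA -expRD -mulrA -expRD mulrC; congr (expR _ * _); ring.
  rewrite ler_wpM2l ?(ltW n0)// hp ler_pM ?expR_ge0 ?(ltW ep0)//.
  exact: le_trans Vl.
have e1 : 1 <= expR ((1 - u) * x).
  by rewrite -[leLHS]expR0 ler_expR mulr_ge0 ?subr_ge0 ?(ltW x0).
have e2 : 2 * expR ((1 - u) * x) <= n%:R * p.
  by rewrite (le_trans _ hnp)// ler_wpM2r// expR_ge0.
have hdev : (n%:R * p) ^+ 2 / 4 <= ((Z n l w)%:R - n%:R * p) ^+ 2.
  have : 0 <= (Z n l w)%:R :> R by [].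
  nra.
have E0 : 0 < ep * expR (dd * x) by rewrite mulr_gt0 ?expR_gt0.
rewrite /box_deviation -/p.
have -> : 4 / (ep * expR (dd * x) * n%:R) * (p^-1 * ((Z n l w)%:R - n%:R * p) ^+ 2) =
   4 * ((Z n l w)%:R - n%:R * p) ^+ 2 / (ep * expR (dd * x) * (n%:R * p)).
  by field; rewrite !gt_eqF ?expR_gt0.
have np0 : 0 < n%:R * p by rewrite mulr_gt0.
rewrite ler_pdivlMr ?mulr_gt0 ?expR_gt0// mul1r.
have : ep * expR (dd * x) <= n%:R * p.
  by rewrite (le_trans _ hnp)// ler_peMr// ltW.
nra.
Qed.

(** The tolerance [dl] leaves room for a factor [1 + dl] between [q i] and [expR (- u)],
    that is, for a power [n `^ ln (1 + dl)] between [V (i * k)] and [n `^ (- u)]. This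
    power absorbs the factor [ep] and the fluctuations of the number of balls; the
    count of boxes is then exact up to the exceptional boxes and up to the rounding of
    [b / N] to [k]. *)
Lemma sieve_consistent w : bad_weight w < 1 ->
  consistent N (fun i => V (i * k)%N w `^ x^-1) (fun t => b^-1 * K n t w) dl.
Proof.
move=> hbad i iL.
have n0' : (0 < n)%N by exact: ltn_trans n1.
have Nr : 0 < N%:R :> R by rewrite ltr0n.
have s1 : 0 <= \sum_(j < (N * N).+1) expR (- (dd / 2 * x)) / n%:R *
     ((V (j * k)%N w)^-1 * tail_balls W U n (j * k)%N w).
  by apply: sumr_ge0 => j _; exact: tail_term_ge0.
have s2 : 0 <= 2 / (dl * b) * \sum_(l < N * N * k) fail_weight l w.
  rewrite mulr_ge0 ?divr_ge0 ?mulr_ge0 ?(ltW dl0) ?(ltW b0)//.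
  by apply: sumr_ge0 => l _; exact: fail_weight_ge0.
have /andP[Vi0 Vi1] := sieve_V01 hsieve (i * k)%N w.
have htail : tail_balls W U n (i * k)%N w < expR ((1 + dd / 2) * x) * V (i * k)%N w.
  have h1 : expR (- (dd / 2 * x)) / n%:R *
     ((V (i * k)%N w)^-1 * tail_balls W U n (i * k)%N w) < 1.
    apply: le_lt_trans hbad; rewrite /bad_weight.
    rewrite (bigD1 (Ordinal (iL : (i < (N * N).+1)%N)))//= -!addrA lerDl.
    rewrite addr_ge0//; apply: sumr_ge0 => j _; exact: tail_term_ge0.
  have -> : expR ((1 + dd / 2) * x) = n%:R / expR (- (dd / 2 * x)).
    by rewrite nx expRN invrK -expRD; congr expR; ring.
  rewrite mulrAC ltr_pdivlMr ?expR_gt0//.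
  have nV : 0 < n%:R * V (i * k)%N w by rewrite mulr_gt0.
  have E0 := expR_gt0 (- (dd / 2 * x)).
  have -> : tail_balls W U n (i * k)%N w * expR (- (dd / 2 * x)) =
      expR (- (dd / 2 * x)) / n%:R * ((V (i * k)%N w)^-1 * tail_balls W U n (i * k)%N w)
      * (n%:R * V (i * k)%N w).
    by field; rewrite !gt_eqF.
  by rewrite -[ltRHS]mul1r ltr_pM2r.
have hfail : \sum_(l < N * N * k) fail_weight l w < b * (dl / 2).
  have h1 : 2 / (dl * b) * \sum_(l < N * N * k) fail_weight l w < 1.
    by apply: le_lt_trans hbad; rewrite /bad_weight lerDr.
  have dlb : 0 < dl * b by rewrite mulr_gt0.
  move: h1; rewrite mulrAC ltr_pdivrMr// mul1r => h1.
  have -> : b * (dl / 2) = dl * b / 2 by field.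
  by rewrite ltr_pdivlMr// mulrC.
have qV (q : R) : 0 <= q -> (q <= V (i * k)%N w `^ x^-1) -> q `^ x <= V (i * k)%N w.
  move=> q0 hq; rewrite -[leRHS](powRr1 (ltW Vi0)) -(mulVf (lt0r_neq0 x0)) powRrM.
  by apply: ge0_ler_powR => //; rewrite ?nnegrE ?powR_ge0 ?ltW.
have qV' (q : R) : 0 <= q -> (V (i * k)%N w `^ x^-1 <= q) -> V (i * k)%N w <= q `^ x.
  move=> q0 hq; rewrite -[leLHS](powRr1 (ltW Vi0)) -(mulVf (lt0r_neq0 x0)) powRrM.
  by apply: ge0_ler_powR => //; rewrite ?nnegrE ?powR_ge0 ?ltW.
have ik : (i * k)%:R <= b * (i%:R / N%:R).
  have -> : b * (i%:R / N%:R) = i%:R * (b / N%:R) by field; rewrite gt_eqF.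
  by rewrite natrM ler_wpM2l// ler_pdivlMr.
have ik2 : b * (i%:R / N%:R - dl / 2) <= (i * k)%:R.
  have h1 : b * (i%:R / N%:R) <= (i * k)%:R + i%:R.
    have -> : b * (i%:R / N%:R) = i%:R * (b / N%:R) by field; rewrite gt_eqF.
    have -> : (i * k)%:R + i%:R = i%:R * (k%:R + 1) :> R by rewrite natrM; ring.
    by rewrite ler_wpM2l// ler_pdivrMr// ltW.
  have h2 : i%:R <= (N * N)%:R :> R by rewrite ler_nat.
  by rewrite mulrBr lerBlDr (le_trans h1)// lerD2l (le_trans h2).
have upper u : 0 <= u -> V (i * k)%N w `^ x^-1 <= expR (- u) - dl -> u <= 1 ->
    tail_balls W U n (i * k)%N w < expR ((1 - u - dd / 2) * x).
  move=> u0 hq u1.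
  have hq' : V (i * k)%N w `^ x^-1 <= expR (- (u + dd)).
    rewrite (le_trans hq)// opprD expRD [expR (- dd)]expRN ddE ler_pdivlMr ?addr_gt0//.
    have : expR (- u) <= 1 by rewrite -[leRHS]expR0 ler_expR oppr_le0.
    move=> E1; have : 0 <= dl * (1 - expR (- u)) by rewrite mulr_ge0 ?subr_ge0// ltW.
    have : 0 <= dl * dl by rewrite mulr_ge0// ltW.
    rewrite mulrBl mulrDr mulr1; lra.
  have hV := qV' _ (expR_ge0 _) hq'.
  rewrite (lt_le_trans htail)//.
  rewrite (le_trans (ler_wpM2l (expR_ge0 _) hV))//.
  rewrite /powR gt_eqF ?expR_gt0// expRK -expRD ler_expR.
  rewrite le_eqVlt; apply/orP; left; apply/eqP; by field.
split.
- move=> u u01 hq; have /andP[u0 u1] := u01.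
  have hq' : expR (dd - u) <= V (i * k)%N w `^ x^-1.
    rewrite (le_trans _ hq)// expRD ddE mulrDl mul1r lerD2l ler_piMr// ?(ltW dl0)//.
    by rewrite -[leRHS]expR0 ler_expR oppr_le0.
  have hV := qV _ (expR_ge0 _) hq'.
  have {}hV : expR ((dd - u) * x) <= V (i * k)%N w.
    by move: hV; rewrite /powR gt_eqF ?expR_gt0// expRK mulrC.
  have := count_lower hsieve (phi := fail_weight^~ w) n0' u01
    (fun l => fail_weight_ge0 l w) (fun l li h => fail_weight_ge1 u01 li hV h).
  have hs : \sum_(l < i * k) fail_weight l w <= \sum_(l < N * N * k) fail_weight l w.
    have : (i * k <= N * N * k)%N by rewrite leq_mul2r iL orbT.
    move=> /subnKC <-; rewrite big_split_ord /= lerDl sumr_ge0// => l _.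
    exact: fail_weight_ge0.
  move=> h; rewrite -mulrBr -(ler_pM2l b0) [leRHS]mulrA mulfV ?gt_eqF// mul1r.
  apply: le_trans h.
  have -> : b * (i%:R / N%:R - dl) = b * (i%:R / N%:R - dl / 2) - b * (dl / 2).
    by field; rewrite gt_eqF.
  by rewrite lerB// (le_trans hs)// ltW.
- move=> u u01 hq; have /andP[u0 u1] := u01.
  have ht := upper u u0 hq u1.
  have := @count_upper _ _ _ _ _ _ _ _ _ _ hsieve n (i * k)%N u w n0' u01.
  move=> h; rewrite -mulrBr -(ler_pM2l b0) [leLHS]mulrA mulfV ?gt_eqF// mul1r.
  apply: le_trans (h _) _.
    move=> l il; rewrite (le_trans (sieve_Z_le_tail w il))// (le_trans (ltW ht))//.
    rewrite n_pow ler_expR ler_wpM2r ?(ltW x0)// gerBl divr_ge0// ltW//.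
  rewrite mulrDr (le_trans ik)// lerDl mulr_ge0 ?(ltW b0)// ltW//.
- move=> hq.
  have ht := upper 1 ler01 hq (lexx _).
  rewrite -(ler_pM2l b0) mulrA mulfV ?gt_eqF// mul1r.
  rewrite (@le_trans _ _ (i * k)%:R)//; last first.
    by rewrite mulrDr (le_trans ik)// lerDl mulr_ge0 ?(ltW b0) ?(ltW dl0).
  apply: (count_all hsieve) => // l il; apply/eqP.
  rewrite -leqn0 -ltnS -(ltr_nat R) (le_lt_trans (sieve_Z_le_tail w il))//.
  rewrite (lt_le_trans ht)// subrr sub0r -[leRHS]expR0 ler_expR mulNr oppr_le0.
  by rewrite mulr_ge0 ?divr_ge0 ?(ltW dd0) ?(ltW x0).
Qed.

End sieve_consistent.

Section bad_event.
Context (R : realType) d (T : measurableType d) (P : probability T R)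
  (W U : nat -> {RV P >-> R})
  d0 (T0 : measurableType d0) (P0 : probability T0 R) (W0 : {RV P0 >-> R}).
Hypothesis hW0 : forall w, 0 < W0 w < 1.
Hypothesis hsieve : bernoulli_sieve W U W0.
Local Notation V := (sieve_V W).

Definition flat_prob (ep : R) : R := fine (P0 [set v | 1 - W0 v < ep]).

Let measurable_flat ep : measurable [set v | 1 - W0 v < ep].
Proof.
have m1 : measurable_fun setT (fun v => 1 - W0 v) by exact: measurable_funB.
rewrite (_ : mkset _ = (fun v => 1 - W0 v) @^-1` `]-oo, ep[%classic).
  by rewrite -[X in measurable X]setTI; exact: m1.
by apply/seteqP; split => v /=; rewrite in_itv.
Qed.

(** [1 - W0] is positive, so its distribution has no mass at 0. *)
Lemma flat_prob_small (e : R) : 0 < e -> exists2 ep, 0 < ep & flat_prob ep < e.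
Proof.
move=> e0.
pose F n := [set v | 1 - W0 v < n.+1%:R^-1].
have cF : P0 \o F @ \oo --> P0 (\bigcap_n F n).
  apply: nonincreasing_cvg_mu => //.
  - by rewrite (le_lt_trans (probability_le1 _ _)) ?ltry//; exact: measurable_flat.
  - by move=> n; exact: measurable_flat.
  - by apply: bigcap_measurable => // n _; exact: measurable_flat.
  - move=> m n mn; apply/subsetPset => v; rewrite /F/= => /lt_le_trans; apply.
    by rewrite lef_pV2 ?posrE ?ltr0n// ler_nat.
have F0 : \bigcap_n F n = set0.
  apply/seteqP; split => // v hv; have /andP[_ w1] := hW0 v.
  have w0 : 0 < 1 - W0 v by rewrite subr_gt0.
  have := hv (Num.truncn (1 - W0 v)^-1) I; rewrite /F/= ltNge => /negP; apply.
  by rewrite -[leRHS]invrK lef_pV2 ?posrE ?invr_gt0 ?ltr0n// ltW// truncnS_gt.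
rewrite F0 measure0 in cF.
have hf : (fine \o (P0 \o F)) @ \oo --> (0 : R) by exact: fine_cvg.
have /cvgrPdist_lt/(_ e e0)[N _ /(_ N (leqnn N))] := hf.
rewrite /= sub0r normrN => h; exists N.+1%:R^-1 => //.
exact: le_lt_trans (ler_norm _) h.
Qed.

Variables (n N k : nat) (dl ep b : R).
Hypothesis n1 : (1 < n)%N.
Hypothesis dl0 : 0 < dl.
Hypothesis ep0 : 0 < ep.
Hypothesis b0 : 0 < b.
Let n0 : 0 < n%:R :> R. Proof. by rewrite ltr0n (ltn_trans _ n1). Qed.
Let x : R := ln n%:R.
Let dd : R := ln (1 + dl).

Let flatE l : (\int[P]_w ((1 - W l w < ep)%R%:R : R)%:E = (flat_prob ep)%:E)%E.
Proof.
have [_ hlaw _ _] := hsieve.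
pose B : set R := [set r | 1 - r < ep].
have mB : measurable B.
  rewrite (_ : B = `]1 - ep, +oo[%classic) //.
  by apply/seteqP; split => r; rewrite /B /= in_itv/= andbT; lra.
have e1 : (P (W l @^-1` B) = (flat_prob ep)%:E)%E.
  rewrite /flat_prob fineK; first exact: (hlaw l _ mB).
  by rewrite fin_num_measure//; exact: measurable_flat.
have mA : measurable (W l @^-1` B).
  by rewrite -[X in measurable X]setTI; exact: measurable_funPT.
rewrite -e1 -[in RHS](setIT (_ @^-1` _)) -integral_indic//.
apply: eq_integral => w _; rewrite indicE; congr (_%:E).
by congr (_%:R); congr nat_of_bool; apply/idP/idP; rewrite inE.
Qed.

Let measurable_flat_ind l : measurable_fun setT (fun w => (1 - W l w < ep)%R%:R : R).
Proof.
apply: measurable_natr_bool => //.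
by apply: measurable_fun_ltr => //; exact: measurable_funB.
Qed.

Let cf := 4 / (ep * expR (dd * x) * n%:R).
Let cf0 : 0 <= cf.
Proof. by rewrite /cf divr_ge0// ?mulr_ge0 ?expR_ge0 ?(ltW ep0). Qed.

Let fail_ge0 l w : 0 <= fail_weight W U n dl ep l w.
Proof. exact: (fail_weight_ge0 hsieve). Qed.

Let dev_ge0 l w : 0 <= box_deviation W U n l w.
Proof. by rewrite mulr_ge0 ?sqr_ge0// invr_ge0 ltW// (box_prob_gt0 hsieve). Qed.

Let mdev l : measurable_fun setT (box_deviation W U n l).
Proof. exact: (measurable_box_deviation hsieve). Qed.

Lemma measurable_fail_weight l : measurable_fun setT (fail_weight W U n dl ep l).
Proof. by apply: measurable_funD => //; exact: measurable_funM. Qed.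

Lemma integral_fail_weight l :
  (\int[P]_w (fail_weight W U n dl ep l w)%:E <=
   (flat_prob ep + 4 / (ep * expR (dd * x)))%:E)%E.
Proof.
under eq_integral do rewrite /fail_weight EFinD EFinM.
rewrite ge0_integralD//; last 3 first.
- exact/measurable_EFinP.
- by move=> w _; rewrite -EFinM lee_fin mulr_ge0.
- by apply/measurable_EFinP; exact: measurable_funM.
rewrite flatE ge0_integralZl//; last 2 first.
- exact/measurable_EFinP.
- by move=> w _; rewrite lee_fin.
rewrite EFinD leeD2l// (le_trans (lee_wpmul2l _ (integral_box_deviation hsieve n l)))//.
rewrite -EFinM lee_fin /cf -/x -/dd le_eqVlt; apply/orP; left; apply/eqP.
by field; rewrite !gt_eqF ?expR_gt0.
Qed.

Let tail_ge0 i w : 0 <= (V i w)^-1 * tail_balls W U n i w.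
Proof.
rewrite mulr_ge0 ?sumr_ge0//.
by rewrite invr_ge0 ltW//; case/andP: (sieve_V01 hsieve i w).
Qed.

Let mtail i : measurable_fun setT (fun w => (V i w)^-1 * tail_balls W U n i w).
Proof.
apply: measurable_funM; last first.
  apply: measurable_tail_balls.
apply: measurable_inv_pos; first exact: measurable_sieve_V.
by move=> w; case/andP: (sieve_V01 hsieve i w) => /ltW.
Qed.

Let ct := expR (- (dd / 2 * x)) / n%:R.
Let ct0 : 0 <= ct. Proof. by rewrite divr_ge0 ?expR_ge0. Qed.

Let cs := 2 / (dl * b).
Let cs0 : 0 <= cs. Proof. by rewrite divr_ge0 ?mulr_ge0 ?ltW. Qed.

Lemma bad_weight_ge0 w : 0 <= bad_weight W U n N k dl ep b w.
Proof.
rewrite addr_ge0 ?sumr_ge0//; first by move=> i _; exact: mulr_ge0.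
by rewrite mulr_ge0// sumr_ge0.
Qed.

Lemma measurable_bad_weight : measurable_fun setT (bad_weight W U n N k dl ep b).
Proof.
apply: measurable_funD.
  by apply: measurable_sum => i; exact: measurable_funM.
by apply: measurable_funM => //; apply: measurable_sum => l; exact: measurable_fail_weight.
Qed.

Hypothesis kb : k%:R * N%:R <= b.

Lemma integral_bad_weight :
  (\int[P]_w (bad_weight W U n N k dl ep b w)%:E <=
   ((N * N).+1%:R * expR (- (dd / 2 * x)) +
    2 / dl * N%:R * (flat_prob ep + 4 / (ep * expR (dd * x))))%:E)%E.
Proof.
under eq_integral do rewrite /bad_weight EFinD EFinM -!sumEFin.
rewrite ge0_integralD//; last 4 first.
- by move=> w _; rewrite sume_ge0// => i _; rewrite lee_fin mulr_ge0.
- apply: emeasurable_sum => i; apply/measurable_EFinP; exact: measurable_funM.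
- move=> w _; rewrite mule_ge0 ?lee_fin// sume_ge0// => l _; rewrite lee_fin.
  exact: fail_ge0.
- apply: emeasurable_funM => //; apply: emeasurable_sum => l.
  exact/measurable_EFinP/measurable_fail_weight.
rewrite EFinD; apply: leeD.
  rewrite ge0_integral_sum//; last 2 first.
  - by move=> i; apply/measurable_EFinP; exact: measurable_funM.
  - by move=> i w _; rewrite lee_fin mulr_ge0.
  rewrite -sum_cst_EFin; apply: lee_sum => i _.
  under eq_integral do rewrite EFinM.
  rewrite ge0_integralZl//; last 2 first.
  - exact/measurable_EFinP.
  - by move=> w _; rewrite lee_fin.
  rewrite (integral_tail_balls hsieve) -EFinM lee_fin /ct divfK ?gt_eqF//.
rewrite ge0_integralZl//; last 2 first.
- apply: emeasurable_sum => l; exact/measurable_EFinP/measurable_fail_weight.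
- by move=> w _; rewrite sume_ge0// => l _; rewrite lee_fin; exact: fail_ge0.
rewrite ge0_integral_sum//; last 2 first.
- by move=> l; exact/measurable_EFinP/measurable_fail_weight.
- by move=> l w _; rewrite lee_fin; exact: fail_ge0.
set c := flat_prob ep + _.
have c0 : 0 <= c.
  by rewrite addr_ge0 ?fine_ge0// divr_ge0// mulr_ge0 ?expR_ge0 ?(ltW ep0).
have hs : (\sum_(l < N * N * k) \int[P]_w (fail_weight W U n dl ep l w)%:E <=
    ((N * N * k)%:R * c)%:E)%E.
  by rewrite -sum_cst_EFin; apply: lee_sum => l _; exact: integral_fail_weight.
apply: (le_trans (lee_wpmul2l _ hs)); first by rewrite lee_fin.
rewrite -EFinM lee_fin mulrA ler_wpM2r//.
have -> : cs * (N * N * k)%:R = 2 / dl * N%:R * ((k%:R * N%:R) / b).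
  by rewrite /cs !natrM; field; rewrite !gt_eqF.
rewrite ler_piMr//; last by rewrite ler_pdivrMr// mul1r.
by rewrite mulr_ge0// divr_ge0// ltW.
Qed.

(** Truncation at 1 makes the weight bounded and does not change the event on which it
    is less than 1. *)
Definition bad_indicator w : R := Num.min 1 (bad_weight W U n N k dl ep b w).

Lemma bmeas_bad_indicator : bmeas bad_indicator.
Proof.
split; first by apply: measurable_minr => //; exact: measurable_bad_weight.
exists 1 => w; rewrite ger0_norm /bad_indicator ?ge_min ?lexx//.
by rewrite le_min ler01 bad_weight_ge0.
Qed.

Lemma Ex_bad_indicator : Ex P bad_indicator <=
  (N * N).+1%:R * expR (- (dd / 2 * x)) +
    2 / dl * N%:R * (flat_prob ep + 4 / (ep * expR (dd * x))).
Proof.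
rewrite -lee_fin -(bmeas_fin P bmeas_bad_indicator) unlock.
apply: le_trans integral_bad_weight; apply: ge0_le_integral => //.
- by move=> w _; rewrite lee_fin le_min ler01 bad_weight_ge0.
- by apply/measurable_EFinP; have [] := bmeas_bad_indicator.
- by apply/measurable_EFinP; exact: measurable_bad_weight.
- by move=> w _; rewrite lee_fin ge_min lexx orbT.
Qed.

End bad_event.

Section consistent_whp.
Context (R : realType) d (T : measurableType d) (P : probability T R)
  (W U : nat -> {RV P >-> R})
  d0 (T0 : measurableType d0) (P0 : probability T0 R) (W0 : {RV P0 >-> R}).
Variables (alpha : R) (l : R -> R).
Hypothesis hW0 : forall w, 0 < W0 w < 1.
Hypothesis hsieve : bernoulli_sieve W U W0.
Hypothesis halpha : 0 < alpha < 1.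
Hypothesis hl : slowly_varying l.
Hypothesis htail :
  log_tail W0 x / (x `^ (- alpha) * l x) @[x --> +oo] --> (1 : R).
Local Notation b := (scaling alpha l).

Lemma cvg_scaling_ln : b (ln n%:R) @[n --> \oo] --> +oo.
Proof.
have h := cvg_scaling_pinfty hl htail (log_tail_cvg0 W0).
exact: (cvg_comp (fun n : nat => ln n%:R) b (@cvg_ln_natr R) h).
Qed.

(** First [ep] is chosen so small that few boxes have [1 - W l < ep], then [n] so large
    that the powers of [n] dominate. *)
Lemma sieve_consistent_whp N (dl e : R) : (0 < N)%N -> 0 < dl -> 0 < e ->
  \forall n \near \oo, exists h : T -> R,
    [/\ bmeas h, forall w, 0 <= h w, Ex P h <= e &
     forall w, h w < 1 -> consistent N
       (fun i => sieve_V W (i * Num.truncn (N%:R^-1 * b (ln n%:R)))%N w `^ (ln n%:R)^-1)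
       (fun t => (b (ln n%:R))^-1 * sieve_K W U n t w) dl].
Proof.
move=> N0 dl0 e0; have Nr : 0 < N%:R :> R by rewrite ltr0n.
have c0 : 0 < 2 / dl * N%:R by rewrite mulr_gt0// divr_gt0.
have e30 : 0 < e / 3 / (2 / dl * N%:R) by rewrite divr_gt0// divr_gt0.
have [ep ep0 hep] := flat_prob_small hW0 e30.
have dd0 : 0 < ln (1 + dl) by rewrite ln_gt0// ltrDl.
have xoo := (cvgryPge _).1 (@cvg_ln_natr R).
have boo := (cvgryPge _).1 cvg_scaling_ln.
pose A := 4 / ep / (e / 3 / (2 / dl * N%:R)).
pose B := (N * N).+1%:R / (e / 3) : R.
have A0 : 0 < A by rewrite /A divr_gt0// divr_gt0.
have B0 : 0 < B by rewrite /B !divr_gt0// ltr0n.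
near=> n.
have n1 : (1 < n)%N by near: n; exact: nbhs_infty_gt.
set x := ln n%:R.
have x1 : 2 / ep <= ln (1 + dl) * x.
  rewrite [leRHS]mulrC -ler_pdivrMr//; rewrite /x; near: n.
  exact: xoo.
have x2 : A <= ln (1 + dl) * x.
  rewrite [leRHS]mulrC -ler_pdivrMr//; rewrite /x; near: n.
  exact: xoo.
have x3 : B <= ln (1 + dl) / 2 * x.
  rewrite [leRHS]mulrC -ler_pdivrMr ?divr_gt0//; rewrite /x; near: n.
  exact: xoo.
have b0 : 0 < b x.
  by rewrite (lt_le_trans ltr01)//; rewrite /x; near: n; exact: boo.
have bL : (N * N)%:R <= b x * (dl / 2).
  rewrite -ler_pdivrMr ?divr_gt0//; rewrite /x; near: n.
  exact: boo.
have exp_big z y : z <= y -> z <= expR y :> R.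
  by move=> zy; have := expR_ge1Dx y; lra.
have x1' := exp_big _ _ x1; have x2' := exp_big _ _ x2; have x3' := exp_big _ _ x3.
set k := Num.truncn _.
have Nb0 : 0 <= N%:R^-1 * b x by rewrite mulr_ge0 ?invr_ge0 ?ltW.
have /andP[hk1 hk2] := truncn_itv Nb0.
have kb : k%:R * N%:R <= b x.
  by rewrite -ler_pdivlMr// mulrC.
have bk : b x < (k%:R + 1) * N%:R.
  by rewrite -ltr_pdivrMr// mulrC natr1.
have hx : 2 <= ep * expR (ln (1 + dl) * x).
  by rewrite mulrC -ler_pdivrMr.
exists (bad_indicator W U n N k dl ep (b x)); split.
- exact: (bmeas_bad_indicator hsieve).
- by move=> w; rewrite le_min ler01 (bad_weight_ge0 hsieve).
- apply: (le_trans (Ex_bad_indicator hsieve n1 dl0 ep0 b0 kb)).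
  have h1 : (N * N).+1%:R * expR (- (ln (1 + dl) / 2 * ln n%:R)) <= e / 3.
    rewrite expRN ler_pdivrMr ?expR_gt0// mulrC -ler_pdivrMr ?divr_gt0//.
  have h2 : 2 / dl * N%:R * flat_prob W0 ep <= e / 3.
    by rewrite mulrC -ler_pdivlMr// ltW.
  have h3 : 2 / dl * N%:R * (4 / (ep * expR (ln (1 + dl) * ln n%:R))) <= e / 3.
    rewrite mulrC -ler_pdivlMr// invfM mulrA ler_pdivrMr ?expR_gt0//.
    by rewrite [leRHS]mulrC -ler_pdivrMr.
  rewrite mulrDr; lra.
- move=> w hw; apply: (sieve_consistent hsieve n1 N0 dl0 ep0 b0 hx kb bk bL).
  by move: hw; rewrite /bad_indicator gt_min ltxx.
Unshelve. all: by end_near. Qed.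

End consistent_whp.

(** * From moments to Lipschitz functions *)

Section moments.
Context (R : realType) d (T : measurableType d) (P : probability T R)
  d' (T' : measurableType d') (Q : probability T' R).
Variables (L : nat) (X : nat -> T -> nat -> R) (Y : T' -> nat -> R).
Hypothesis X01 : forall n w, cube (X n w).
Hypothesis Y01 : forall w, cube (Y w).
Hypothesis mX : forall n i, measurable_fun setT (fun w => X n w i).
Hypothesis mY : forall i, measurable_fun setT (fun w => Y w i).
Hypothesis XY : forall m : nat -> nat,
  Ex P (fun w => \prod_(i < L) X n w i ^+ m i) @[n --> \oo] -->
  Ex Q (fun w => \prod_(i < L) Y w i ^+ m i).

Let bounded01 d1 (T1 : measurableType d1) (f : T1 -> R) :
  measurable_fun setT f -> (forall w, 0 <= f w <= 1) -> bmeas f.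
Proof.
move=> mf f01; split=> //; exists 1 => w; have /andP[f0 f1] := f01 w.
by rewrite ger0_norm.
Qed.

(* A uniform limit on the cube of functions whose compositions with [Z] are
   measurable. *)
Let bmeas_lim d1 (T1 : measurableType d1) (Z : T1 -> nat -> R) (h : (nat -> R) -> R) :
  (forall w, cube (Z w)) ->
  (forall e : R, 0 < e -> exists2 k, bmeas (fun w => k (Z w)) &
    forall r, cube r -> `|h r - k r| <= e) -> bmeas (fun w => h (Z w)).
Proof.
move=> Z01 hk.
have /choice[k kP] : forall n : nat, exists k, bmeas (fun w => k (Z w)) /\
    forall r, cube r -> `|h r - k r| <= n.+1%:R^-1.
  by move=> n; have [|k k1 k2] := hk n.+1%:R^-1; [rewrite invr_gt0|exists k].
split.
  apply: (@measurable_fun_cvg _ _ _ _ (fun n w => k n (Z w))) => //.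
    by move=> n; have [[]] := kP n.
  move=> w _; apply/cvgrPdist_le => e e0; near=> n.
  have [_ /(_ _ (Z01 w)) /le_trans] := kP n; apply.
  rewrite invf_ple ?posrE// (le_trans (ltW (truncnS_gt _)))// ler_nat ltnS.
  by near: n; exact: nbhs_infty_ge.
have [[_ [M hM]] hd] := kP 0%N; exists (M + 1) => w.
rewrite -[h _](subrK (k 0%N (Z w))) (le_trans (ler_normD _ _))// addrC lerD//.
by rewrite (le_trans (hd _ (Z01 w)))// invr1.
Unshelve. all: by end_near. Qed.

(** The functions whose means converge form a class that is closed under linear
    combinations and uniform limits and contains the monomials. *)
Lemma cvg_Ex_lip (g : (nat -> R) -> R) : lip L g ->
  [/\ forall n, bmeas (fun w => g (X n w)), bmeas (fun w => g (Y w)) &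
    Ex P (fun w => g (X n w)) @[n --> \oo] --> Ex Q (fun w => g (Y w))].
Proof.
apply: (@lip_in_closure R L (fun h => [/\ forall n, bmeas (fun w => h (X n w)),
  bmeas (fun w => h (Y w)) &
  Ex P (fun w => h (X n w)) @[n --> \oo] --> Ex Q (fun w => h (Y w))])).
- move=> h k [h1 h2 h3] [k1 k2 k3]; split.
  + by move=> n; exact: bmeasD.
  + exact: bmeasD.
  + rewrite ExD//; under eq_fun do rewrite ExD//.
    exact: cvgD.
- move=> a h [h1 h2 h3]; split.
  + by move=> n; apply: bmeasM => //; exact: bmeas_cst.
  + by apply: bmeasM => //; exact: bmeas_cst.
  + rewrite ExZ//; under eq_fun do rewrite ExZ//.
    exact: cvgMr.
- move=> h hlim.
  have h1 n : bmeas (fun w => h (X n w)).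
    apply: bmeas_lim => // e e0; have [k [k1 _ _] hk] := hlim e e0.
    by exists k.
  have h2 : bmeas (fun w => h (Y w)).
    apply: bmeas_lim => // e e0; have [k [_ k1 _] hk] := hlim e e0.
    by exists k.
  split => //; apply/cvgrPdist_le => e e0.
  have e30 : 0 < e / 3 by rewrite divr_gt0.
  have [k [k1 k2 k3] hk] := hlim _ e30.
  near=> n.
  have d1 : `|Ex P (fun w => h (X n w)) - Ex P (fun w => k (X n w))| <= e / 3.
    have [_ [M hM]] := h1 n; have [_ [M' hM']] := k1 n.
    by apply: (Ex_dist _ hM hM' (k1 n)) => w; exact: hk.
  have d2 : `|Ex Q (fun w => h (Y w)) - Ex Q (fun w => k (Y w))| <= e / 3.
    have [_ [M hM]] := h2; have [_ [M' hM']] := k2.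
    by apply: (Ex_dist _ hM hM' k2) => w; exact: hk.
  have d3 : `|Ex Q (fun w => k (Y w)) - Ex P (fun w => k (X n w))| <= e / 3.
    by near: n; move/cvgrPdist_le : k3; exact.
  move: d1 d2 d3; rewrite !ler_norml => /andP[? ?] /andP[? ?] /andP[? ?].
  by apply/andP; split; lra.
- move=> m; split => //.
  + move=> n; apply: bmeas_prod => i; apply: bmeas_exp.
    by apply: bounded01 => // w; exact: X01.
  + apply: bmeas_prod => i; apply: bmeas_exp.
    by apply: bounded01 => // w; exact: Y01.
Unshelve. all: by end_near. Qed.

End moments.

(** * Penalized infima over consistent paths *)

Section penalized_inf.
Context (R : realType) (N : nat) (k M : R) (Phi : (R -> R) -> R).
Hypothesis k0 : 0 <= k.
Hypothesis PhiM : forall y, `|Phi y| <= M.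

(** The product of the first [i] ratios plays the role of [expR (- sigma (i / N))]. *)
Definition qprod (r : nat -> R) (i : nat) : R := \prod_(j < i) r j.

Definition penalized (r : nat -> R) : set R :=
  [set v | exists y dl, [/\ path01 y, 0 <= dl, consistent N (qprod r) y dl &
     v = Phi y + k * dl]].

(** The penalty [k * dl] makes this infimum Lipschitz in the data [r], whatever the
    functional, and forces small tolerances when [k] is large. *)
Definition pen_inf r : R := inf (penalized r).

Let qprod01 r i : cube r -> 0 <= qprod r i <= 1.
Proof.
move=> cr; rewrite /qprod prodr_ge0 => [|j _]; last by case/andP: (cr j).
by apply: prodr_ile1 => j _; exact: cr.
Qed.

Let path0 : path01 (fun=> 0 : R).
Proof. by split=> //; exact: cadlag01_cst. Qed.

(** With tolerance 2 consistency is void, which bounds the infimum from above. *)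
Let penalized_path0 r : cube r -> penalized r (Phi (fun=> 0) + k * 2).
Proof.
move=> cr; exists (fun=> 0), 2; split=> // i _.
have /andP[q0 q1] := qprod01 i cr.
split=> [u _|u /andP[u0 _]|]; rewrite ?subrr.
- by have := expR_gt0 (- u); lra.
- have : expR (- u) <= 1 by rewrite -[leRHS]expR0 ler_expR oppr_le0.
  lra.
- have : expR (- 1) <= 1 :> R by rewrite -[leRHS]expR0 ler_expR oppr_le0.
  lra.
Qed.

Let penalized_ge r v : penalized r v -> - M <= v.
Proof.
move=> [y [dl [_ dl0 _ ->]]].
have : 0 <= k * dl by rewrite mulr_ge0.
by have := PhiM y; rewrite ler_norml => /andP[]; lra.
Qed.

Lemma pen_inf_le r y dl : path01 y -> 0 <= dl -> consistent N (qprod r) y dl ->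
  pen_inf r <= Phi y + k * dl.
Proof.
move=> hy dl0 hc; apply: ge_inf; first by exists (- M) => v; exact: penalized_ge.
by exists y, dl.
Qed.

Lemma pen_inf_ge r c : cube r ->
  (forall y dl, path01 y -> 0 <= dl -> consistent N (qprod r) y dl ->
    c <= Phi y + k * dl) -> c <= pen_inf r.
Proof.
move=> cr h; apply: lb_le_inf; first by eexists; exact: penalized_path0.
by move=> v [y [dl [hy dl0 hc ->]]]; exact: h.
Qed.

Lemma pen_inf_bounds r : cube r -> - M <= pen_inf r <= M + 2 * k.
Proof.
move=> cr; apply/andP; split.
  apply: pen_inf_ge => // y dl _ dl0 _.
  have : 0 <= k * dl by rewrite mulr_ge0.
  by have := PhiM y; rewrite ler_norml => /andP[]; lra.
apply: (@le_trans _ _ (Phi (fun=> 0) + k * 2)).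
  apply: ge_inf; last exact: penalized_path0.
  by exists (- M) => v; exact: penalized_ge.
by have := PhiM (fun=> 0); rewrite ler_norml => /andP[]; lra.
Qed.

Let qprod_dist r s i L : cube r -> cube s -> (i <= L)%N ->
  `|qprod r i - qprod s i| <= \sum_(j < L) `|r j - s j|.
Proof.
move=> cr cs iL; apply: (@le_trans _ _ (\sum_(j < i) `|r j - s j|)).
  elim: i {iL} => [|i IH]; first by rewrite /qprod !big_ord0 subrr normr0.
  have -> : qprod r i.+1 - qprod s i.+1 =
      (qprod r i - qprod s i) * r i + qprod s i * (r i - s i).
    by rewrite /qprod !big_ord_recr /=; ring.
  rewrite big_ord_recr /= (le_trans (ler_normD _ _))// lerD//.
    rewrite (le_trans _ IH)// normrM ler_piMr//.
    by have /andP[h0 h1] := cr i; rewrite ger0_norm.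
  rewrite normrM ler_piMl//.
  by have /andP[h0 h1] := qprod01 i cs; rewrite ger0_norm.
by rewrite -(subnKC iL) big_split_ord /= lerDl sumr_ge0.
Qed.

(** Consistency is monotone in the tolerance, so a perturbation of the data is
    paid for by an increase of the tolerance of the same size. *)
Let consistent_shift r s y dl : cube r -> cube s -> consistent N (qprod r) y dl ->
  consistent N (qprod s) y (dl + \sum_(j < N * N) `|r j - s j|).
Proof.
move=> cr cs hc i iN; have [h1 h2 h3] := hc i iN.
set D := \sum_(j < _) _.
have hD : `|qprod r i - qprod s i| <= D by exact: qprod_dist.
have D0 : 0 <= D by exact: sumr_ge0.
move: hD; rewrite ler_distl => /andP[hD1 hD2].
split.
- move=> u u01 hq; have : i%:R / N%:R - dl <= y 1 - y (1 - u) by apply: h1 => //; lra.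
  lra.
- move=> u u01 hq; have : y 1 - y (1 - u) <= i%:R / N%:R + dl by apply: h2 => //; lra.
  lra.
- move=> hq; have : y 1 <= i%:R / N%:R + dl by apply: h3; lra.
  lra.
Qed.

Lemma lip_pen_inf : lip (N * N) pen_inf.
Proof.
have half r s : cube r -> cube s ->
    pen_inf s - k * \sum_(j < N * N) `|r j - s j| <= pen_inf r.
  move=> cr cs; apply: pen_inf_ge => // y dl hy dl0 hc.
  have hD : 0 <= dl + \sum_(j < N * N) `|r j - s j| by rewrite addr_ge0// sumr_ge0.
  have := pen_inf_le hy hD (consistent_shift cr cs hc).
  rewrite mulrDr; lra.
exists k => // r s cr cs; rewrite ler_distl; apply/andP; split.
  exact: half.
have := half _ _ cs cr; rewrite lerBlDr.
by under eq_bigr do rewrite distrC.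
Qed.

End penalized_inf.

(** * Convergence of the block ratios *)

Lemma powR_prod (R : realType) (F : nat -> R) (z : R) k : (forall j, 0 <= F j) ->
  \prod_(j < k) (F j `^ z) = (\prod_(j < k) F j) `^ z.
Proof.
move=> F0; elim: k => [|k IH]; first by rewrite !big_ord0 powR1.
by rewrite !big_ord_recr /= IH powRM// prodr_ge0.
Qed.

Lemma cvg_prod_ord (R : realType) (u : nat -> nat -> R) (c : nat -> R) L :
  (forall i, u i n @[n --> \oo] --> c i) ->
  \prod_(i < L) u i n @[n --> \oo] --> \prod_(i < L) c i.
Proof.
move=> uc; elim: L => [|L IH].
  by rewrite big_ord0; under eq_fun do rewrite big_ord0; exact: cvg_cst.
rewrite big_ord_recr /=; under eq_fun do rewrite big_ord_recr /=.
by apply: cvgM.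
Qed.

Section block_ratio.
Context (R : realType) d (T : measurableType d) (P : probability T R)
  (W U : nat -> {RV P >-> R})
  d0 (T0 : measurableType d0) (P0 : probability T0 R) (W0 : {RV P0 >-> R}).
Hypothesis hW0 : forall w, 0 < W0 w < 1.
Hypothesis hsieve : bernoulli_sieve W U W0.

(** The ratio of [V] at the two ends of a block of [k] boxes, to the power [z]. *)
Definition block_ratio (z : R) (k : nat) (w : T) (i : nat) : R :=
  \prod_(j < k) W (i * k + j)%N w `^ z.

Let W_pow01 z l w : 0 <= z -> 0 <= W l w `^ z <= 1.
Proof.
move=> z0; have [hW _ _ _] := hsieve; have /andP[w0 w1] := hW l w.
by apply: powR01 => //; rewrite w0 ltW.
Qed.

Lemma block_ratio_cube z k w : 0 <= z -> cube (block_ratio z k w).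
Proof.
move=> z0 i; rewrite /block_ratio prodr_ge0 => [|j _]; last exact: powR_ge0.
by apply: prodr_ile1 => j _; exact: W_pow01.
Qed.

Lemma measurable_block_ratio z k i :
  measurable_fun setT (fun w => block_ratio z k w i).
Proof.
apply: measurable_prod => j _.
by apply: (@measurableT_comp _ _ _ _ _ _ (fun v : R => v `^ z)) => //; exact: measurable_powR.
Qed.

Lemma qprod_block_ratio z k w i :
  qprod (block_ratio z k w) i = sieve_V W (i * k)%N w `^ z.
Proof.
have [hW _ _ _] := hsieve.
rewrite /qprod /block_ratio -(prod_blocks (fun l => W l w `^ z)) /sieve_V
  (powR_prod z _ (F := fun l => W l w))//.
by move=> j; have /andP[/ltW] := hW j w.
Qed.

Lemma Ex_block_ratio z k L (m : nat -> nat) : 0 <= z ->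
  Ex P (fun w => \prod_(i < L) block_ratio z k w i ^+ m i) =
  \prod_(i < L) Ex P0 (fun w => (W0 w `^ z) ^+ m i) ^+ k.
Proof.
move=> z0; have [hW hlaw _ hind] := hsieve.
pose X (i : nat + nat) : T -> R := match i with inl k => W k : T -> R | inr j => U j end.
have mX i : measurable_fun setT (X i) by case: i => i /=.
pose f l (v : R) := (v `^ z) ^+ m (l %/ k)%N.
have mf l : measurable_fun setT (f l).
  apply: measurable_funX; exact: measurable_powR.
have e1 w : \prod_(i < L) block_ratio z k w i ^+ m i = partial_prod X inl f (L * k)%N w.
  rewrite /partial_prod (prod_blocks (fun l => f l (W l w))).
  apply: eq_bigr => i _; rewrite /block_ratio -prodrXl; apply: eq_bigr => j _.
  have k0 : (0 < k)%N by exact: leq_ltn_trans (leq0n j) (ltn_ord j).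
  by rewrite /f divnMDl// divn_small// addn0.
rewrite (_ : (fun w => _) = partial_prod X inl f (L * k)%N); last exact/funext.
rewrite (Ex_prod_independent mX hind)//; last 2 first.
- by move=> a b [].
- move=> l w; have /andP[h0 h1] := W_pow01 l w z0.
  by rewrite /f /= exprn_ge0//= exprn_ile1.
rewrite (prod_blocks (fun l => Ex P (fun w => f l (X (inl l) w)))).
apply: eq_bigr => i _.
rewrite (eq_bigr (fun=> Ex P0 (fun w => (W0 w `^ z) ^+ m i))); last first.
  move=> j _; have k0 : (0 < k)%N by exact: leq_ltn_trans (leq0n j) (ltn_ord j).
  rewrite /f divnMDl// divn_small// addn0 /Ex.
  rewrite (Ex_same_law _ _ (hlaw (i * k + j)%N) (f := fun v => (v `^ z) ^+ m i))//.
    by apply: measurable_funX; exact: measurable_powR.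
  by move=> v; rewrite exprn_ge0// powR_ge0.
by rewrite prodr_const card_ord.
Qed.

Variables (alpha : R) (l : R -> R).
Hypothesis halpha : 0 < alpha < 1.
Hypothesis hl : slowly_varying l.
Hypothesis htail :
  log_tail W0 x / (x `^ (- alpha) * l x) @[x --> +oo] --> (1 : R).
Local Notation b := (scaling alpha l).

Context d' (T' : measurableType d') (Q : probability T' R) (S : R -> {RV Q >-> R}).
Hypothesis hS : subordinator S.
Hypothesis hSexp : forall z : R, 0 <= z ->
  laplace_exponent S z = Gamma (1 - alpha) * z `^ alpha.

Lemma ln_natr_inv_ge0 n : 0 <= (ln n%:R : R)^-1.
Proof.
rewrite invr_ge0; case: n => [|n]; first by rewrite ln0.
by rewrite ln_ge0// ler1n.
Qed.

Definition sieve_ratio N n (w : T) : nat -> R :=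
  block_ratio (ln n%:R)^-1 (Num.truncn (N%:R^-1 * b (ln n%:R))) w.

Lemma cvg_Ex_ratio N L (g : (nat -> R) -> R) : (0 < N)%N -> lip L g ->
  [/\ forall n, bmeas (fun w => g (sieve_ratio N n w)),
    bmeas (fun w => g (incr_exp S N ^~ w)) &
    Ex P (fun w => g (sieve_ratio N n w)) @[n --> \oo] -->
    Ex Q (fun w => g (incr_exp S N ^~ w))].
Proof.
move=> N0; have Nr : 0 < N%:R :> R by rewrite ltr0n.
have /andP[a0 a1] := halpha.
have G0 : 0 < Gamma (1 - alpha) by exact: (Gamma_gt0 hW0 halpha hl htail).
apply: cvg_Ex_lip.
- by move=> n w; apply: block_ratio_cube; exact: ln_natr_inv_ge0.
- by move=> w i; have /andP[/ltW -> ->] := incr_exp01 S N i w.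
- by move=> n i; exact: measurable_block_ratio.
- by move=> i; have [] := bmeas_incr_exp S N i.
move=> m; rewrite (Ex_incr_prod a0 hS G0 hSexp)//.
under eq_fun do rewrite Ex_block_ratio ?ln_natr_inv_ge0//.
apply: (cvg_prod_ord (u := fun i n => Ex P0 (fun w => (W0 w `^ (ln n%:R)^-1) ^+ m i)
  ^+ Num.truncn (N%:R^-1 * b (ln n%:R)))
  (c := fun i => expR (- (N%:R^-1 * (Gamma (1 - alpha) * (m i)%:R `^ alpha))))) => i.
by apply: (cvg_block_laplace hW0 halpha hl htail); rewrite invr_gt0.
Qed.

End block_ratio.

(** * Lower bounds for the limits of expectations *)

Section lower_bound.
Context (R : realType) d (T : measurableType d) (P : probability T R)
  (W U : nat -> {RV P >-> R})
  d0 (T0 : measurableType d0) (P0 : probability T0 R) (W0 : {RV P0 >-> R}).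
Hypothesis hW0 : forall w, 0 < W0 w < 1.
Hypothesis hsieve : bernoulli_sieve W U W0.
Variables (alpha : R) (l : R -> R).
Hypothesis halpha : 0 < alpha < 1.
Hypothesis hl : slowly_varying l.
Hypothesis htail :
  log_tail W0 x / (x `^ (- alpha) * l x) @[x --> +oo] --> (1 : R).
Local Notation b := (scaling alpha l).
Context d' (T' : measurableType d') (Q : probability T' R) (S : R -> {RV Q >-> R}).
Hypothesis hS : subordinator S.
Hypothesis hSexp : forall z : R, 0 <= z ->
  laplace_exponent S z = Gamma (1 - alpha) * z `^ alpha.

Definition scaled_sieve n (w : T) (t : R) : R := (b (ln n%:R))^-1 * sieve_K W U n t w.

Definition reversed_passage (w : T') : R -> R := reversed (fun s => S s w).

Variables (Phi : (R -> R) -> R) (M : R).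
Hypothesis PhiM : forall y, `|Phi y| <= M.
Hypothesis Phi_lsc : {ae Q, forall w, forall e : R, 0 < e -> exists2 dl, 0 < dl &
  forall y, path01 y ->
    (forall t, 0 <= t <= 1 -> `|y t - reversed_passage w t| <= dl) ->
  Phi (reversed_passage w) - e <= Phi y}.

Let M0 : 0 <= M. Proof. exact: le_trans (PhiM (fun=> 0)). Qed.

Let near_scaling : \forall n \near \oo, 0 < b (ln n%:R).
Proof.
have /cvgryPge/(_ 1) := cvg_scaling_ln hl htail.
by apply: filterS => n; exact: lt_le_trans.
Qed.

(** Off the bad event the pair of the rescaled sieve and the tolerance [dl] competes in
    the infimum; on the bad event the bounds of the infimum and of [Phi] are used,
    with a weight of small mean. *)
Lemma lower_bound_penalized N k (e : R) : (0 < N)%N -> 0 <= k -> 0 < e ->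
  \forall n \near \oo,
    Ex Q (fun w => pen_inf N k Phi (incr_exp S N ^~ w)) - e <=
    Ex P (fun w => Phi (scaled_sieve n w)).
Proof.
move=> N0 k0 e0.
have [mX mY cXY] := cvg_Ex_ratio hW0 hsieve halpha hl htail hS hSexp N0
  (lip_pen_inf N k0 PhiM).
pose c := 2 * M + 2 * k + 1.
have c0 : 0 < c by rewrite /c ltr_wpDl// addr_ge0// mulr_ge0.
have e3 : 0 < e / 3 by rewrite divr_gt0.
pose dl := e / 3 / (k + 1).
have dl0 : 0 < dl by rewrite divr_gt0// ltr_wpDl.
have kdl : k * dl <= e / 3.
  by rewrite /dl mulrCA ler_piMr ?(ltW e3)// ler_pdivrMr ?ltr_wpDl// mul1r lerDl.
have ec0 : 0 < e / 3 / c by rewrite divr_gt0.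
have hwhp := sieve_consistent_whp hW0 hsieve hl htail N0 dl0 ec0.
near=> n.
have bn : 0 < b (ln n%:R) by near: n; exact: near_scaling.
have hcvg : Ex Q (fun w => pen_inf N k Phi (incr_exp S N ^~ w)) - e / 3 <
    Ex P (fun w => pen_inf N k Phi (sieve_ratio W alpha l N n w)).
  by near: n; move/cvgr_gt : cXY; apply; rewrite ltrBlDr ltrDl.
have [h [bh h0 Eh hh]] : exists h : T -> R,
    [/\ bmeas h, forall w, 0 <= h w, Ex P h <= e / 3 / c &
     forall w, h w < 1 -> consistent N
       (fun i => sieve_V W (i * Num.truncn (N%:R^-1 * b (ln n%:R)))%N w `^ (ln n%:R)^-1)
       (scaled_sieve n w) dl] by near: n; exact: hwhp.
pose G w := pen_inf N k Phi (sieve_ratio W alpha l N n w).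
have G01 w : - M <= G w <= M + 2 * k.
  apply: pen_inf_bounds => //; apply: (block_ratio_cube hsieve).
  exact: ln_natr_inv_ge0.
have hpt w : G w + (- (k * dl)) + (- c) * h w <= Phi (scaled_sieve n w).
  have [h1|h1] := ltP (h w) 1.
    have hy : path01 (scaled_sieve n w).
      by apply: (sieve_path01 hsieve); rewrite invr_ge0 ltW.
    have hc : consistent N (qprod (sieve_ratio W alpha l N n w)) (scaled_sieve n w) dl.
      move: (hh w h1); congr consistent; apply/funext => i.
      by rewrite /sieve_ratio (qprod_block_ratio hsieve).
    have := pen_inf_le k0 PhiM hy (ltW dl0) hc; rewrite -/(G w).
    have : 0 <= c * h w by rewrite mulr_ge0// ltW.
    rewrite mulNr; lra.
  have := G01 w => /andP[_ G1].
  have : c * 1 <= c * h w by rewrite ler_pM2l.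
  have := PhiM (scaled_sieve n w); rewrite ler_norml => /andP[P1 _].
  have : 0 <= k * dl by rewrite mulr_ge0// ltW.
  rewrite mulr1 mulNr /c; lra.
have bG : bmeas G by exact: mX.
have bk : bmeas (fun w => G w + - (k * dl)) by apply: bmeasD => //; exact: bmeas_cst.
have bch : bmeas (fun w => (- c) * h w) by apply: bmeasM => //; exact: bmeas_cst.
have E1 : Ex P (fun w => G w + (- (k * dl)) + (- c) * h w) =
    Ex P G - k * dl - c * Ex P h.
  rewrite (ExD _ bk bch) (ExD _ bG) ?Ex_cst ?(ExZ _ _ bh); last exact: bmeas_cst.
  by rewrite mulNr.
have [_ [B hB]] := bmeasD bk bch.
have E2 : Ex P G - k * dl - c * Ex P h <= Ex P (fun w => Phi (scaled_sieve n w)).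
  rewrite -E1; apply: (@Ex_le _ _ _ _ _ _ (Num.max B M)) => // w.
  - by rewrite le_max hB.
  - by rewrite le_max PhiM orbT.
apply: le_trans E2.
have : c * Ex P h <= e / 3 by rewrite mulrC -ler_pdivlMr.
move: hcvg; rewrite -/G; lra.
Unshelve. all: by end_near. Qed.

Let ae_good : {ae Q, forall w, [/\ strict_path (fun s => S s w),
  forall N i, qprod (incr_exp S N.+1 ^~ w) i = expR (- S (i%:R / N.+1%:R) w) &
  forall e : R, 0 < e -> exists2 dl, 0 < dl &
  forall y, path01 y ->
    (forall t, 0 <= t <= 1 -> `|y t - reversed_passage w t| <= dl) ->
  Phi (reversed_passage w) - e <= Phi y]}.
Proof.
have /andP[a0 a1] := halpha.
have G0 : 0 < Gamma (1 - alpha) by exact: (Gamma_gt0 hW0 halpha hl htail).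
have h1 := ae_strict_path a0 hS G0 hSexp.
have h2 : {ae Q, forall w, forall N i, incr_exp S N.+1 i w = expR (- incr S N.+1 i w)}.
  by apply/ae_foralln => N; exact: ae_grid.
apply: filterS3 h1 h2 Phi_lsc => w s1 s2 s3; split => // N i.
by rewrite /qprod (grid_prod _ _ (sp0 s1)).
Qed.

(** For a large penalty [j], only pairs with a small tolerance compete with the bound
    [M], and their paths are close to the limit path. *)
Lemma pen_inf_liminf w (e : R) : strict_path (fun s => S s w) ->
  (forall N i, qprod (incr_exp S N.+1 ^~ w) i = expR (- S (i%:R / N.+1%:R) w)) ->
  (exists2 dl, 0 < dl & forall y, path01 y ->
    (forall t, 0 <= t <= 1 -> `|y t - reversed_passage w t| <= dl) ->
    Phi (reversed_passage w) - e <= Phi y) -> 0 <= e ->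
  \forall j \near \oo, Phi (reversed_passage w) - e <=
    pen_inf j.+1 j%:R Phi (incr_exp S j.+1 ^~ w).
Proof.
move=> hs hq [dl dl0 hdl] e0.
have [dl1 dl10 [N0 hN0]] := consistent_close hs dl0.
near=> j.
have jN : (N0 <= j.+1)%N.
  by rewrite (@leq_trans j)//; near: j; exact: nbhs_infty_ge.
have jM : 2 * M <= j%:R * dl1.
  rewrite -ler_pdivrMr//; near: j; exact: nbhs_infty_ger.
apply: pen_inf_ge => //.
  by move=> i; have /andP[/ltW -> ->] := incr_exp01 S j.+1 i w.
move=> y dl' hy dl'0 hc.
have jdl : 0 <= j%:R * dl' by rewrite mulr_ge0.
have [dle|/ltW dge] := leP dl' dl1.
  have h : Phi (reversed_passage w) - e <= Phi y.
    apply: hdl => //; apply: (hN0 _ jN dl') => //; first by rewrite dl'0 dle.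
    by move: hc; congr consistent; apply/funext => i; rewrite hq.
  lra.
have : 2 * M <= j%:R * dl' by rewrite (le_trans jM)// ler_wpM2l.
have := PhiM y; have := PhiM (reversed_passage w).
rewrite !ler_norml => /andP[_ ?] /andP[? _]; lra.
Unshelve. all: by end_near. Qed.

(** The mesh [1 / (j + 1)] and the penalty [j] are tied together; the infima lie below
    [Phi] at the limit path and converge to it almost surely. *)
Lemma lower_bound_limit (e : R) : 0 < e -> exists j : nat,
  Ex Q (fun w => Phi (reversed_passage w)) - e <=
  Ex Q (fun w => pen_inf j.+1 j%:R Phi (incr_exp S j.+1 ^~ w)).
Proof.
move=> e0.
have bp j : bmeas (fun w => pen_inf j.+1 j%:R Phi (incr_exp S j.+1 ^~ w)).
  by have [] := cvg_Ex_ratio hW0 hsieve halpha hl htail hS hSexp (ltn0Sn j)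
    (lip_pen_inf j.+1 (ler0n R j) PhiM).
have cu j w : cube (incr_exp S j.+1 ^~ w).
  by move=> i; have /andP[/ltW -> ->] := incr_exp01 S j.+1 i w.
pose g j w := Num.min M (pen_inf j.+1 j%:R Phi (incr_exp S j.+1 ^~ w)).
have mg j : measurable_fun setT (g j).
  by apply: measurable_minr => //; have [] := bp j.
have gM j w : `|g j w| <= M.
  have /andP[h _] := pen_inf_bounds j.+1 (ler0n R j) PhiM (cu j w).
  rewrite ler_norml /g ge_min lexx andbT le_min h andbT.
  by have := M0; lra.
have hcvg : Ex Q (g j) @[j --> \oo] --> Ex Q (fun w => Phi (reversed_passage w)).
  apply: (cvg_Ex_ae (M := M)) => //.
  apply: filterS ae_good => w [hs hq hPhi].
  apply/cvgrPdist_le => r r0; near=> j.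
  have hup : pen_inf j.+1 j%:R Phi (incr_exp S j.+1 ^~ w) <= Phi (reversed_passage w).
    rewrite -[leRHS]addr0 -(mulr0 j%:R); apply: pen_inf_le => //.
      exact: reversed_path01.
    rewrite (_ : qprod _ = fun i => expR (- S (i%:R / j.+1%:R) w)).
      exact: reversed_consistent.
    by apply/funext => i; exact: hq.
  have hlo : Phi (reversed_passage w) - r <=
      pen_inf j.+1 j%:R Phi (incr_exp S j.+1 ^~ w).
    by near: j; exact: (pen_inf_liminf hs hq (hPhi r r0) (ltW r0)).
  have hM : Phi (reversed_passage w) <= M by exact: le_trans (ler_norm _) (PhiM _).
  rewrite /g min_r ?(le_trans hup)//.
  by rewrite ger0_norm ?subr_ge0//; lra.
have [j _ /(_ j (leqnn j)) hj] := (cvgrPdist_lt _ _).1 hcvg e e0.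
exists j; apply: (@le_trans _ _ (Ex Q (g j))).
  by move: hj; rewrite ltr_norml => /andP[_]; lra.
have [_ [B hB]] := bp j.
apply: (@Ex_le _ _ _ _ _ _ (Num.max M B)) => w.
- by rewrite le_max gM.
- by rewrite le_max hB orbT.
- by rewrite /g ge_min lexx orbT.
Unshelve. all: by end_near. Qed.

Lemma lower_bound (e : R) : 0 < e -> \forall n \near \oo,
  Ex Q (fun w => Phi (reversed_passage w)) - e <=
  Ex P (fun w => Phi (scaled_sieve n w)).
Proof.
move=> e0; have e20 : 0 < e / 2 by rewrite divr_gt0.
have [j hj] := lower_bound_limit e20.
have := lower_bound_penalized (ltn0Sn j) (ler0n R j) e20.
by apply: filterS => n; lra.
Qed.

End lower_bound.

(** * Weak convergence in the Skorohod space *)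

Section skorohod_facts.
Variable R : realType.
Implicit Types (y z : R -> R) (F : skorohod R -> R).

(** All the one-sided limits involved are taken from inside [0, 1]. *)
Lemma cadlag01_eq y z : (forall t, 0 <= t <= 1 -> y t = z t) -> cadlag01 y -> cadlag01 z.
Proof.
move=> yz [h1 h2]; split.
- move=> t t01; have /andP[t0 t1] := t01.
  rewrite -yz ?t0 ?(ltW t1)//; apply: cvg_trans (h1 t t01).
  apply: near_eq_cvg; near=> x; apply: yz.
  have tx : t < x by near: x; exact: nbhs_right_gt.
  have x1 : x < 1 by near: x; exact: nbhs_right_lt.
  by rewrite (le_trans t0 (ltW tx)) ltW.
- move=> t t01; have /andP[t0 t1] := t01.
  apply: cvgP; apply: cvg_trans (h2 t t01).
  apply: near_eq_cvg; near=> x; apply: yz.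
  have xt : x < t by near: x; exact: nbhs_left_lt.
  have x0 : 0 < x by near: x; exact: nbhs_left_gt.
  by rewrite (ltW x0) (le_trans (ltW xt)).
Unshelve. all: by end_near. Qed.

Lemma to_DE y : cadlag01 y -> sko_fun (to_D y) = y.
Proof. by rewrite /to_D; case: pselect. Qed.

(** The uniform distance dominates the Skorohod distance: take the identity as
    time change. *)
Lemma continuous_uniform F y : continuous F -> cadlag01 y -> forall e : R, 0 < e ->
  exists2 dl : R, 0 < dl & forall z, cadlag01 z ->
    (forall t, 0 <= t <= 1 -> `|z t - y t| <= dl) ->
  `|F (to_D y) - F (to_D z)| < e.
Proof.
move=> cF cy e e0.
have /cvgrPdist_lt/(_ e e0)/nbhs_ballP[r /= r0 hr] := cF (to_D y).
exists (r / 2); first by rewrite divr_gt0.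
move=> z cz hz; apply: hr; exists id, (r / 2).
  by rewrite ltr_pdivrMr// mulr_natr mulr2n ltrDl.
split; first by split => // u u01; exists u.
move=> t t01; rewrite subrr normr0 !to_DE// distrC; split; last exact: hz.
by rewrite divr_ge0// ltW.
Qed.

Lemma continuous_agree F y z : continuous F -> cadlag01 y ->
  (forall t, 0 <= t <= 1 -> y t = z t) -> F (to_D y) = F (to_D z).
Proof.
move=> cF cy yz; apply/eqP; rewrite -subr_eq0 -normr_le0; apply/ler_addgt0Pr => e e0.
have [dl dl0 h] := continuous_uniform cF cy e0.
rewrite add0r ltW// h//; first exact: cadlag01_eq cy.
by move=> t /yz ->; rewrite subrr normr0 ltW.
Qed.

End skorohod_facts.

Section weak_limit.
Context (R : realType) d (T : measurableType d) (P : probability T R)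
  (W U : nat -> {RV P >-> R})
  d0 (T0 : measurableType d0) (P0 : probability T0 R) (W0 : {RV P0 >-> R}).
Hypothesis hW0 : forall w, 0 < W0 w < 1.
Hypothesis hsieve : bernoulli_sieve W U W0.
Variables (alpha : R) (l : R -> R).
Hypothesis halpha : 0 < alpha < 1.
Hypothesis hl : slowly_varying l.
Hypothesis htail :
  log_tail W0 x / (x `^ (- alpha) * l x) @[x --> +oo] --> (1 : R).
Local Notation b := (scaling alpha l).
Context d' (T' : measurableType d') (Q : probability T' R) (S : R -> {RV Q >-> R}).
Hypothesis hS : subordinator S.
Hypothesis hSexp : forall z : R, 0 <= z ->
  laplace_exponent S z = Gamma (1 - alpha) * z `^ alpha.
Local Notation X := (scaled_sieve W U alpha l).
Local Notation Y := (reversed_passage S).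

Lemma cvg_Ex_path (Phi : (R -> R) -> R) (M : R) : (forall y, `|Phi y| <= M) ->
  {ae Q, forall w, forall e : R, 0 < e -> exists2 dl, 0 < dl &
    forall y, path01 y -> (forall t, 0 <= t <= 1 -> `|y t - Y w t| <= dl) ->
    `|Phi (Y w) - Phi y| < e} ->
  Ex P (fun w => Phi (X n w)) @[n --> \oo] --> Ex Q (fun w => Phi (Y w)).
Proof.
move=> PhiM hPhi; apply/cvgrPdist_le => e e0.
have lo : \forall n \near \oo, Ex Q (fun w => Phi (Y w)) - e <= Ex P (fun w => Phi (X n w)).
  apply: (lower_bound hW0 hsieve halpha hl htail hS hSexp PhiM) => //.
  apply: filterS hPhi => w hw r r0; have [dl dl0 h] := hw r r0; exists dl => // y hy hd.
  by have := h y hy hd; rewrite ltr_norml => /andP[_]; lra.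
have hi : \forall n \near \oo, Ex Q (fun w => - Phi (Y w)) - e <= Ex P (fun w => - Phi (X n w)).
  apply: (lower_bound hW0 hsieve halpha hl htail hS hSexp (Phi := fun y => - Phi y) (M := M)) => //.
    by move=> y; rewrite normrN.
  apply: filterS hPhi => w hw r r0; have [dl dl0 h] := hw r r0; exists dl => // y hy hd.
  by have := h y hy hd; rewrite ltr_norml => /andP[+ _]; lra.
apply: filterS2 lo hi => n; rewrite (ExN _ (fun w => PhiM (Y w))).
rewrite (ExN _ (fun w => PhiM (X n w))) ler_norml => h1 h2.
by apply/andP; split; lra.
Qed.

Variables (A : (R -> R) -> (R -> R)) (X' : nat -> T -> R -> R) (Y' : T' -> R -> R).
Hypothesis A_cadlag : forall y, path01 y -> cadlag01 (A y).
Hypothesis A_cont : {ae Q, forall w, forall e : R, 0 < e -> exists2 dl, 0 < dl &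
    forall y, path01 y -> (forall t, 0 <= t <= 1 -> `|y t - Y w t| <= dl) ->
    forall t, 0 <= t <= 1 -> `|A y t - A (Y w) t| <= e}.
Hypothesis X'_cadlag : forall n w, cadlag01 (X' n w).
Hypothesis X'E : \forall n \near \oo, forall w, X' n w = A (X n w).
Hypothesis Y'E : {ae Q, forall w t, 0 <= t <= 1 -> A (Y w) t = Y' w t}.

(** A continuous mapping principle for a transformation [A] of paths that is
    continuous, for the uniform distance, at almost every limit path. *)
Lemma weak_cvg_transform : weak_cvg_D P Q X' Y'.
Proof.
have /andP[a0 a1] := halpha.
have G0 : 0 < Gamma (1 - alpha) by exact: (Gamma_gt0 hW0 halpha hl htail).
have hY : {ae Q, forall w, path01 (Y w)}.
  apply: filterS (ae_strict_path a0 hS G0 hSexp) => w; exact: reversed_path01.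
have cY : {ae Q, forall w, cadlag01 (A (Y w))}.
  by apply: filterS hY => w; exact: A_cadlag.
split.
- by move=> n; exact: aeW.
- by apply: filterS2 cY Y'E => w h1 h2; exact: cadlag01_eq h1.
move=> F cF [M FM].
have E1 : ('E_Q[fun w => F (to_D (Y' w))] = 'E_Q[fun w => F (to_D (A (Y w)))])%E.
  have e : {ae Q, forall w, F (to_D (A (Y w))) = F (to_D (Y' w))}.
    by apply: filterS2 cY Y'E => w h1 h2; exact: continuous_agree.
  by apply/le_anti/andP; split; apply: expectation_le_ae; apply: filterS e => w ->.
rewrite E1 (@expectation_bounded _ _ _ _ _ M)//.
have h : Ex P (fun w => F (to_D (A (X n w)))) @[n --> \oo] -->
    Ex Q (fun w => F (to_D (A (Y w)))).
  apply: (@cvg_Ex_path (fun y => F (to_D (A y))) M) => //.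
  apply: filterS3 cY A_cont hY => w h1 h2 h3 e e0.
  have [dl dl0 hdl] := continuous_uniform cF h1 e0.
  have [dl' dl'0 hdl'] := h2 dl dl0; exists dl' => // y hy hd.
  by apply: hdl; [exact: A_cadlag|exact: hdl'].
have : (Ex P (fun w => F (to_D (A (X n w)))))%:E @[n --> \oo] -->
    (Ex Q (fun w => F (to_D (A (Y w)))))%:E by apply: cvg_EFin => //; exact: nearW.
apply: cvg_trans; apply: near_eq_cvg; apply: filterS X'E => n hn.
rewrite -(@expectation_bounded _ _ _ _ _ M)//.
by congr expectation; apply/funext => w; rewrite hn.
Qed.

End weak_limit.

Theorem theorem2p5 (R : realType)
    (d0 : measure_display) (T0 : measurableType d0) (P0 : probability T0 R)
    (d : measure_display) (T : measurableType d) (P : probability T R)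
    (d' : measure_display) (T' : measurableType d') (Q : probability T' R)
    (W0 : {RV P0 >-> R}) (W U : nat -> {RV P >-> R})
    (alpha : R) (l : R -> R) (S : R -> {RV Q >-> R})
    (hW0 : forall w, 0 < W0 w < 1)
    (hsieve : bernoulli_sieve W U W0)
    (halpha : 0 < alpha < 1)
    (hl : slowly_varying l)
    (htail : fine (P0 [set w | `|ln (W0 w)| > x]) / (x `^ (- alpha) * l x)
               @[x --> +oo] --> (1 : R))
    (hS : subordinator S)
    (hSexp : forall z : R, 0 <= z ->
       laplace_exponent S z = Gamma (1 - alpha) * z `^ alpha) :
  weak_cvg_D P Q
    (fun n w t => l (ln n%:R) * sieve_K W U n t w / (ln n%:R) `^ alpha)
    (fun w t => first_passage S 1 w - first_passage_left S (1 - t) w)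
  /\
  weak_cvg_D P Q
    (fun n w t => sieve_K W U n t w / sieve_K W U n 1 w)
    (fun w t => 1 - first_passage_left S (1 - t) w / first_passage S 1 w).
Proof.
have /andP[a0 a1] := halpha.
have htail' : log_tail W0 x / (x `^ (- alpha) * l x) @[x --> +oo] --> (1 : R) by exact: htail.
have G0 : 0 < Gamma (1 - alpha) by exact: (Gamma_gt0 hW0 halpha hl htail').
have hstrict := ae_strict_path a0 hS G0 hSexp.
have K_cadlag n w (c : R) : cadlag01 (fun t => c * sieve_K W U n t w).
  by apply: cadlag01Z; exact: (sieve_K_cadlag hsieve).
have leftE w t : strict_path (fun s => S s w) -> 0 <= t <= 1 ->
    first_passage_left S (1 - t) w = passage (fun s => S s w) (1 - t).
  move=> hs /andP[t0 t1]; apply: (passage_leftE hs).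
  by apply/andP; split; lra.
split.
- apply: (weak_cvg_transform hW0 hsieve halpha hl htail' hS hSexp (A := id)).
  + by move=> y [].
  + by apply: aeW => w e e0; exists e.
  + move=> n w; have := K_cadlag n w (l (ln n%:R) / (ln n%:R) `^ alpha).
    by congr cadlag01; apply/funext => t; rewrite mulrAC.
  + apply: nearW => n w; apply/funext => t.
    by rewrite /scaled_sieve /scaling invf_div mulrAC.
  + apply: filterS hstrict => w hs t t01.
    by rewrite leftE.
- apply: (weak_cvg_transform hW0 hsieve halpha hl htail' hS hSexp
    (A := fun y t => y t / y 1)).
  + move=> y [hy _ _]; have := cadlag01Z (y 1)^-1 hy.
    by congr cadlag01; apply/funext => t; rewrite mulrC.
  + apply: filterS hstrict => w hs e e0.
    set y0 := reversed_passage S w.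
    have [_ y0mono y00] := reversed_path01 hs.
    have y01 : 0 < y0 1.
      by rewrite /y0 /reversed_passage /reversed subrr (passage0 hs) subr0 passage1_gt0.
    (* The first bound keeps [y 1] above [y0 1 / 2]; then numerator and denominator
       of the quotient each contribute half of [e]. *)
    exists (Num.min (y0 1 / 2) (e * y0 1 / 4)).
      by rewrite lt_min !divr_gt0// mulr_gt0.
    move=> y _ hy t t01; have /andP[t0 t1] := t01.
    have := hy t t01; have := hy 1 _; rewrite ler01 lexx => /(_ isT).
    rewrite !le_min => /andP[h1 h1'] /andP[_ h2].
    have y1 : y0 1 / 2 <= y 1 by move: h1; rewrite ler_norml => /andP[]; lra.
    have y1_gt0 : 0 < y 1 by rewrite (lt_le_trans _ y1)// divr_gt0.
    have -> : y t / y 1 - y0 t / y0 1 =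
        ((y t - y0 t) * y0 1 + y0 t * (y0 1 - y 1)) / (y 1 * y0 1).
      by field; rewrite !gt_eqF.
    rewrite normrM normfV (ger0_norm (mulr_ge0 (ltW y1_gt0) (ltW y01))).
    rewrite ler_pdivrMr ?mulr_gt0//.
    have yt0 : 0 <= y0 t by rewrite (le_trans y00)// y0mono.
    have yt1 : y0 t <= y0 1 by apply: y0mono.
    have hA : `|(y t - y0 t) * y0 1| <= e * y0 1 / 4 * y0 1.
      by rewrite normrM (ger0_norm (ltW y01)) ler_wpM2r// ltW.
    have hB : `|y0 t * (y0 1 - y 1)| <= y0 1 * (e * y0 1 / 4).
      by rewrite normrM (ger0_norm yt0) ler_pM// distrC.
    rewrite (le_trans (ler_normD _ _))//.
    have hC : e * (y0 1 / 2 * y0 1) <= e * (y 1 * y0 1).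
      by rewrite ler_wpM2l ?(ltW e0)// ler_wpM2r// ltW.
    have e1 : e * (y0 1 / 2 * y0 1) = e * y0 1 / 4 * y0 1 + y0 1 * (e * y0 1 / 4).
      by field.
    lra.
  + move=> n w; have := K_cadlag n w (sieve_K W U n 1 w)^-1.
    by congr cadlag01; apply/funext => t; rewrite mulrC.
  + have /cvgryPge/(_ 1) := cvg_scaling_ln hl htail'.
    apply: filterS => n hn w; apply/funext => t.
    have b0 : scaling alpha l (ln n%:R) != 0 by rewrite gt_eqF// (lt_le_trans ltr01).
    by rewrite /scaled_sieve -mulf_div divff ?invr_eq0// mul1r.
  + apply: filterS hstrict => w hs t t01.
    rewrite leftE// /reversed_passage /reversed subrr (passage0 hs) subr0.
    rewrite mulrBl divff// gt_eqF//; exact: passage1_gt0.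
Qed.
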